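(* Let $\lambda>0$, let $\mathbb{B}_1(0)\subset\mathbb{R}^2$ be the open unit ball and let $\Omega=(-\pi,\pi)\times(-1,1)$. Let $f\in \mathrm{L}^1(\mathbb{B}_1(0))\cap \mathrm{C}(\overline{\mathbb{B}_1(0)})$ be real-valued and compactly supported in $\mathbb{B}_1(0)$, extended by zero to $\mathbb{R}^2$, with Fourier transform $\mathcal{F}f\in \mathrm{L}^1(\mathbb{R}^2)$. Let $\mathcal{R}f$ be the Radon transform of $f$ and $\mathcal{R}^\lambda f$ its modulo Radon transform. Assume $\mathcal{R}f\in \mathrm{C}^2(\overline{\Omega})$ and set, on $\Omega$, $$\mathcal{R}^\lambda_\Delta(f) := \tfrac{\lambda}{\pi}\Bigl[\cos\bigl(\tfrac{\pi}{\lambda}\mathcal{R}^\lambda f\bigr)\,\Delta \sin\bigl(\tfrac{\pi}{\lambda}\mathcal{R}^\lambda f\bigr) - \sin\bigl(\tfrac{\pi}{\lambda}\mathcal{R}^\lambda f\bigr)\,\Delta\cos\bigl(\tfrac{\pi}{\lambda}\mathcal{R}^\lambda f\bigr)\Bigr],$$ where $\Delta=\partial_\vartheta^2+\partial_t^2$. Then $$f(x) = \frac{1}{4\pi}\,\mathcal{B}\Bigl(\mathcal{F}_1^{-1}\bigl[\,|S|\,\mathcal{F}_1\bigl(\Delta^{-1}\mathcal{R}^\lambda_\Delta(f)\bigr)(\vartheta,S)\bigr]\Bigr)(x)$$ holds for all $x\in\mathbb{R}^2$, where $\Delta^{-1}\mathcal{R}^\lambda_\Delta(f)\in \mathrm{H}^1_{\mathrm{per},D}(\mathrm{T}^2)$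 is the (unique) weak solution $u$ of the Poisson problem $\Delta u=\mathcal{R}^\lambda_\Delta(f)$ on $\Omega$ with homogeneous Dirichlet conditions at $t=\pm1$ and $2\pi$-periodic conditions in $\vartheta$.
   Context: Radon transform: for $f\in \mathrm{L}^1(\mathbb{R}^2)$, $$\mathcal{R}f(\vartheta,t)=\int_{\mathbb{R}} f\bigl(t\cos\vartheta-s\sin\vartheta,\;t\sin\vartheta+s\cos\vartheta\bigr)\,\mathrm{d}s .$$ It is regarded as a function of $(\vartheta,t)$; it is $2\pi$-periodic in $\vartheta$, and for $f$ supported in $\mathbb{B}_1(0)$ it vanishes for $|t|\ge 1$. Modulo Radon transform: $\mathcal{R}^\lambda f(\vartheta,t)=\mathcal{M}^\lambda(\mathcal{R}f(\vartheta,t))$ with $\mathcal{M}^\lambda(t)=t-2\lambda\left\lfloor\frac{t+\lambda}{2\lambda}\right\rfloor$. Back projection: $\mathcal{B}g(x)=\int_{-\pi}^{\pi} g(\vartheta,x_1\cos\vartheta+x_2\sin\vartheta)\,\mathrm{d}\vartheta$ for $x=(x_1,x_2)\in\mathbb{R}^2$. Fourier transforms: $\mathcal{F}f(\xi)=\int_{\mathbb{R}^2}f(x)e^{-\mathrm{i}x\cdot\xi}\,\mathrm{d}x$. $\mathcal{F}_1$ is the one-dimensional Fourier transform in the second (radial) variable, $\mathcal{F}_1 g(\vartheta,S)=\int_{\mathbb{R}}g(\vartheta,t)e^{-\mathrm{i}tS}\,\mathrm{d}t$, with inverse $\mathcal{F}_1^{-1}h(\vartheta,t)=\frac{1}{2\pi}\int_{\mathbb{R}}h(\vartheta,S)e^{\mathrm{i}tS}\,\mathrm{d}S$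 (defined for almost every $\vartheta$, which suffices for applying $\mathcal{B}$). A function on $(-\pi,\pi)\times(-1,1)$ is extended by zero in $t$ to $(-\pi,\pi)\times\mathbb{R}$ before applying $\mathcal{F}_1$; for the weak solution its continuous representative is used. Periodic function spaces: $\mathrm{T}^2=[-\pi,\pi]\times[-1,1]$ with opposite boundary points identified (a torus, with coordinates $(\vartheta,t)$). $\mathrm{L}^2_{\mathrm{per}}(\mathrm{T}^2)$ is the space of (classes of) real-valued, measurable, square-integrable functions on $\mathrm{T}^2$. $\mathrm{H}^1_{\mathrm{per}}(\mathrm{T}^2)$ is the space of $u\in \mathrm{L}^2_{\mathrm{per}}(\mathrm{T}^2)$ with weak derivatives (on the torus) $\partial_\vartheta u,\partial_t u\in \mathrm{L}^2_{\mathrm{per}}(\mathrm{T}^2)$, with norm $\|u\|_{\mathrm{H}^1_{\mathrm{per}}}=(\|u\|^2_{\mathrm{L}^2_{\mathrm{per}}}+\|\partial_\vartheta u\|^2_{\mathrm{L}^2_{\mathrm{per}}}+\|\partial_t u\|^2_{\mathrm{L}^2_{\mathrm{per}}})^{1/2}$. $\mathrm{C}^\infty_{\mathrm{per},D}(\mathrm{T}^2)$ is the set of smooth periodic functions $\varphi$ on $\mathrm{T}^2$ for which there is $0<r<1$ with $\operatorname{supp}\varphi(\vartheta,\cdot)\subseteq(-r,r)$ for all $\vartheta\in(-\pi,\pi)$. $\mathrm{H}^1_{\mathrm{per},D}(\mathrm{T}^2)$ is the closure of $\mathrm{C}^\infty_{\mathrm{per},D}(\mathrm{T}^2)$ in $\mathrm{H}^1_{\mathrm{per}}(\mathrm{T}^2)$.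 Weak solution: for $g\in \mathrm{L}^2_{\mathrm{per}}(\mathrm{T}^2)$ (here $g=\mathcal{R}^\lambda_\Delta(f)$, regarded as a function on $\mathrm{T}^2$), a weak solution of the Poisson problem $\Delta u=g$ on $\Omega$, $u(\cdot,\pm1)=0$ on $(-\pi,\pi)$, $u(-\pi,\cdot)=u(\pi,\cdot)$ and $\partial_\vartheta u(-\pi,\cdot)=\partial_\vartheta u(\pi,\cdot)$ on $(-1,1)$, is a function $u\in \mathrm{H}^1_{\mathrm{per},D}(\mathrm{T}^2)$ with $$\int_{\mathrm{T}^2}\nabla u\cdot\nabla v\,\mathrm{d}(\vartheta,t)=-\int_{\mathrm{T}^2}v\,g\,\mathrm{d}(\vartheta,t)\qquad\text{for all } v\in \mathrm{H}^1_{\mathrm{per},D}(\mathrm{T}^2).$$ *)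

(* Defs.v *)
(* Functions on the plane, in the coordinates x = (x1, x2) or (theta, t), are
   functions on R * R, and the plane carries the product of the Lebesgue
   measures. *)
From mathcomp Require Import all_boot all_order all_algebra.
From mathcomp Require Import all_classical all_reals all_analysis.
From mathcomp Require Import complex.

Set Implicit Arguments.
Unset Strict Implicit.
Unset Printing Implicit Defensive.

Import Order.TTheory GRing.Theory Num.Theory numFieldNormedType.Exports.

Local Open Scope classical_set_scope.
Local Open Scope ring_scope.
Local Open Scope complex_scope.

Notation leb2 := (lebesgue_measure \x lebesgue_measure)%E.

Section ComplexIntegral.
Context d (T : measurableType d) (R : realType).
Variable mu : {measure set T -> \bar R}.

Definition Cintegrable (D : set T) (h : T -> R[i]) : Prop :=
  mu.-integrable D (fun x => (complex.Re (h x))%:E) /\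
  mu.-integrable D (fun x => (complex.Im (h x))%:E).

Definition Cintegral (D : set T) (h : T -> R[i]) : R[i] :=
  (\int[mu]_(x in D) complex.Re (h x)) +i*
  (\int[mu]_(x in D) complex.Im (h x)).

End ComplexIntegral.

Section Definitions.
Context {R : realType}.
Implicit Types (f g u v w : R * R -> R) (h : R * R -> R[i]).

(* The norm of R * R in the library is the maximum norm, hence the explicit
   Euclidean ball. *)
Definition unit_ball : set (R * R) := [set x | x.1 ^+ 2 + x.2 ^+ 2 < 1].

Definition Omega : set (R * R) := `]- pi, pi[ `*` `]- 1, 1[.

(* The torus is represented by its fundamental domain; the identification of
   opposite sides appears in [smooth_per] and [continuous_torus]. *)
Definition T2 : set (R * R) := `[- pi, pi] `*` `[- 1, 1].

Definition radon f (p : R * R) : R :=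
  \int[lebesgue_measure]_s
    f (p.2 * cos p.1 - s * sin p.1, p.2 * sin p.1 + s * cos p.1).

Definition centered_mod (lambda r : R) : R :=
  r - 2 * lambda * (Num.floor ((r + lambda) / (2 * lambda)))%:~R.

Definition modulo_radon (lambda : R) f (p : R * R) : R :=
  centered_mod lambda (radon f p).

Definition cexpi (r : R) : R[i] := cos r +i* sin r.

Definition fourier2 f (xi : R * R) : R[i] :=
  Cintegral leb2 setT
    (fun x => (f x)%:C * cexpi (- (x.1 * xi.1 + x.2 * xi.2))).

Definition fourier1 h (p : R * R) : R[i] :=
  Cintegral lebesgue_measure setT
    (fun t : R => h (p.1, t) * cexpi (- (t * p.2))).

Definition inv_fourier1 h (p : R * R) : R[i] :=
  ((2 * pi)^-1)%:C *
  Cintegral lebesgue_measure setT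
    (fun S : R => h (p.1, S) * cexpi (p.2 * S)).

Definition back_projection h (x : R * R) : R[i] :=
  Cintegral lebesgue_measure `[- pi, pi]
    (fun theta : R => h (theta, x.1 * cos theta + x.2 * sin theta)).

Definition e_theta : R * R := (1, 0).
Definition e_t : R * R := (0, 1).

Definition d_theta g : R * R -> R := fun p => 'D_e_theta g p.
Definition d_t g : R * R -> R := fun p => 'D_e_t g p.

Definition laplacian g (p : R * R) : R := d_theta (d_theta g) p + d_t (d_t g) p.

(* Iterated partial derivative: [true] stands for t, [false] for theta. *)
Definition partial (s : seq bool) g : R * R -> R :=
  foldr (fun b F => if b then d_t F else d_theta F) g s.

(* C^k on an open set U. *)
Definition Ck (k : nat) (U : set (R * R)) g : Prop :=
  forall s : seq bool, (size s <= k)%N ->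
    (forall p, U p -> {for p, continuous (partial s g)}) /\
    ((size s < k)%N -> forall p, U p ->
      derivable (partial s g) p e_theta /\ derivable (partial s g) p e_t).

(* C^k on the closure of U: all partial derivatives of order at most k on U
   extend continuously to the closure. *)
Definition Ck_closure (k : nat) (U : set (R * R)) g : Prop :=
  Ck k U g /\
  forall s : seq bool, (size s <= k)%N ->
    exists G : R * R -> R, {within closure U, continuous G} /\
      forall p, U p -> G p = partial s g p.

(* Extended by zero outside Omega: the partial derivatives are only meant on
   the open set Omega, whose boundary is a null set. *)
Definition radon_lap (lambda : R) f : R * R -> R :=
  let a := fun q => pi / lambda * modulo_radon lambda f q in
  patch (cst 0) Omega (fun p =>
    lambda / pi * (cos (a p) * laplacian (fun q => sin (a q)) p -
                   sin (a p) * laplacian (fun q => cos (a q)) p)).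

Definition zero_ext u : R * R -> R := patch (cst 0) Omega u.

Definition L2per u : Prop :=
  measurable_fun T2 u /\ leb2.-integrable T2 (fun p => (u p ^+ 2)%:E).

Definition L2norm_sq u : R := \int[leb2]_(p in T2) (u p ^+ 2).

Definition smooth_per (phi : R * R -> R) : Prop :=
  [/\ forall k, Ck k setT phi,
      forall t, periodic (fun theta => phi (theta, t)) (2 * pi) &
      forall theta, periodic (fun t => phi (theta, t)) 2].

Definition smooth_perD (phi : R * R -> R) : Prop :=
  smooth_per phi /\
  exists2 r : R, 0 < r < 1 & forall theta : R, - pi < theta < pi ->
    closure [set t : R | - 1 <= t <= 1 /\ phi (theta, t) != 0] `<=` `]- r, r[.

Definition is_weak_deriv (e : R * R) u w : Prop :=
  L2per w /\
  forall phi, smooth_per phi ->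
    \int[leb2]_(p in T2) (u p * 'D_e phi p) =
    - \int[leb2]_(p in T2) (w p * phi p).

(* A representative of the weak derivative, unique almost everywhere on T2;
   0 if there is none. *)
Definition weak_deriv (e : R * R) u : R * R -> R :=
  xget (cst 0) [set w | is_weak_deriv e u w].

Definition H1per u : Prop :=
  [/\ L2per u, exists w, is_weak_deriv e_theta u w &
      exists w, is_weak_deriv e_t u w].

Definition H1norm u : R :=
  Num.sqrt (L2norm_sq u + L2norm_sq (weak_deriv e_theta u) +
            L2norm_sq (weak_deriv e_t u)).

Definition H1perD u : Prop :=
  H1per u /\
  forall eps : R, 0 < eps ->
    exists2 phi, smooth_perD phi & H1norm (fun p => u p - phi p) < eps.

Definition weak_solution g u : Prop :=
  [/\ L2per g, H1perD u &
      forall v, H1perD v ->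
        \int[leb2]_(p in T2)
          (weak_deriv e_theta u p * weak_deriv e_theta v p +
           weak_deriv e_t u p * weak_deriv e_t v p) =
        - \int[leb2]_(p in T2) (v p * g p)].

Definition continuous_torus u : Prop :=
  [/\ {within T2, continuous u},
      forall t : R, - 1 <= t <= 1 -> u (- pi, t) = u (pi, t) &
      forall theta : R, - pi <= theta <= pi -> u (theta, - 1) = u (theta, 1)].

(* |S| times the radial Fourier transform of u on Omega, extended by zero. *)
Definition ramp_fourier1 u (p : R * R) : R[i] :=
  `|p.2|%:C * fourier1 (fun q => (zero_ext u q)%:C) p.

End Definitions.

(* Main.v *)
(* Taking R f modulo 2 lambda changes it by multiples of 2 lambda, which the
   factor pi / lambda turns into full periods of sin and cos; hence
   R^lambda_Delta f is the Laplacian of R f on Omega. As R f vanishes for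
   |t| > rho, where rho < 1, and is invariant under the glide reflection
   (theta, t) |-> (theta + pi, - t), its C^2 regularity on Omega extends to the
   whole plane. So R f is a classical solution of the Poisson problem, hence a weak
   one, and weak solutions are unique by a Poincare inequality in t; mollification
   by powers of 1 + cos relates classical and weak derivatives. It remains to prove
   the filtered back projection formula for R f itself. The Fourier slice theorem
   follows by writing a rotation as a product of three shears, the passage to polar
   coordinates by the substitution y = x tan theta, and Fourier inversion by the
   weight exp (- e (|xi_1| + |xi_2|)), whose Fourier transform is a product of two
   Poisson kernels. *)
Require Import Defs.
From HB Require Import structures.
From mathcomp Require Import all_boot all_order all_algebra.
From mathcomp Require Import all_classical all_reals all_analysis.
From mathcomp Require Import measurable_realfun complex.
From mathcomp Require Import ring lra.

Import Order.TTheory GRing.Theory Num.Theory numFieldNormedType.Exports.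

Set Implicit Arguments.
Unset Strict Implicit.
Unset Printing Implicit Defensive.

Local Open Scope classical_set_scope.
Local Open Scope ring_scope.
Local Open Scope complex_scope.

(** * Integration on the line and on the plane *)

(** No derivative is ever taken under an integral sign: a power of 1 + cos is a trigonometric
    polynomial, so a mollified function is a finite sum of products of smooth functions of one
    coordinate, with explicit derivatives. Mollification spoils the Dirichlet condition, and a
    smooth cutoff equal to 1 on the support of R f restores it.

    The weight exp (- e (|xi_1| + |xi_2|)) is preferred to a Gaussian because everything about it is
    elementary: it has an explicit primitive against cosines, and its Poisson kernels integrate to
    arctangents.

    Fourier transforms are handled through their real coefficients [ccoef] and [scoef]. The back
    projection is real because its imaginary part comes from a kernel that is odd in the radial
    variable.

    The constant 4 pi: a full circle of angles with a signed radius covers the plane twice, so the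
    integrals contribute (2 pi)^-1 * 2 * (2 pi)^2 = 4 pi.

    The angles theta = - pi and theta = pi lie outside [Omega], where the extension by zero replaces
    R f; they are treated apart. *)

Section plane_measurability.
Context {R : realType}.
Implicit Types (F : R * R -> R).
Local Notation mR := (measurableTypeR R).

(** The measurable structure of the plane is generated by rectangles, not by open sets. An open set
    belongs to it as the countable union of the rational boxes that it contains. *)
Lemma open_measurable2 (U : set (R * R)) : open U ->
  measurable (U : set (mR * mR)).
Proof.
move=> oU.
pose box (q : rat * rat * rat * rat) : set (R * R) :=
  `]ratr q.1.1.1 : R, ratr q.1.1.2[ `*` `]ratr q.1.2, ratr q.2[.
have -> : U = \bigcup_q (if `[< box q `<=` U >] then box q else set0).
  apply/seteqP; split => [[x y] Uxy|p [q _]]; last first.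
    by case: (asboolP (box q `<=` U)) => [sub bp|_ []]; exact: sub.
  have /nbhs_ballP[e /= e0 eU] : nbhs (x, y) U by exact: open_nbhs_nbhs.
  have [a aI] := rat_in_itvoo (ltac:(lra) : x - e < x).
  have [b bI] := rat_in_itvoo (ltac:(lra) : x < x + e).
  have [c cI] := rat_in_itvoo (ltac:(lra) : y - e < y).
  have [d dI] := rat_in_itvoo (ltac:(lra) : y < y + e).
  move: aI bI cI dI; rewrite !in_itv/= => /andP[a1 a2] /andP[b1 b2] /andP[c1 c2] /andP[d1 d2].
  exists (a, b, c, d) => //; case: asboolP => [_|]; first by rewrite /box/= !in_itv/= a2 b1 c2 d1.
  case=> -[u v] /=; rewrite /box/= !in_itv/= => -[/andP[u1 u2] /andP[v1 v2]].
  by apply: eU; split; rewrite /= /ball/= ltr_norml; apply/andP; split; lra.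
apply: countable_bigcupT_measurable => // q.
case: asboolP => _ //.
by apply: measurableX; exact: measurable_itv.
Qed.

Lemma continuous_measurable_fun2 F : continuous F ->
  measurable_fun (setT : set (mR * mR)) (F : mR * mR -> mR).
Proof.
move=> cF; apply: (measurability _ (RGenOInfty.measurableE R)).
move=> _ [_ [x ->] <-]; rewrite setTI; apply: open_measurable2.
by move/continuousP : cF; apply; exact: interval_open.
Qed.

End plane_measurability.

Section affine_change_of_variables.
Context {R : realType}.
Local Notation mu := (@lebesgue_measure R).
Local Notation mR := (measurableTypeR R).

Lemma measurable_affine (a b : R) :
  measurable_fun (setT : set mR) ((fun x => a * x + b) : mR -> mR).
Proof.
apply: continuous_measurable_fun => x.
by apply: cvgD; [apply: cvgM; [exact: cvg_cst|exact: cvg_id]|exact: cvg_cst].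
Qed.

(** The right-hand side is a measure in [A] that agrees with Lebesgue measure on half-open
    intervals, and such a measure is unique. A negative slope moves the open end of the interval to
    the other side, which does not change its length. *)
Lemma lebesgue_measure_affine (a b : R) (A : set mR) : a != 0 ->
  measurable A ->
  mu A = (`|a|%:E * mu ((fun x : R => (a * x + b)%R) @^-1` A))%E.
Proof.
move=> a0 mA.
pose m : {measure set mR -> \bar R} := mscale (NngNum (normr_ge0 a))
  (measure_function_pushforward__canonical__measure_function_Measure mu
    (measurable_affine a b)).
rewrite (@lebesgue_measure_unique _ m)// => X /ocitvP[->|[[u v] /= uv ->]].
  by rewrite !measure0.
rewrite /m /= /mscale /= /pushforward lebesgue_measure_itv/= lte_fin uv.
have [a_gt0|a_lt0] : 0 < a \/ a < 0 by case: (ltgtP a 0) a0 => //; [right|left].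
  have -> : (fun x : R => a * x + b) @^-1` `]u, v] = `](u - b) / a, (v - b) / a]%classic.
    apply/seteqP; split=> x /=; rewrite !in_itv/= ltr_pdivrMr// ler_pdivlMr//.
      by move=> /andP[h1 h2]; apply/andP; split; lra.
    by move=> /andP[h1 h2]; apply/andP; split; lra.
  rewrite lebesgue_measure_itv/= lte_fin ltr_pM2r ?invr_gt0// ltrD2r uv.
  by rewrite gtr0_norm// -!EFinB -EFinM; congr EFin; field.
have -> : (fun x : R => a * x + b) @^-1` `]u, v] = `[(v - b) / a, (u - b) / a[%classic.
  apply/seteqP; split=> x /=; rewrite !in_itv/= ltr_ndivlMr// ler_ndivrMr//.
    by move=> /andP[h1 h2]; apply/andP; split; lra.
  by move=> /andP[h1 h2]; apply/andP; split; lra.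
rewrite lebesgue_measure_itv/= lte_fin ltr_nM2r ?invr_lt0// ltrD2r uv.
by rewrite ltr0_norm// -!EFinB -EFinM; congr EFin; field.
Qed.

Lemma ge0_integral_affine (a b : R) (f : R -> \bar R) : a != 0 ->
  measurable_fun (setT : set mR) f -> (forall x, 0 <= f x)%E ->
  (\int[mu]_x f x = `|a|%:E * \int[mu]_x f (a * x + b)%R)%E.
Proof.
move=> a0 mf f0.
have mphi := measurable_affine a b.
pose m : {measure set mR -> \bar R} := mscale (NngNum (normr_ge0 a))
  (measure_function_pushforward__canonical__measure_function_Measure mu
    (measurable_affine a b)).
rewrite (eq_measure_integral m) => [|A mA _]; last exact: lebesgue_measure_affine.
rewrite ge0_integral_mscale//= ge0_integral_pushforward//.
Qed.

Lemma integrable_affine (a b : R) (f : R -> R) : a != 0 ->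
  mu.-integrable (setT : set mR) (EFin \o f) ->
  mu.-integrable (setT : set mR) (fun x => (f (a * x + b))%:E).
Proof.
move=> a0 /integrableP[mf fi]; apply/integrableP; split.
  by apply: (measurableT_comp mf); exact: measurable_affine.
have mabs : measurable_fun (setT : set mR) (fun x => `|(f x)%:E|)%E.
  exact: measurableT_comp.
move: fi; rewrite (@ge0_integral_affine a b (fun x => `|(f x)%:E|)%E)//=.
have aP : 0 < `|a| by rewrite normr_gt0.
set I := integral _ _ _; case: I => [r| |] //.
- by move=> _; rewrite ltry.
- by rewrite gt0_muley ?lte_fin// ltxx.
Qed.

Lemma Rintegral_affine (a b : R) (f : R -> R) : a != 0 ->
  mu.-integrable (setT : set mR) (EFin \o f) ->
  \int[mu]_x f x = `|a| * \int[mu]_x f (a * x + b).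
Proof.
move=> a0 fi.
have mf := measurable_int _ fi.
have fi2 := integrable_affine b a0 fi.
have P : (\int[mu]_x (EFin \o f)^\+ x =
    `|a|%:E * \int[mu]_x (fun y : mR => (f (a * y + b)%R)%:E)^\+ x)%E.
  rewrite (@ge0_integral_affine a b)//; last exact: measurable_funepos.
  by congr (_ * _)%E; apply: eq_integral => x _; rewrite !funeposE.
have N : (\int[mu]_x (EFin \o f)^\- x =
    `|a|%:E * \int[mu]_x (fun y : mR => (f (a * y + b)%R)%:E)^\- x)%E.
  rewrite (@ge0_integral_affine a b)//; last exact: measurable_funeneg.
  by congr (_ * _)%E; apply: eq_integral => x _; rewrite !funenegE.
rewrite /Rintegral.
have -> : (\int[mu]_x (f x)%:E = `|a|%:E * \int[mu]_x (f (a * x + b)%R)%:E)%E.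
  rewrite (integralE mu setT (fun x : mR => (f (a * x + b)%R)%:E)) muleBr//.
    by rewrite -P -N -integralE.
  exact: integrable_add_def.
by rewrite fineM// integrable_fin_num.
Qed.

End affine_change_of_variables.

(** * Calculus of real-valued integrals: integrability, almost everywhere equality, dominated
    convergence *)

Section Rintegral_calculus.
Context d (T : measurableType d) (R : realType) (mu : {measure set T -> \bar R}).
Variables (D : set T) (mD : measurable D).
Implicit Types f g h : T -> R.
Local Notation I f := (mu.-integrable D (EFin \o f)).

Lemma Rintegrable_measurable f : I f -> measurable_fun D f.
Proof. by move=> /integrableP[/measurable_EFinP]. Qed.

Lemma RintegrableD f g : I f -> I g -> I (fun x => f x + g x).
Proof. by move=> fi gi; exact: (integrableD mD fi gi). Qed.

Lemma RintegrableB f g : I f -> I g -> I (fun x => f x - g x).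
Proof. by move=> fi gi; exact: (integrableB mD fi gi). Qed.

Lemma RintegrableZ (c : R) f : I f -> I (fun x => c * f x).
Proof. by move=> fi; exact: (integrableZl mD c fi). Qed.

Lemma Rintegrable_le f g : measurable_fun D f -> I g ->
  (forall x, D x -> `|f x| <= g x) -> I f.
Proof.
move=> mf gi fg; apply: (le_integrable mD _ _ gi); first exact/measurable_EFinP.
by move=> x Dx /=; rewrite lee_fin (le_trans (fg _ Dx))// ler_norm.
Qed.

Lemma Rintegrable_mulbounded (M : R) f g : measurable_fun D f -> I g ->
  (forall x, D x -> `|f x| <= M) -> I (fun x => f x * g x).
Proof.
move=> mf gi fM; have mg := Rintegrable_measurable gi.
apply: (@Rintegrable_le _ (fun x => M * `|g x|)).
- exact: measurable_funM.
- exact/RintegrableZ/integrable_norm.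
- by move=> x Dx; rewrite normrM ler_wpM2r// fM.
Qed.

Lemma Rintegrable_bounded (M : R) f : (mu D < +oo)%E -> measurable_fun D f ->
  (forall x, D x -> `|f x| <= M) -> I f.
Proof.
move=> Doo mf fM; apply: (@Rintegrable_le _ (cst M)) => //.
apply: measurable_bounded_integrable => //.
by exists `|M|; split => // x Mx y _ /=; exact: ltW.
Qed.

Lemma Rintegral_eq0 f : (forall x, D x -> f x = 0) -> \int[mu]_(x in D) f x = 0.
Proof.
move=> f0; rewrite /Rintegral (eq_integral (fun=> 0%E)) ?integral0// => x /set_mem Dx.
by rewrite f0.
Qed.

Lemma Rintegrable_ae_eq f g : measurable_fun D g -> I f ->
  {ae mu, forall x, D x -> f x = g x} -> I g.
Proof.
move=> mg /integrableP[mf fi] fg; apply/integrableP; split.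
  exact/measurable_EFinP.
rewrite (@ae_eq_integral _ _ _ _ _ (abse \o (EFin \o f)))//.
- by apply: measurableT_comp => //; exact/measurable_EFinP.
- by apply: measurableT_comp.
- by apply: filterS fg => x /= fg Dx; rewrite fg.
Qed.

Lemma Rintegral_ae_eq f g : measurable_fun D f -> measurable_fun D g ->
  {ae mu, forall x, D x -> f x = g x} ->
  \int[mu]_(x in D) f x = \int[mu]_(x in D) g x.
Proof.
move=> mf mg fg; rewrite /Rintegral; congr fine; apply: ae_eq_integral => //.
- exact/measurable_EFinP.
- exact/measurable_EFinP.
- by apply: filterS fg => x /= fg Dx; rewrite fg.
Qed.

Lemma Rintegral_eq0_ae f : I f -> (forall x, D x -> 0 <= f x) ->
  \int[mu]_(x in D) f x = 0 -> {ae mu, forall x, D x -> f x = 0}.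
Proof.
move=> fi f0 If0; have mf := Rintegrable_measurable fi.
have : (\int[mu]_(x in D) `|(f x)%:E| = 0)%E.
  have := @integrable_fin_num _ _ _ mu _ mD _ fi.
  move=> /fineK; rewrite -/(Rintegral _ _ _) If0 => /esym H.
  rewrite -[RHS]H; apply: eq_integral => x /[!inE] Dx.
  by rewrite gee0_abs// lee_fin f0.
have mEf : measurable_fun D (EFin \o f) by exact/measurable_EFinP.
move/(ae_eq_integral_abs mu mD mEf).1; apply: filterS => x /= fx Dx.
by have [] := fx Dx.
Qed.

Lemma Rintegral_dominated (f_ : nat -> T -> R) f g :
  (forall n, measurable_fun D (f_ n)) -> measurable_fun D f ->
  {ae mu, forall x, D x -> f_ ^~ x @ \oo --> f x} -> I g ->
  (forall n x, D x -> `|f_ n x| <= g x) ->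
  (fun n => \int[mu]_(x in D) f_ n x) @ \oo --> \int[mu]_(x in D) f x.
Proof.
move=> mf_ mf ff gi fg.
have [||||| fi _ cv] := @dominated_convergence _ _ _ mu D mD
  (fun n x => (f_ n x)%:E) (EFin \o f) (EFin \o g).
- by move=> n; exact/measurable_EFinP.
- exact/measurable_EFinP.
- apply: filterS ff => x /= ff Dx; apply: cvg_EFin; last exact: ff.
  by apply: nearW.
- exact: gi.
- by apply/aeW => x n Dx; rewrite /= lee_fin; exact: fg.
apply: fine_cvg; rewrite fineK//; exact: integrable_fin_num.
Qed.

End Rintegral_calculus.

Section Rintegral_Fubini.
Context d1 d2 (T1 : measurableType d1) (T2 : measurableType d2) (R : realType).
Variable m1 : {sigma_finite_measure set T1 -> \bar R}.
Variable m2 : {sigma_finite_measure set T2 -> \bar R}.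
Implicit Types f : T1 * T2 -> R.

(** The inner extended integral is finite only almost everywhere. Applying [fine] keeps it
    measurable and does not increase its absolute value, so the integrability of [fubini_F] is
    inherited. *)
Lemma Rintegrable_fubini f : (m1 \x m2)%E.-integrable setT (EFin \o f) ->
  m1.-integrable setT (EFin \o (fun x => \int[m2]_y f (x, y))).
Proof.
move=> fi; have Fi := integrable_fubini_F fi.
have mF := measurable_int _ Fi.
apply: (@Rintegrable_ae_eq _ _ _ _ _ measurableT (fine \o fubini_F m2 (EFin \o f))) => //.
- exact: measurableT_comp.
- apply/integrableP; split.
    by apply/measurable_EFinP; exact: measurableT_comp.
  case/integrableP: Fi => _; apply: le_lt_trans; apply: ge0_le_integral => //=.
  + by apply/measurable_EFinP; do 2 apply: measurableT_comp => //.
  + exact: measurableT_comp.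
  + by move=> x _; case: fubini_F => [r| |] //=; rewrite normr0 leey.
- exact/aeW.
Qed.

Lemma Rintegral_fubini f : (m1 \x m2)%E.-integrable setT (EFin \o f) ->
  \int[(m1 \x m2)%E]_z f z = \int[m1]_x \int[m2]_y f (x, y).
Proof.
move=> fi; have Fi := integrable_fubini_F fi.
rewrite /Rintegral -(integral12_prod_meas1 fi); congr fine.
have mF := measurable_int _ Fi.
apply: ae_eq_integral => //.
- by apply/measurable_EFinP; exact: measurableT_comp.
- have := integrable_ae measurableT Fi; apply: filterS => x /= /[apply].
  by move/fineK => <-.
Qed.

Lemma Rintegral_fubini2 f : (m1 \x m2)%E.-integrable setT (EFin \o f) ->
  \int[(m1 \x m2)%E]_z f z = \int[m2]_y \int[m1]_x f (x, y).
Proof.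
move=> fi; have mf := measurable_int _ fi.
have Fi : m2.-integrable setT (fubini_G m1 (EFin \o f)).
  apply/integrableP; split; first exact: measurable_fubini_G fi.
  apply: le_lt_trans ((integrable21ltyP _ _ mf).1 fi); apply: ge0_le_integral => //=.
  - by apply: measurableT_comp => //; exact: measurable_fubini_G fi.
  - apply: (measurable_fun_fubini_tonelli_G (abse \o (EFin \o f))) => //.
      by apply: measurableT_comp.
    by move=> x /=.
  - by move=> y _; apply: le_abse_integral => //; exact: measurableT_comp.
rewrite /Rintegral -(integral21_prod_meas1 fi); congr fine.
have mF := measurable_int _ Fi.
apply: ae_eq_integral => //.
- by apply/measurable_EFinP; exact: measurableT_comp.
- have := integrable_ae measurableT Fi; apply: filterS => x /= /[apply].
  by move/fineK => <-.
Qed.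

Lemma Rintegrable_patch d (T : measurableType d) (mu : {measure set T -> \bar R})
    (D : set T) (f : T -> R) : measurable D ->
  mu.-integrable D (EFin \o f) <-> mu.-integrable setT (EFin \o (f \_ D)).
Proof.
by move=> mD; rewrite (integrable_mkcond _ mD) restrict_EFin.
Qed.

Lemma patch_prod f (A : set T1) (B : set T2) x y :
  (f \_ (A `*` B)) (x, y) = ((fun x => ((fun y => f (x, y)) \_ B) y) \_ A) x.
Proof.
by rewrite /patch in_setX /=; case: (x \in A).
Qed.

Lemma Rintegral_fubiniX f (A : set T1) (B : set T2) :
    measurable A -> measurable B ->
    (m1 \x m2)%E.-integrable (A `*` B) (EFin \o f) ->
  \int[(m1 \x m2)%E]_(z in A `*` B) f z = \int[m1]_(x in A) \int[m2]_(y in B) f (x, y).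
Proof.
move=> mA mB /Rintegrable_patch-/(_ (measurableX mA mB)) fi.
rewrite Rintegral_mkcond (Rintegral_fubini fi) [RHS]Rintegral_mkcond.
apply: eq_Rintegral => x _ /=; rewrite {2}/patch; case: ifPn => xA.
  rewrite [RHS]Rintegral_mkcond; apply: eq_Rintegral => y _.
  by rewrite patch_prod {1}/patch xA.
by apply: Rintegral_eq0 => y _; rewrite patch_prod {1}/patch (negbTE xA).
Qed.

Lemma Rintegral_fubiniX2 f (A : set T1) (B : set T2) :
    measurable A -> measurable B ->
    (m1 \x m2)%E.-integrable (A `*` B) (EFin \o f) ->
  \int[(m1 \x m2)%E]_(z in A `*` B) f z =
  \int[m2]_(y in B) \int[m1]_(x in A) f (x, y).
Proof.
move=> mA mB /Rintegrable_patch-/(_ (measurableX mA mB)) fi.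
rewrite Rintegral_mkcond (Rintegral_fubini2 fi) [RHS]Rintegral_mkcond.
apply: eq_Rintegral => y _ /=; rewrite {2}/patch; case: ifPn => yB.
  rewrite [RHS]Rintegral_mkcond; apply: eq_Rintegral => x _.
  by rewrite patch_prod {2 3}/patch yB.
apply: Rintegral_eq0 => x _; rewrite patch_prod {2}/patch (negbTE yB).
by rewrite /patch; case: ifP.
Qed.

End Rintegral_Fubini.

Lemma continuous_pair (T U V : topologicalType) (f : T -> U) (g : T -> V) (x : T) :
  {for x, continuous f} -> {for x, continuous g} ->
  {for x, continuous (fun y => (f y, g y))}.
Proof.
by move=> cf cg; exact: (@cvg_pair _ _ _ (nbhs x) (nbhs (f x)) (nbhs (g x)) _ _ _ f g cf cg).
Qed.

Section plane_calculus.
Context {R : realType}.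
Implicit Types (g h : R * R -> R) (p : R * R).
Local Notation mR := (measurableTypeR R).
Local Notation mu := (@lebesgue_measure R).

(** The two difference quotients are the same function of the increment. Through this equivalence,
    all differentiation in the plane is done with the calculus of one variable. *)
Lemma is_derive_e_theta g p (d : R) :
  is_derive p e_theta g d <-> is_derive p.1 1 (fun x => g (x, p.2)) d.
Proof.
have E : (fun h : R => h^-1 *: ((g \o shift p) (h *: (e_theta : R * R)) - g p)) =
    (fun h : R => h^-1 *: (((fun x => g (x, p.2)) \o shift p.1) (h *: (1 : R)) -
       g (p.1, p.2))).
  apply/funext => h; congr (_ *: (_ - _)); last by case: p.
  congr g; apply: injective_projections; first by [].
  by rewrite -[LHS]/(h * 0 + p.2) mulr0 add0r.
by split=> -[dg <-]; constructor; move: dg; rewrite /derivable /derive E.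
Qed.

Lemma is_derive_e_t g p (d : R) :
  is_derive p e_t g d <-> is_derive p.2 1 (fun x => g (p.1, x)) d.
Proof.
have E : (fun h : R => h^-1 *: ((g \o shift p) (h *: (e_t : R * R)) - g p)) =
    (fun h : R => h^-1 *: (((fun x => g (p.1, x)) \o shift p.2) (h *: (1 : R)) -
       g (p.1, p.2))).
  apply/funext => h; congr (_ *: (_ - _)); last by case: p.
  congr g; apply: injective_projections; last by [].
  by rewrite -[LHS]/(h * 0 + p.1) mulr0 add0r.
by split=> -[dg <-]; constructor; move: dg; rewrite /derivable /derive E.
Qed.

Lemma Rintegral_FTC (F f : R -> R) (a b : R) : a < b -> continuous f ->
  (forall x : R, is_derive x 1 F (f x)) -> \int[mu]_(x in `[a, b]) f x = F b - F a.
Proof.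
move=> ab cf dF.
have cF : continuous F.
  by move=> x; apply/differentiable_continuous/derivable1_diffP.
rewrite /Rintegral (continuous_FTC2 (F := F) ab)//.
- exact: continuous_subspaceT.
- split=> //.
  + by apply: cvg_at_right_filter; exact: cF.
  + by apply: cvg_at_left_filter; exact: cF.
- by move=> x _; rewrite derive1E derive_val.
Qed.

Lemma continuous_slice1 g (y : R) : continuous g -> continuous (fun x => g (x, y)).
Proof.
move=> cg x; apply: (continuous_comp (f := fun x => (x, y)) (g := g)); last exact: cg.
by apply: (@continuous_pair _ _ _ id (cst y)); [exact: cvg_id|exact: cvg_cst].
Qed.

Lemma continuous_slice2 g (x : R) : continuous g -> continuous (fun y => g (x, y)).
Proof.
move=> cg y; apply: (continuous_comp (f := fun y => (x, y)) (g := g)); last exact: cg.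
by apply: (@continuous_pair _ _ _ (cst x) id); [exact: cvg_cst|exact: cvg_id].
Qed.

Lemma measurable_box (a b c d : R) : measurable (`[a, b] `*` `[c, d] : set (mR * mR)).
Proof. by apply: measurableX; exact: measurable_itv. Qed.

Lemma leb2_box (a b c d : R) : (leb2 (`[a, b] `*` `[c, d] : set (mR * mR)) < +oo)%E.
Proof.
rewrite product_measure1E ?measurable_itv//.
have H (u v : R) : (mu `[u, v]%classic < +oo)%E.
  by rewrite lebesgue_measure_itv /=; case: ifP => _; rewrite -?EFinB ltry.
apply: lte_mul_pinfty; [exact: measure_ge0| |exact: H].
by rewrite ge0_fin_numE; [exact: H|exact: measure_ge0].
Qed.

Lemma continuous_box_bounded g (a b c d : R) : continuous g ->
  exists M : R, forall p, (`[a, b] `*` `[c, d]) p -> `|g p| <= M.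
Proof.
move=> cg.
have cA : compact (`[a, b] `*` `[c, d] : set (R * R)).
  by apply: compact_setX; exact: segment_compact.
have [A0|] := eqVneq (`[a, b] `*` `[c, d] : set (R * R)) set0.
  by exists 0 => p; rewrite A0.
move=> /set0P A0.
have cn : {within `[a, b] `*` `[c, d], continuous (fun p => `|g p|)}.
  by apply: continuous_subspaceT => p; apply: cvg_norm; exact: cg.
have [x _ xM] := compact_EVT_max A0 cA cn.
by exists `|g x| => p pA; apply: xM; rewrite inE.
Qed.

Lemma continuous_box_integrable g (a b c d : R) : continuous g ->
  leb2.-integrable (`[a, b] `*` `[c, d] : set (mR * mR)) (EFin \o g).
Proof.
move=> cg; have [M gM] := continuous_box_bounded a b c d cg.
apply: (Rintegrable_bounded (measurable_box a b c d) _ _ gM); first exact: leb2_box.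
by apply: measurable_funTS; exact: continuous_measurable_fun2.
Qed.

(** Fubini with the theta integral innermost lets the fundamental theorem of calculus apply on each
    line, where the boundary terms cancel. With its companion in t, this is the source of every
    integration by parts on the torus. *)
Lemma Rintegral_box_d_theta g h (a b c d : R) : a < b ->
  continuous h -> (forall p, is_derive p e_theta g (h p)) ->
  (forall t, t \in `[c, d] -> g (a, t) = g (b, t)) ->
  \int[leb2]_(p in `[a, b] `*` `[c, d]) h p = 0.
Proof.
move=> ab ch dg gab.
rewrite Rintegral_fubiniX2 ?measurable_itv//; last exact: continuous_box_integrable.
apply: Rintegral_eq0 => t tcd.
have dF (x : R) : is_derive x 1 (fun x => g (x, t)) (h (x, t)).
  exact/(is_derive_e_theta g (x, t)).
by rewrite (Rintegral_FTC ab (continuous_slice1 (y := t) ch) dF) gab ?subrr ?inE.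
Qed.

Lemma Rintegral_box_d_t g h (a b c d : R) : c < d ->
  continuous h -> (forall p, is_derive p e_t g (h p)) ->
  (forall x, x \in `[a, b] -> g (x, c) = g (x, d)) ->
  \int[leb2]_(p in `[a, b] `*` `[c, d]) h p = 0.
Proof.
move=> cd ch dg gcd.
rewrite Rintegral_fubiniX ?measurable_itv//; last exact: continuous_box_integrable.
apply: Rintegral_eq0 => x xab.
have dF (t : R) : is_derive t 1 (fun t => g (x, t)) (h (x, t)).
  exact/(is_derive_e_t g (x, t)).
by rewrite (Rintegral_FTC cd (continuous_slice2 (x := x) ch) dF) gcd ?subrr ?inE.
Qed.

End plane_calculus.

(** * Mollification on the torus *)

Section smooth_functions.
Context {R : realType}.
Implicit Types (f g : R -> R) (x : R).

(* [k = 0] is the classical flat function [exp (- 1 / x)]; its derivatives are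
   combinations of the [flat k]. *)
Definition flat (k : nat) x : R := if 0 < x then x ^- k * expR (- x^-1) else 0.

Lemma flat_gt0 k x : 0 < x -> 0 < flat k x.
Proof. by move=> x0; rewrite /flat x0 mulr_gt0 ?invr_gt0 ?exprn_gt0 ?expR_gt0. Qed.

Lemma flat_le0 k x : x <= 0 -> flat k x = 0.
Proof. by move=> x0; rewrite /flat ltNge x0. Qed.

Lemma flat_ge0 k x : 0 <= flat k x.
Proof. by have [/flat_le0->//|/flat_gt0 /ltW] := leP x 0. Qed.

(** For y = 1 / ((k + 1) x), the inequality exp y >= y raised to the power k + 1 bounds exp (- 1 /
    x) by ((k + 1) x)^(k + 1). One power of x survives the division by x^k, so [flat k] tends to 0
    at 0. *)
Lemma flat_bound k x : `|flat k x| <= k.+1%:R ^+ k.+1 * `|x|.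
Proof.
have [x0|x0] := leP x 0; first by rewrite flat_le0// normr0 mulr_ge0// exprn_ge0.
rewrite ger0_norm ?flat_ge0// gtr0_norm// /flat x0.
have e : expR (- x^-1) <= (k.+1%:R * x) ^+ k.+1.
  have -> : - x^-1 = k.+1%:R * - (k.+1%:R * x)^-1.
    by field; rewrite gt_eqF//= pnatr_eq0.
  rewrite expRM_natl lerXn2r ?nnegrE ?expR_ge0 ?mulr_ge0 ?(ltW x0)//.
  rewrite expRN -[leRHS]invrK lef_pV2 ?posrE ?expR_gt0 ?invr_gt0 ?mulr_gt0//.
  by rewrite (le_trans _ (expR_ge1Dx _))// lerDr.
rewrite (le_trans (ler_wpM2l _ e)) ?invr_ge0 ?exprn_ge0 ?(ltW x0)//.
rewrite exprMn (exprS x) mulrCA ler_wpM2l ?exprn_ge0//.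
by rewrite mulrCA mulVf ?mulr1// expf_neq0 ?gt_eqF.
Qed.

Lemma is_derive_flat k x :
  is_derive x 1 (flat k) (- k%:R * flat k.+1 x + flat k.+2 x).
Proof.
have [x0|x0|->] := ltgtP x 0.
- rewrite !flat_le0 ?ltW// mulr0 addr0.
  have D : is_derive x 1 (cst (0 : R)) (0 : R) by exact: is_derive_cst.
  apply: near_eq_is_derive D.
  by near=> y; rewrite flat_le0//; apply: ltW; near: y; exact: (cvgr_lt x).
- have d1 : is_derive x 1 (fun y : R => y^-1) (- x ^- 2).
    have := @is_deriveV _ id x 1 1 (lt0r_neq0 x0) (is_derive_id _ _).
    by rewrite -[_ *: 1]/(_ * 1) mulr1.
  have d2 : is_derive x 1 (fun y : R => expR (- y^-1)) (expR (- x^-1) * x ^- 2).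
    have := @is_derive1_comp R expR (fun y : R => - y^-1) x _ _ (is_derive_expR _) (is_deriveN d1).
    by rewrite opprK.
  have dk : is_derive x 1 (fun y : R => y^-1 ^+ k) (- k%:R * x^-1 ^+ k.+1).
    elim: k => [|k IH].
      by rewrite oppr0 mul0r; apply: is_derive_cst.
    have -> : (fun y : R => y^-1 ^+ k.+1) = (fun y : R => y^-1) * (fun y : R => y^-1 ^+ k).
      by apply/funext => y; rewrite exprS.
    apply: is_derive_eq (is_deriveM d1 IH) _.
    by rewrite -![_ *: _]/(_ * _) -exprVn -natr1 !exprS; ring.
  have d3 := is_deriveM dk d2.
  apply: near_eq_is_derive (is_derive_eq d3 _).
    near=> y; have y0 : 0 < y by near: y; exact: (cvgr_gt x).
    by rewrite /flat y0 -exprVn.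
  rewrite /flat x0 -!exprVn !exprS.
  by rewrite -![_ *: _]/(_ * _); ring.
- rewrite !flat_le0// mulr0 addr0.
  have H : h^-1 *: ((flat k \o shift 0) (h *: (1 : R)) - flat k 0) @[h --> (0:R)^'] --> (0:R).
    apply/cvgrPdist_le => e e0; near=> h.
    have h0 : h != 0 by near: h; exact: nbhs_dnbhs_neq.
    rewrite sub0r normrN (flat_le0 k (lexx 0)) subr0 /shift /= addr0.
    rewrite -[h *: 1]/(h * 1) mulr1 -[_ *: _]/(_ * _).
    (* Dividing by the increment only raises the index, so the difference quotient at 0 is again a
       [flat] function and tends to 0 by [flat_bound]. *)
    have -> : h^-1 * flat k h = flat k.+1 h.
      rewrite /flat; case: ifP; rewrite ?mulr0// => _.
      by rewrite -!exprVn exprS mulrA.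
    rewrite (le_trans (flat_bound _ _))// -ler_pdivlMl ?exprn_gt0//.
    near: h; apply: dnbhs0_le.
    by rewrite mulr_gt0// invr_gt0 exprn_gt0.
  split; first by apply/cvg_ex; exists 0.
  exact/cvg_lim.
Unshelve. all: by end_near. Qed.

(* Every generator has a derivative of the same kind, whence smoothness. *)
Inductive smooth1 : (R -> R) -> Prop :=
| smooth1_cst c : smooth1 (fun=> c)
| smooth1_sin w : smooth1 (fun x => sin (w * x))
| smooth1_cos w : smooth1 (fun x => cos (w * x))
| smooth1D f g : smooth1 f -> smooth1 g -> smooth1 (fun x => f x + g x)
| smooth1M f g : smooth1 f -> smooth1 g -> smooth1 (fun x => f x * g x)
| smooth1_flat k f : smooth1 f -> smooth1 (fun x => flat k (f x))
| smooth1V f : smooth1 f -> (forall x, f x != 0) -> smooth1 (fun x => (f x)^-1).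

Lemma is_derive_scale (w x : R) : is_derive x 1 (fun x => w * x) w.
Proof.
by have := is_deriveZ w (is_derive_id x 1); rewrite -[_ *: 1]/(_ * 1) mulr1.
Qed.

Lemma smooth1_derive f : smooth1 f ->
  exists2 f' : R -> R, smooth1 f' & forall x : R, is_derive x 1 f (f' x).
Proof.
elim => [c|w|w|{}f g _ [f' sf' df] _ [g' sg' dg]|{}f g sf [f' sf' df] sg [g' sg' dg]
  |k {}f sf [f' sf' df]|{}f sf [f' sf' df] f0].
- by exists (fun=> 0); [exact: smooth1_cst|move=> x; exact: is_derive_cst].
- exists (fun x => cos (w * x) * w).
    by apply: smooth1M; [exact: smooth1_cos|exact: smooth1_cst].
  by move=> x; apply: is_derive1_comp; exact: is_derive_scale.
- exists (fun x => -1 * sin (w * x) * w).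
    apply: smooth1M; last exact: smooth1_cst.
    by apply: smooth1M; [exact: smooth1_cst|exact: smooth1_sin].
  by move=> x; rewrite mulN1r; apply: is_derive1_comp; exact: is_derive_scale.
- exists (fun x => f' x + g' x); first exact: smooth1D.
  by move=> x; exact: is_deriveD.
- exists (fun x => f x * g' x + g x * f' x).
    by apply: smooth1D; exact: smooth1M.
  by move=> x; exact: is_deriveM.
- exists (fun x => (- k%:R * flat k.+1 (f x) + flat k.+2 (f x)) * f' x).
    apply: smooth1M => //; apply: smooth1D; last exact: smooth1_flat.
    by apply: smooth1M; [exact: smooth1_cst|exact: smooth1_flat].
  move=> x; apply: (@is_derive1_comp R (flat k) f) => //; exact: is_derive_flat.
- exists (fun x => -1 * ((f x)^-1 * (f x)^-1) * f' x).
    apply: smooth1M => //; apply: smooth1M; first exact: smooth1_cst.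
    by apply: smooth1M; exact: smooth1V.
  move=> x; apply: is_derive_eq (is_deriveV (f0 x) (df x)) _.
  by rewrite -[_ *: _]/(_ * _) mulN1r -expr2 exprVn.
Qed.

Lemma smooth1_continuous f : smooth1 f -> continuous f.
Proof.
move=> /smooth1_derive[f' _ df] x.
by apply/differentiable_continuous/derivable1_diffP.
Qed.

End smooth_functions.

Section smooth_plane_functions.
Context {R : realType}.
Implicit Types (f : R -> R) (g h : R * R -> R).

(** Functions of one coordinate, their sums and their products: a class closed under both partial
    derivatives, yet large enough to contain convolutions with kernels that separate their
    variables. *)
Inductive smooth2 : (R * R -> R) -> Prop :=
| smooth2_fst f : smooth1 f -> smooth2 (fun p => f p.1)
| smooth2_snd f : smooth1 f -> smooth2 (fun p => f p.2)
| smooth2D g h : smooth2 g -> smooth2 h -> smooth2 (fun p => g p + h p)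
| smooth2M g h : smooth2 g -> smooth2 h -> smooth2 (fun p => g p * h p).

Lemma smooth2_derive (e : R * R) g : e = e_theta \/ e = e_t -> smooth2 g ->
  exists2 g' : R * R -> R, smooth2 g' & forall p : R * R, is_derive p e g (g' p).
Proof.
have cst0 : smooth2 (fun=> 0) by apply: (@smooth2_fst (fun=> 0)); exact: smooth1_cst.
have dcst (x c : R) : is_derive x 1 (fun=> c) (0 : R) by exact: is_derive_cst.
move=> eE; elim => [f sf|f sf|{}g h _ [g' sg dg] _ [h' sh dh]|{}g h sg [g' sg' dg] sh [h' sh' dh]].
- have [f' sf' df] := smooth1_derive sf.
  case: eE => ->; last by exists (fun=> 0) => // p; apply/is_derive_e_t; rewrite /=; exact: dcst.
  by exists (fun p => f' p.1); [exact: smooth2_fst|move=> p; exact/is_derive_e_theta].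
- have [f' sf' df] := smooth1_derive sf.
  case: eE => ->; first by exists (fun=> 0) => // p; apply/is_derive_e_theta; rewrite /=; exact: dcst.
  by exists (fun p => f' p.2); [exact: smooth2_snd|move=> p; exact/is_derive_e_t].
- exists (fun p => g' p + h' p); first exact: smooth2D.
  by move=> p; exact: is_deriveD.
- exists (fun p => g p * h' p + h p * g' p).
    by apply: smooth2D; exact: smooth2M.
  by move=> p; exact: is_deriveM.
Qed.

Lemma smooth2_continuous g : smooth2 g -> continuous g.
Proof.
elim => [f /smooth1_continuous cf p|f /smooth1_continuous cf p|{}g h _ cg _ ch p|{}g h _ cg _ ch p].
- by apply: (continuous_comp (f := fst) (g := f)); [exact: cvg_fst|exact: cf].
- by apply: (continuous_comp (f := snd) (g := f)); [exact: cvg_snd|exact: cf].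
- by apply: cvgD; [exact: cg|exact: ch].
- by apply: cvgM; [exact: cg|exact: ch].
Qed.

Lemma smooth2_partial (s : seq bool) g : smooth2 g -> smooth2 (partial s g).
Proof.
move=> sg; elim: s => //= b s IH; case: b.
- have [g' sg' dg] := smooth2_derive (or_intror erefl) IH.
  have -> // : d_t (partial s g) = g' by apply/funext => p; rewrite /d_t derive_val.
- have [g' sg' dg] := smooth2_derive (or_introl erefl) IH.
  have -> // : d_theta (partial s g) = g' by apply/funext => p; rewrite /d_theta derive_val.
Qed.

Lemma smooth2_Ck k g : smooth2 g -> Ck k setT g.
Proof.
move=> sg s _; have sp := smooth2_partial s sg; split=> [p _|_ p _].
  exact: smooth2_continuous.
have [g1 _ d1] := smooth2_derive (or_introl erefl) sp.
by have [g2 _ d2] := smooth2_derive (or_intror erefl) sp.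
Qed.

End smooth_plane_functions.

(** * Approximate identities on a box *)

Section approximate_identity.
Context {R : realType}.
Local Notation mR := (measurableTypeR R).
Local Notation mu := (@lebesgue_measure R).
Implicit Types (A B : R -> R) (G : R * R -> R).

Lemma continuous_itv_integrable (f : R -> R) (a b : R) : continuous f ->
  mu.-integrable (`[a, b] : set mR) (EFin \o f).
Proof.
move=> cf; apply: continuous_compact_integrable; first exact: segment_compact.
exact: continuous_subspaceT.
Qed.

Lemma continuous_fst (f : R -> R) : continuous f -> continuous (fun p : R * R => f p.1).
Proof.
by move=> cf p; apply: (continuous_comp (f := fst) (g := f)); [exact: cvg_fst|exact: cf].
Qed.

Lemma continuous_snd (f : R -> R) : continuous f -> continuous (fun p : R * R => f p.2).
Proof.
by move=> cf p; apply: (continuous_comp (f := snd) (g := f)); [exact: cvg_snd|exact: cf].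
Qed.

Lemma continuous_tensor A B : continuous A -> continuous B ->
  continuous (fun p : R * R => A p.1 * B p.2).
Proof.
by move=> cA cB p; apply: cvgM; [exact: continuous_fst|exact: continuous_snd].
Qed.

Lemma Rintegral_tensor A B (a b c d : R) : continuous A -> continuous B ->
  \int[leb2]_(p in `[a, b] `*` `[c, d]) (A p.1 * B p.2) =
  (\int[mu]_(x in `[a, b]) A x) * \int[mu]_(y in `[c, d]) B y.
Proof.
move=> cA cB.
rewrite Rintegral_fubiniX ?measurable_itv//; last first.
  exact/continuous_box_integrable/continuous_tensor.
rewrite -RintegralZr ?measurable_itv//; last exact: continuous_itv_integrable.
apply: eq_Rintegral => x _.
rewrite /= RintegralZl ?measurable_itv//; exact: continuous_itv_integrable.
Qed.

Lemma Rintegral_itv1 (a b : R) : 0 <= \int[mu]_(x in `[a, b]) 1 <= `|b - a|.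
Proof.
rewrite Rintegral_cst ?measurable_itv// mul1r [X in fine X]lebesgue_measure_itv/= lte_fin.
by case: ltP => ab /=; rewrite ?lexx ?normr_ge0// subr_ge0 ltW// ler_norm.
Qed.

(** The masses are only required to converge, to arbitrary limits [al] and [be], in order to cover
    two uses: the normalised cosine kernels, of mass exactly 1, and Poisson kernels truncated to a
    box, whose masses merely tend to 2 pi. Continuity of [G] is needed at [p] alone, so [G] may be
    an indicator. *)
Lemma approximate_identity (A_ B_ : nat -> R -> R) G (a b c d M al be : R) (p : R * R) :
  (forall n, continuous (A_ n)) -> (forall n, continuous (B_ n)) ->
  (forall n x, 0 <= A_ n x) -> (forall n x, 0 <= B_ n x) ->
  (fun n => \int[mu]_(x in `[a, b]) A_ n x) @ \oo --> al ->
  (fun n => \int[mu]_(y in `[c, d]) B_ n y) @ \oo --> be ->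
  (forall dl eta : R, 0 < dl -> 0 < eta -> \forall n \near \oo,
     forall x, x \in `[a, b] -> dl <= `|x - p.1| -> A_ n x <= eta) ->
  (forall dl eta : R, 0 < dl -> 0 < eta -> \forall n \near \oo,
     forall y, y \in `[c, d] -> dl <= `|y - p.2| -> B_ n y <= eta) ->
  measurable_fun (`[a, b] `*` `[c, d] : set (mR * mR)) G ->
  (forall q, (`[a, b] `*` `[c, d]) q -> `|G q| <= M) ->
  `|G p| <= M -> {for p, continuous G} ->
  (fun n => \int[leb2]_(q in `[a, b] `*` `[c, d]) (G q * (A_ n q.1 * B_ n q.2)))
    @ \oo --> G p * (al * be).
Proof.
move=> cA cB A0 B0 Aal Bbe tA tB mG GM GpM cG.
set D := `[a, b] `*` `[c, d].
have mD : measurable (D : set (mR * mR)) := measurable_box a b c d.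
pose iA n := \int[mu]_(x in `[a, b]) A_ n x.
pose iB n := \int[mu]_(x in `[c, d]) B_ n x.
have iAB n : leb2.-integrable (D : set (mR * mR)) (EFin \o (fun q => A_ n q.1 * B_ n q.2)).
  by apply: continuous_box_integrable; exact: continuous_tensor.
have M0 : 0 <= M by exact: le_trans GpM.
suff H : (fun n => \int[leb2]_(q in D) ((G q - G p) * (A_ n q.1 * B_ n q.2))) @ \oo --> 0.
  have -> : (fun n => \int[leb2]_(q in D) (G q * (A_ n q.1 * B_ n q.2))) =
      (fun n => \int[leb2]_(q in D) ((G q - G p) * (A_ n q.1 * B_ n q.2)) +
        G p * (iA n * iB n)).
    apply/funext => n; rewrite -Rintegral_tensor// -RintegralZl//.
    rewrite -RintegralD//; last 2 first.
    - apply: (@Rintegrable_mulbounded _ _ _ _ _ mD (M + M)) => //.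
        by apply: measurable_funB.
      by move=> q Dq; rewrite (le_trans (ler_normB _ _))// lerD// GM.
    - exact: RintegrableZ.
    by apply: eq_Rintegral => q _; ring.
  rewrite -[X in _ --> X]add0r; apply: cvgD => //.
  by apply: cvgM; [exact: cvg_cst|apply: cvgM].
apply/cvgr0Pnorm_le => e e0.
(* Near [p] the error is at most [ep] times a total mass bounded by [K]. Elsewhere one of the two
   factors is at most [eta], so the product is at most [eta] times the sum of the factors, whose
   integral is bounded by [L], while [M + M] bounds the oscillation of [G]. Both contributions are
   at most e / 2; the 1 added in [eta] keeps its denominator positive. *)
pose K := (`|al| + 1) * (`|be| + 1).
have K0 : 0 < K by rewrite mulr_gt0// ltr_wpDl.
pose L := `|d - c| * (`|al| + 1) + `|b - a| * (`|be| + 1).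
have L0 : 0 <= L by rewrite addr_ge0// mulr_ge0// addr_ge0.
pose ep := e / 2 / K.
have ep0 : 0 < ep by rewrite !divr_gt0.
pose eta := e / 2 / ((M + M) * L + 1).
have ML0 : 0 <= (M + M) * L by rewrite mulr_ge0// addr_ge0.
have eta0 : 0 < eta by rewrite divr_gt0 ?divr_gt0// ltr_wpDl.
have [dl dl0 Gdl] : exists2 dl, 0 < dl & forall q, `|q.1 - p.1| < dl -> `|q.2 - p.2| < dl ->
    `|G q - G p| <= ep.
  have /cvgrPdist_le/(_ _ ep0) := cG; move=> /nbhs_ballP[dl /= dl0 dlP].
  exists dl => // q q1 q2; rewrite distrC; apply: dlP.
  by split; rewrite /= /ball/= distrC.
near=> n.
have n1 : `|iA n| <= `|al| + 1.
  by near: n; apply: cvgr_norm_le; [exact: Aal|rewrite ltrDl].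
have n2 : `|iB n| <= `|be| + 1.
  by near: n; apply: cvgr_norm_le; [exact: Bbe|rewrite ltrDl].
have n3 : forall x, x \in `[a, b] -> dl <= `|x - p.1| -> A_ n x <= eta.
  by near: n; exact: tA.
have n4 : forall x, x \in `[c, d] -> dl <= `|x - p.2| -> B_ n x <= eta.
  by near: n; exact: tB.
have iG : leb2.-integrable (D : set (mR * mR))
    (EFin \o (fun q => (G q - G p) * (A_ n q.1 * B_ n q.2))).
  apply: (@Rintegrable_mulbounded _ _ _ _ _ mD (M + M)) => //.
    by apply: measurable_funB.
  by move=> q Dq; rewrite (le_trans (ler_normB _ _))// lerD// GM.
have iA1 : leb2.-integrable (D : set (mR * mR)) (EFin \o (fun q => A_ n q.1)).
  by apply: continuous_box_integrable; exact: continuous_fst.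
have iB1 : leb2.-integrable (D : set (mR * mR)) (EFin \o (fun q => B_ n q.2)).
  by apply: continuous_box_integrable; exact: continuous_snd.
have IA1 : \int[leb2]_(q in D) A_ n q.1 <= `|d - c| * (`|al| + 1).
  under eq_Rintegral do rewrite -[A_ _ _]mulr1.
  rewrite (@Rintegral_tensor _ (cst 1))//; last exact: cst_continuous.
  have /andP[h1 h2] := Rintegral_itv1 c d.
  by rewrite mulrC ler_pM// ?Rintegral_ge0// (le_trans (ler_norm _)).
have IB1 : \int[leb2]_(q in D) B_ n q.2 <= `|b - a| * (`|be| + 1).
  under eq_Rintegral do rewrite -[B_ _ _]mul1r.
  rewrite (@Rintegral_tensor (cst 1))//; last exact: cst_continuous.
  have /andP[h1 h2] := Rintegral_itv1 a b.
  by rewrite ler_pM// ?Rintegral_ge0// (le_trans (ler_norm _)).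
apply: le_trans (le_normr_Rintegral mD iG) _.
have bnd : \int[leb2]_(q in D) `|(G q - G p) * (A_ n q.1 * B_ n q.2)| <=
    \int[leb2]_(q in D) (ep * (A_ n q.1 * B_ n q.2) +
      ((M + M) * eta) * (A_ n q.1 + B_ n q.2)).
  apply: le_Rintegral => //; first exact: integrable_norm.
    by apply: RintegrableD => //; apply: RintegrableZ => //; exact: RintegrableD.
  move=> q [/= q1 q2].
  have AB0 : 0 <= A_ n q.1 * B_ n q.2 by rewrite mulr_ge0.
  have GM2 : `|G q - G p| <= M + M by rewrite (le_trans (ler_normB _ _))// lerD// GM.
  rewrite normrM (ger0_norm AB0).
  have [h1|h1] := ltP `|q.1 - p.1| dl; last first.
    rewrite -[leLHS]add0r lerD ?(mulr_ge0 (ltW ep0))// -mulrA.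
    rewrite ler_pM// mulrDr; apply: ler_wpDl; first by rewrite mulr_ge0// ltW.
    by rewrite ler_wpM2r// n3.
  have [h2|h2] := ltP `|q.2 - p.2| dl; last first.
    rewrite -[leLHS]add0r lerD ?(mulr_ge0 (ltW ep0))// -mulrA.
    rewrite ler_pM// mulrDr; apply: ler_wpDr; first by rewrite mulr_ge0// ltW.
    by rewrite mulrC ler_wpM2r// n4.
  rewrite -[leLHS]addr0 lerD// ?ler_wpM2r ?Gdl//.
  by apply: mulr_ge0; [apply: mulr_ge0; [exact: addr_ge0|exact: ltW]|exact: addr_ge0].
apply: le_trans bnd _.
rewrite RintegralD//; last 2 first.
- exact: RintegrableZ.
- by apply: RintegrableZ => //; exact: RintegrableD.
rewrite !RintegralZl// ?RintegralD//; last exact: RintegrableD.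
rewrite [leRHS]splitr lerD//.
  rewrite Rintegral_tensor// /ep -[leRHS](divfK (lt0r_neq0 K0)) ler_wpM2l//.
    by rewrite ltW.
  rewrite (le_trans (ler_norm _))// normrM ler_pM//.
rewrite (@le_trans _ _ (((M + M) * eta) * L))//.
  apply: ler_wpM2l; last by rewrite /L lerD.
  by apply: mulr_ge0; [exact: addr_ge0|exact: ltW].
have -> : (M + M) * eta * L = e / 2 * (((M + M) * L) / ((M + M) * L + 1)).
  by rewrite /eta; ring.
rewrite -[leRHS]mulr1; apply: ler_wpM2l; first by rewrite divr_ge0// ltW.
by rewrite ler_pdivrMr ?mul1r ?lerDl// ltr_wpDl.
Unshelve. all: by end_near. Qed.

End approximate_identity.

Section interval_integrals.
Context {R : realType}.
Local Notation mR := (measurableTypeR R).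
Local Notation mu := (@lebesgue_measure R).
Implicit Types f : R -> R.

Lemma Rintegral_itv_affine f (s r a b : R) : r != 0 -> continuous f ->
  \int[mu]_(x in `[a, b]) f x =
  `|r| * \int[mu]_(x in (fun x => r * x + s) @^-1` `[a, b]) f (r * x + s).
Proof.
move=> r0 cf.
have fi : mu.-integrable setT (EFin \o (f \_ `[a, b])).
  apply: (Rintegrable_patch mu f (measurable_itv `[a, b])).1.
  exact: continuous_itv_integrable.
by rewrite Rintegral_mkcond (Rintegral_affine s r0 fi) [in RHS]Rintegral_mkcond.
Qed.

Lemma Rintegral_itv_shift f (s a b : R) : continuous f ->
  \int[mu]_(x in `[a, b]) f (x + s) = \int[mu]_(x in `[a + s, b + s]) f x.
Proof.
move=> cf; rewrite [RHS](@Rintegral_itv_affine _ s 1)// ?oner_eq0// normr1 mul1r.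
have -> : (fun x => 1 * x + s) @^-1` `[a + s, b + s] = `[a, b]%classic.
  by apply/seteqP; split=> x /=; rewrite !in_itv/= mul1r !lerD2r.
by apply: eq_Rintegral => x _; rewrite mul1r.
Qed.

Lemma Rintegral_itv_shift_eq f (s a b c d : R) : continuous f ->
  c = a + s -> d = b + s ->
  \int[mu]_(x in `[a, b]) f (x + s) = \int[mu]_(x in `[c, d]) f x.
Proof. by move=> cf -> ->; exact: Rintegral_itv_shift. Qed.

Lemma Rintegral_itv_split f (a b c : R) : continuous f -> a <= b -> b <= c ->
  \int[mu]_(x in `[a, c]) f x =
  \int[mu]_(x in `[a, b]) f x + \int[mu]_(x in `[b, c]) f x.
Proof.
move=> cf ab bc.
have fi : mu.-integrable (`]b, c] : set mR) (EFin \o f).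
  apply: integrableS (continuous_itv_integrable b c cf).
  - exact: measurable_itv.
  - exact: measurable_itv.
  - by move=> x /=; rewrite !in_itv/= => /andP[/ltW-> ->].
rewrite -(Rintegral_itv_obnd_cbnd fi) -(@Rintegral_itvB _ f (BLeft a) (BRight c) b).
- by rewrite addrC subrK.
- exact: continuous_itv_integrable.
- by rewrite bnd_simp.
- by rewrite bnd_simp.
Qed.

(** The part of the shifted window that leaves [- h, h] is brought back by one period; the bound on
    [x] makes a single cut sufficient. *)
Lemma Rintegral_period f (h x : R) : continuous f -> 0 < h ->
  (forall y, f (y + (h + h)) = f y) -> - h <= x <= h ->
  \int[mu]_(y in `[- h, h]) f (y + x) = \int[mu]_(y in `[- h, h]) f y.
Proof.
move=> cf h0 pf /andP[x1 x2]; rewrite Rintegral_itv_shift//.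
have [x0|x0] := leP 0 x.
  rewrite (@Rintegral_itv_split f (- h + x) h); [|by []|lra|lra].
  rewrite (@Rintegral_itv_split f (- h) (- h + x) h); [|by []|lra|lra].
  rewrite addrC; congr (_ + _).
  under [RHS]eq_Rintegral do rewrite -pf.
  by apply/esym/Rintegral_itv_shift_eq => //; ring.
rewrite (@Rintegral_itv_split f (- h + x) (- h)); [|by []|lra|lra].
rewrite (@Rintegral_itv_split f (- h) (h + x) h); [|by []|lra|lra].
rewrite addrC; congr (_ + _).
under eq_Rintegral do rewrite -pf.
by apply: Rintegral_itv_shift_eq => //; ring.
Qed.

Lemma Rintegral_ge_itv f (a b c d m : R) : continuous f -> (forall x, 0 <= f x) ->
  a <= c -> c <= d -> d <= b -> (forall x, c <= x <= d -> m <= f x) ->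
  (d - c) * m <= \int[mu]_(x in `[a, b]) f x.
Proof.
move=> cf f0 ac cd db fm.
rewrite (@Rintegral_itv_split f a c b)//; last exact: le_trans db.
rewrite (@Rintegral_itv_split f c d b)//.
rewrite (@le_trans _ _ (\int[mu]_(x in `[c, d]) m))//.
  rewrite Rintegral_cst ?measurable_itv// [X in fine X]lebesgue_measure_itv/= lte_fin.
  case: ltP => [_|dc] /=; first by rewrite mulrC.
  have -> : d = c by apply/eqP; rewrite eq_le cd dc.
  by rewrite subrr mul0r mulr0.
rewrite (@le_trans _ _ (\int[mu]_(x in `[c, d]) f x))//.
  apply: le_Rintegral; first exact: measurable_itv.
  - by apply: continuous_itv_integrable; exact: cst_continuous.
  - exact: continuous_itv_integrable.
  - by move=> x /=; rewrite in_itv/=; exact: fm.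
by rewrite addrCA lerDl addr_ge0// Rintegral_ge0.
Qed.

End interval_integrals.

(** * Mass and concentration of the powers of 1 + cos *)

Section trigonometric_kernel.
Context {R : realType}.
Variables w h : R.
Hypotheses (w0 : 0 < w) (h0 : 0 < h) (wh : w * h = pi).
Local Notation mu := (@lebesgue_measure R).

(* Powers of 1 + cos are smooth and periodic, and concentrate at the periods: an
   approximate identity that never leaves the torus. *)
Definition cosker (n : nat) (x : R) : R := (1 + cos (w * x)) ^+ n.

Definition cosmass (n : nat) : R := \int[mu]_(x in `[- h, h]) cosker n x.

Lemma add1cos_ge0 (x : R) : 0 <= 1 + cos x.
Proof. by rewrite -lerBlDl sub0r cos_geN1. Qed.

Lemma cosker_ge0 n x : 0 <= cosker n x.
Proof. by rewrite exprn_ge0// add1cos_ge0. Qed.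

Lemma continuous_cosker n : continuous (cosker n).
Proof.
move=> x; apply: (@continuous_comp _ _ _ (fun x => 1 + cos (w * x)) (fun y => y ^+ n)).
  apply: cvgD; first exact: cvg_cst.
  apply: (@continuous_comp _ _ _ (fun x => w * x) cos); last exact: continuous_cos.
  by apply: cvgM; [exact: cvg_cst|exact: cvg_id].
exact: exprn_continuous.
Qed.

Lemma coskerN n x : cosker n (- x) = cosker n x.
Proof. by rewrite /cosker mulrN cosN. Qed.

Lemma cosker_period n x : cosker n (x + (h + h)) = cosker n x.
Proof.
rewrite /cosker (_ : w * (x + (h + h)) = w * x + pi *+ 2) ?cosD2pi//.
by rewrite mulr2n -wh; ring.
Qed.

Lemma cosker_itv n x : - h <= x <= h ->
  \int[mu]_(y in `[- h, h]) cosker n (x - y) = cosmass n.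
Proof.
move=> xh; rewrite /cosmass -(@Rintegral_period _ (cosker n) h (- x))//.
- by apply: eq_Rintegral => y _; rewrite -coskerN opprB.
- exact: continuous_cosker.
- exact: cosker_period.
- by move: xh => /andP[]; lra.
Qed.

(** Only [- a, a] is kept, where cos is smallest at the ends. With [a] smaller than the distance
    considered in the tail, the base of this power exceeds that of the tail. *)
Lemma cosmass_ge n (a : R) : 0 < a <= h ->
  (a + a) * (1 + cos (w * a)) ^+ n <= cosmass n.
Proof.
move=> /andP[a0 ah].
have cosle (y : R) : - a <= y <= a -> cos (w * a) <= cos (w * y).
  move=> /andP[y1 y2]; rewrite -[cos (w * y)]cos_norm normrM (gtr0_norm w0).
  have ya : `|y| <= a by rewrite ler_norml y1.
  have wa : w * a <= pi by rewrite -wh ler_wpM2l// ltW.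
  rewrite leNgt ltr_cos ?in_itv/= ?mulr_ge0 ?wa ?(ltW w0) ?(ltW a0)//.
    by rewrite -leNgt ler_wpM2l// ltW.
  by rewrite (le_trans _ wa)// ler_wpM2l// ltW.
have := @Rintegral_ge_itv _ (cosker n) (- h) h (- a) a ((1 + cos (w * a)) ^+ n).
rewrite opprK; apply => //.
- exact: continuous_cosker.
- exact: cosker_ge0.
- by rewrite lerN2.
- lra.
- by move=> x xa; rewrite lerXn2r ?nnegrE ?add1cos_ge0// lerD2l cosle.
Qed.

Lemma cos_lt_half (d : R) : 0 < d <= h -> cos (w * d) < cos (w * (d / 2)).
Proof.
move=> /andP[d0 dh].
have wd : w * d <= pi by rewrite -wh ler_wpM2l// ltW.
have wd0 : 0 < w * d by rewrite mulr_gt0.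
rewrite ltr_cos ?in_itv/= ?wd ?(ltW wd0)//; last by apply/andP; split; lra.
lra.
Qed.

Lemma cosmass_gt0 n : 0 < cosmass n.
Proof.
have hh : 0 < h / 2 <= h by move: h0 => ?; apply/andP; split; lra.
apply: lt_le_trans (cosmass_ge n hh); rewrite mulr_gt0 ?exprn_gt0//; first by move: h0; lra.
have /cos_lt_half : 0 < h <= h by rewrite lexx h0.
by have := cos_geN1 (w * h); lra.
Qed.

Lemma cosker_tail (x dl eta : R) : - h < x < h -> 0 < dl -> 0 < eta ->
  \forall n \near \oo, forall y, y \in `[- h, h] -> dl <= `|y - x| ->
    cosker n (x - y) / cosmass n <= eta.
Proof.
move=> /andP[x1 x2] dl0 eta0.
(* [d] separates |x - y| from 0 and also from the full period 2 h, at which the kernel peaks again: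
   as |y| <= h, the distance is at most h + |x| <= 2 h - d. *)
pose d := Num.min dl (h - `|x|).
have d0 : 0 < d by rewrite lt_min dl0 subr_gt0 ltr_norml x1.
have dh : d <= h - `|x| by rewrite ge_min lexx orbT.
have ddl : d <= dl by rewrite ge_min lexx.
have dhh : 0 < d <= h by rewrite d0 (le_trans dh)// gerBl.
have dhh2 : 0 < d / 2 <= h by move: dhh => /andP[]; lra.
(* The numerator governs the kernel at distance at least [d], the denominator bounds the mass from
   below through [- d / 2, d / 2]. Since q < 1, the quotient decays geometrically. *)
pose q := (1 + cos (w * d)) / (1 + cos (w * (d / 2))).
have q2 : 0 < 1 + cos (w * (d / 2)).
  by have := cos_lt_half dhh; have := cos_geN1 (w * d); lra.
have q0 : 0 <= q by rewrite divr_ge0 ?add1cos_ge0.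
have q1 : `|q| < 1.
  by rewrite ger0_norm// ltr_pdivrMr// mul1r ltrD2l cos_lt_half.
(* The factor [d] is the length of the interval [- d / 2, d / 2] in the lower bound for the mass. *)
have ed0 : 0 < eta * d by rewrite mulr_gt0.
have := cvg_expr q1 => /cvgr0Pnorm_le/(_ _ ed0) qn.
near=> n; move=> y; rewrite in_itv/= => /andP[y1 y2] dly.
rewrite ler_pdivrMr ?cosmass_gt0//.
have qne : q ^+ n <= eta * d.
  by rewrite (le_trans (ler_norm _))//; near: n.
have cosz : cos (w * (x - y)) <= cos (w * d).
  rewrite -[cos (w * (x - y))]cos_norm normrM (gtr0_norm w0) distrC.
  set z := `|y - x| in dly *.
  have zd : d <= z by exact: le_trans dly.
  have zh : z <= h + h - d.
    have := ler_normB y x; have : `|y| <= h by rewrite ler_norml y1.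
    by rewrite -/z; lra.
  have wzd : w * d <= w * z by rewrite ler_wpM2l// ltW.
  have wzh : w * z <= w * (h + h - d) by rewrite ler_wpM2l// ltW.
  have wd0 : 0 < w * d by rewrite mulr_gt0.
  have wdh : w * d <= w * h by rewrite ler_wpM2l ?(ltW w0)//; case/andP: dhh.
  have E : w * (h + h - d) = pi + pi - w * d by rewrite -wh; ring.
  rewrite E in wzh; rewrite wh in wdh.
  have [zpi|zpi] := leP (w * z) pi.
    rewrite leNgt ltr_cos ?in_itv/= ?zpi ?wdh ?(ltW wd0) -?leNgt//.
    by rewrite (le_trans _ wzd) ?ltW.
  (* In the second half of the period, a reflection brings the angle back to [0, pi], where cos is
     decreasing. *)
  have -> : cos (w * z) = cos (pi + pi - w * z).
    by rewrite -cosN -(cosD2pi (- (w * z))) mulr2n addrC.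
  rewrite leNgt ltr_cos ?in_itv/= ?wdh ?(ltW wd0) -?leNgt//; first by lra.
  by apply/andP; split; lra.
have ck : cosker n (x - y) <= (1 + cos (w * d)) ^+ n.
  by rewrite lerXn2r ?nnegrE ?add1cos_ge0// lerD2l.
apply: le_trans ck _.
have -> : (1 + cos (w * d)) ^+ n = q ^+ n * (1 + cos (w * (d / 2))) ^+ n.
  by rewrite -exprMn divfK// gt_eqF.
apply: le_trans (_ : eta * d * (1 + cos (w * (d / 2))) ^+ n <= _).
  by rewrite ler_wpM2r// exprn_ge0// ltW.
rewrite -mulrA ler_wpM2l ?(ltW eta0)//.
have := cosmass_ge n dhh2; congr (_ * _ <= _); lra.
Unshelve. all: by end_near. Qed.

End trigonometric_kernel.

(** * Differentiation of convolutions with trigonometric kernels *)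

Section separable_kernels.
Context {R : realType}.
Local Notation mR := (measurableTypeR R).
Local Notation mu := (@lebesgue_measure R).
Implicit Types (a b g u w : R * R -> R) (k : R * R -> R * R -> R).

Lemma measurable_T2 : measurable (T2 : set (mR * mR)).
Proof. exact: measurable_box. Qed.

Let mT2 : measurable (T2 : set (mR * mR)) := measurable_T2.

Lemma leb2_T2 : (leb2 (T2 : set (mR * mR)) < +oo)%E.
Proof. exact: leb2_box. Qed.

Lemma continuous_T2_bounded g : continuous g ->
  exists M : R, forall p, T2 p -> `|g p| <= M.
Proof. exact: continuous_box_bounded. Qed.

Lemma integrable_T2_mul w g : continuous g ->
  leb2.-integrable (T2 : set (mR * mR)) (EFin \o w) ->
  leb2.-integrable (T2 : set (mR * mR)) (EFin \o (fun q => w q * g q)).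
Proof.
move=> cg wi; have [M gM] := continuous_T2_bounded cg.
apply: eq_integrable (Rintegrable_mulbounded measurable_T2 _ wi gM).
- exact: measurable_T2.
- by move=> x _ /=; rewrite mulrC.
- by apply: measurable_funTS; exact: continuous_measurable_fun2.
Qed.

(* [k1] and [k2] are the partial derivatives of [k] in [p]. Trigonometric kernels
   are finite sums of products [a p * b q], so that no differentiation under the
   integral sign is needed. *)
Definition smoothing_kernel k k1 k2 : Prop :=
  [/\ forall p, continuous (k p), forall p, continuous (k1 p),
      forall p, continuous (k2 p) &
      forall w, leb2.-integrable (T2 : set (mR * mR)) (EFin \o w) ->
      [/\ smooth2 (fun p => \int[leb2]_(q in T2) (w q * k p q)),
          forall p : R * R, is_derive p e_theta
            (fun p => \int[leb2]_(q in T2) (w q * k p q))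
            (\int[leb2]_(q in T2) (w q * k1 p q)) &
          forall p : R * R, is_derive p e_t
            (fun p => \int[leb2]_(q in T2) (w q * k p q))
            (\int[leb2]_(q in T2) (w q * k2 p q))]].

Lemma smoothing_kernel1 : smoothing_kernel (fun _ _ => 1) (fun _ _ => 0) (fun _ _ => 0).
Proof.
split=> [p|p|p|w wi]; [exact: cst_continuous..|].
have E0 : \int[leb2]_(q in T2) (w q * 0) = 0.
  by rewrite /Rintegral; under eq_integral do rewrite mulr0; rewrite integral0.
rewrite E0; split=> [|p|p]; [|exact: is_derive_cst|exact: is_derive_cst].
by apply: (@smooth2_fst _ (fun=> _)); exact: smooth1_cst.
Qed.

(** The factor [a p] leaves the integral and the factor [b q] is absorbed into the weight; this is
    why [smoothing_kernel] quantifies over all integrable weights. *)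
Lemma smoothing_kernelM a a1 a2 b k k1 k2 : smooth2 a -> continuous b ->
  continuous a1 -> continuous a2 ->
  (forall p : R * R, is_derive p e_theta a (a1 p)) ->
  (forall p : R * R, is_derive p e_t a (a2 p)) ->
  smoothing_kernel k k1 k2 ->
  smoothing_kernel (fun p q => a p * b q * k p q)
    (fun p q => a1 p * b q * k p q + a p * b q * k1 p q)
    (fun p q => a2 p * b q * k p q + a p * b q * k2 p q).
Proof.
move=> sa cb ca1 ca2 da1 da2 [ck ck1 ck2 kP].
have cabk (c : R) k' p : (forall p, continuous (k' p)) -> continuous (fun q => c * b q * k' p q).
  move=> ck' q; apply: cvgM; last exact: ck'.
  by apply: cvgM; [exact: cvg_cst|exact: cb].
split=> [p|p|p|w wi]; first exact: cabk.
- by move=> q; apply: cvgD; exact: cabk.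
- by move=> q; apply: cvgD; exact: cabk.
have wbi := integrable_T2_mul cb wi.
have E (c : R) k' p : (forall p, continuous (k' p)) ->
    \int[leb2]_(q in T2) (w q * (c * b q * k' p q)) =
    c * \int[leb2]_(q in T2) (w q * b q * k' p q).
  move=> ck'; rewrite -RintegralZl//; last exact: integrable_T2_mul.
  by apply: eq_Rintegral => q _; ring.
have E2 (c d : R) k' k'' p : (forall p, continuous (k' p)) -> (forall p, continuous (k'' p)) ->
    \int[leb2]_(q in T2) (w q * (c * b q * k' p q + d * b q * k'' p q)) =
    c * (\int[leb2]_(q in T2) (w q * b q * k' p q)) +
    d * \int[leb2]_(q in T2) (w q * b q * k'' p q).
  move=> ck' ck''; rewrite -!E// -RintegralD//; last 2 first.
  - by apply: integrable_T2_mul => //; exact: cabk.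
  - by apply: integrable_T2_mul => //; exact: cabk.
  by apply: eq_Rintegral => q _; rewrite mulrDr.
have [s d1 d2] := kP _ wbi.
under eq_fun do rewrite E//.
split=> [|p|p]; first exact: smooth2M.
- apply: is_derive_eq (is_deriveM (da1 p) (d1 p)) _.
  by rewrite E2// -![_ *: _]/(_ * _) addrC [X in X + _]mulrC.
- apply: is_derive_eq (is_deriveM (da2 p) (d2 p)) _.
  by rewrite E2// -![_ *: _]/(_ * _) addrC [X in X + _]mulrC.
Qed.

Lemma smoothing_kernelD k k1 k2 k' k1' k2' :
  smoothing_kernel k k1 k2 -> smoothing_kernel k' k1' k2' ->
  smoothing_kernel (fun p q => k p q + k' p q) (fun p q => k1 p q + k1' p q)
    (fun p q => k2 p q + k2' p q).
Proof.
move=> [ck ck1 ck2 kP] [ck' ck1' ck2' kP'].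
have cD k3 k4 p : (forall p, continuous (k3 p)) -> (forall p, continuous (k4 p)) ->
  continuous (fun q => k3 p q + k4 p q).
  by move=> c3 c4 q; apply: cvgD; [exact: c3|exact: c4].
split=> [p|p|p|w wi]; [exact: cD..|].
have E k3 k4 p : (forall p, continuous (k3 p)) -> (forall p, continuous (k4 p)) ->
    \int[leb2]_(q in T2) (w q * (k3 p q + k4 p q)) =
    \int[leb2]_(q in T2) (w q * k3 p q) + \int[leb2]_(q in T2) (w q * k4 p q).
  move=> c3 c4; rewrite -RintegralD//; last 2 first.
  - exact: integrable_T2_mul.
  - exact: integrable_T2_mul.
  by apply: eq_Rintegral => q _; rewrite mulrDr.
have [s d1 d2] := kP _ wi; have [s' d1' d2'] := kP' _ wi.
under eq_fun do rewrite E//.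
split=> [|p|p]; first exact: smooth2D.
- by rewrite E//; exact: is_deriveD.
- by rewrite E//; exact: is_deriveD.
Qed.

Lemma eq_smoothing_kernel k k1 k2 k' k1' k2' :
  (forall p q, k p q = k' p q) -> (forall p q, k1 p q = k1' p q) ->
  (forall p q, k2 p q = k2' p q) ->
  smoothing_kernel k k1 k2 -> smoothing_kernel k' k1' k2'.
Proof.
move=> E E1 E2.
have -> : k = k' by apply/funext => p; apply/funext => q; exact: E.
have -> : k1 = k1' by apply/funext => p; apply/funext => q; exact: E1.
by have -> : k2 = k2' by apply/funext => p; apply/funext => q; exact: E2.
Qed.

(** The product rule applied to one factor 1 + cos at a time, so that its recursion matches the
    induction in [smoothing_torus_kernel]. *)
Fixpoint dcosker (w : R) (n : nat) (x : R) : R :=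
  if n is n'.+1 then
    (1 + cos (w * x)) * dcosker w n' x - w * sin (w * x) * cosker w n' x
  else 0.

Lemma is_derive_cosker (w : R) n (x : R) : is_derive x 1 (cosker w n) (dcosker w n x).
Proof.
elim: n => [|n IH] /=.
  by apply: (@is_derive_cst _ _ _ (1 : R)).
have -> : cosker w n.+1 = (fun x => 1 + cos (w * x)) * cosker w n.
  by apply/funext => y; rewrite /cosker exprS.
have dc : is_derive x 1 (fun x : R => cos (w * x)) (- sin (w * x) * w).
  by apply: is_derive1_comp; exact: is_derive_scale.
apply: is_derive_eq (is_deriveM (is_deriveD (is_derive_cst (1 : R) x 1) dc) IH) _.
by rewrite -[LHS]/((1 + cos (w * x)) * _ + _ * _) add0r; ring.
Qed.

Definition torus_kernel n (p q : R * R) : R :=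
  cosker 1 n (p.1 - q.1) * cosker pi n (p.2 - q.2).

Lemma smoothing_kernel_fst (f f' : R -> R) b k k1 k2 :
  smooth1 f -> smooth1 f' -> (forall x : R, is_derive x 1 f (f' x)) ->
  continuous b -> smoothing_kernel k k1 k2 ->
  smoothing_kernel (fun p q => f p.1 * b q * k p q)
    (fun p q => f' p.1 * b q * k p q + f p.1 * b q * k1 p q)
    (fun p q => f p.1 * b q * k2 p q).
Proof.
move=> sf sf' df cb kP.
apply: eq_smoothing_kernel (smoothing_kernelM (a := fun p => f p.1)
  (a1 := fun p => f' p.1) (a2 := fun p => 0) _ cb _ _ _ _ kP) => //.
- by move=> p q; rewrite mul0r mul0r add0r.
- exact: smooth2_fst.
- exact/continuous_fst/smooth1_continuous.
- exact: cst_continuous.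
- by move=> p; apply/is_derive_e_theta; exact: df.
- by move=> p; apply/is_derive_e_t; rewrite /=; exact: is_derive_cst.
Qed.

Lemma smoothing_kernel_snd (f f' : R -> R) b k k1 k2 :
  smooth1 f -> smooth1 f' -> (forall x : R, is_derive x 1 f (f' x)) ->
  continuous b -> smoothing_kernel k k1 k2 ->
  smoothing_kernel (fun p q => f p.2 * b q * k p q)
    (fun p q => f p.2 * b q * k1 p q)
    (fun p q => f' p.2 * b q * k p q + f p.2 * b q * k2 p q).
Proof.
move=> sf sf' df cb kP.
apply: eq_smoothing_kernel (smoothing_kernelM (a := fun p => f p.2)
  (a1 := fun p => 0) (a2 := fun p => f' p.2) _ cb _ _ _ _ kP) => //.
- by move=> p q; rewrite mul0r mul0r add0r.
- exact: smooth2_snd.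
- exact: cst_continuous.
- exact/continuous_snd/smooth1_continuous.
- by move=> p; apply/is_derive_e_theta; rewrite /=; exact: is_derive_cst.
- by move=> p; apply/is_derive_e_t; exact: df.
Qed.

Lemma is_derive_cos_scale (w x : R) : is_derive x 1 (fun x => cos (w * x)) (- w * sin (w * x)).
Proof.
apply: is_derive_eq (@is_derive1_comp _ cos (fun x => w * x) _ _ _ (is_derive_cos _) (is_derive_scale _ _)) _.
by ring.
Qed.

Lemma is_derive_sin_scale (w x : R) : is_derive x 1 (fun x => sin (w * x)) (w * cos (w * x)).
Proof.
apply: is_derive_eq (@is_derive1_comp _ sin (fun x => w * x) _ _ _ (is_derive_sin _) (is_derive_scale _ _)) _.
by ring.
Qed.

(** The addition formula for the cosine writes the new factor as 1 + cos cos + sin sin, a sum of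
    products separated in [p] and [q]. *)
Lemma smoothing_kernel_step1 (w : R) k k1 k2 : smoothing_kernel k k1 k2 ->
  smoothing_kernel (fun p q => (1 + cos (w * (p.1 - q.1))) * k p q)
    (fun p q => - (w * sin (w * (p.1 - q.1))) * k p q +
                (1 + cos (w * (p.1 - q.1))) * k1 p q)
    (fun p q => (1 + cos (w * (p.1 - q.1))) * k2 p q).
Proof.
move=> kP.
have cb : continuous (fun q : R * R => cos (w * q.1)).
  exact: (continuous_fst (smooth1_continuous (smooth1_cos w))).
have sb : continuous (fun q : R * R => sin (w * q.1)).
  exact: (continuous_fst (smooth1_continuous (smooth1_sin w))).
have s1 : smooth1 (fun x => - w * sin (w * x)).
  by apply: smooth1M; [exact: smooth1_cst|exact: smooth1_sin].
have s2 : smooth1 (fun x => w * cos (w * x)).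
  by apply: smooth1M; [exact: smooth1_cst|exact: smooth1_cos].
have kc := smoothing_kernel_fst (smooth1_cos w) s1 (is_derive_cos_scale w) cb kP.
have ks := smoothing_kernel_fst (smooth1_sin w) s2 (is_derive_sin_scale w) sb kP.
apply: eq_smoothing_kernel (smoothing_kernelD kP (smoothing_kernelD kc ks)) => p q /=;
  by rewrite mulrBr cosB ?sinB; ring.
Qed.

Lemma smoothing_kernel_step2 (w : R) k k1 k2 : smoothing_kernel k k1 k2 ->
  smoothing_kernel (fun p q => (1 + cos (w * (p.2 - q.2))) * k p q)
    (fun p q => (1 + cos (w * (p.2 - q.2))) * k1 p q)
    (fun p q => - (w * sin (w * (p.2 - q.2))) * k p q +
                (1 + cos (w * (p.2 - q.2))) * k2 p q).
Proof.
move=> kP.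
have cb : continuous (fun q : R * R => cos (w * q.2)).
  exact: (continuous_snd (smooth1_continuous (smooth1_cos w))).
have sb : continuous (fun q : R * R => sin (w * q.2)).
  exact: (continuous_snd (smooth1_continuous (smooth1_sin w))).
have s1 : smooth1 (fun x => - w * sin (w * x)).
  by apply: smooth1M; [exact: smooth1_cst|exact: smooth1_sin].
have s2 : smooth1 (fun x => w * cos (w * x)).
  by apply: smooth1M; [exact: smooth1_cst|exact: smooth1_cos].
have kc := smoothing_kernel_snd (smooth1_cos w) s1 (is_derive_cos_scale w) cb kP.
have ks := smoothing_kernel_snd (smooth1_sin w) s2 (is_derive_sin_scale w) sb kP.
apply: eq_smoothing_kernel (smoothing_kernelD kP (smoothing_kernelD kc ks)) => p q /=;
  by rewrite mulrBr cosB ?sinB; ring.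
Qed.

Lemma smoothing_torus_kernel n : smoothing_kernel (torus_kernel n)
  (fun p q => dcosker 1 n (p.1 - q.1) * cosker pi n (p.2 - q.2))
  (fun p q => cosker 1 n (p.1 - q.1) * dcosker pi n (p.2 - q.2)).
Proof.
elim: n => [|n IH].
  by apply: eq_smoothing_kernel smoothing_kernel1 => p q;
    rewrite /torus_kernel /cosker /= ?expr0 ?mulr1 ?mulr0.
apply: eq_smoothing_kernel (smoothing_kernel_step1 1 (smoothing_kernel_step2 pi IH)) => p q;
  by rewrite /torus_kernel /= /cosker !exprS; ring.
Qed.

Lemma smooth1_cosker (w x : R) n : smooth1 (fun y => cosker w n (x - y)).
Proof.
elim: n => [|n IH].
  by have -> : (fun y => cosker w 0 (x - y)) = (fun=> 1) by []; exact: smooth1_cst.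
have -> : (fun y => cosker w n.+1 (x - y)) = (fun y => (1 + (cos (w * x) * cos (w * y) +
    sin (w * x) * sin (w * y))) * cosker w n (x - y)).
  by apply/funext => y; rewrite /cosker exprS mulrBr cosB.
apply: smooth1M => //; apply: smooth1D; first exact: smooth1_cst.
apply: smooth1D; apply: smooth1M; try exact: smooth1_cst.
- exact: smooth1_cos.
- exact: smooth1_sin.
Qed.

Lemma smooth_per_torus_kernel n p : smooth_per (torus_kernel n p).
Proof.
split=> [k|t x|x t].
- apply: smooth2_Ck; apply: smooth2M.
    by apply: (@smooth2_fst _ (fun y => cosker 1 n (p.1 - y))); exact: smooth1_cosker.
  by apply: (@smooth2_snd _ (fun y => cosker pi n (p.2 - y))); exact: smooth1_cosker.
- rewrite /torus_kernel /= -(@cosker_period _ 1 pi _ n (p.1 - (x + _))) ?mul1r//.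
  by congr (cosker _ _ _ * _); ring.
- rewrite /torus_kernel /= -(@cosker_period _ pi 1 _ n (p.2 - (t + _))) ?mulr1//.
  by congr (_ * cosker _ _ _); ring.
Qed.

Lemma is_derive_sub_cosker (w x y : R) n :
  is_derive y 1 (fun y => cosker w n (x - y)) (- dcosker w n (x - y)).
Proof.
have d : is_derive y 1 (fun y : R => x - y) (-1).
  by apply: is_derive_eq (is_deriveB (is_derive_cst x y 1) (is_derive_id y 1)) _; rewrite sub0r.
by rewrite -mulrN1; apply: is_derive1_comp => //; exact: is_derive_cosker.
Qed.

(** The kernel depends on p - q only, so differentiating it as a test function in [q] gives the
    opposite of its derivative in [p]. *)
Lemma derive_torus_kernel1 n p q : 'D_e_theta (torus_kernel n p) q =
  - (dcosker 1 n (p.1 - q.1) * cosker pi n (p.2 - q.2)).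
Proof.
have : is_derive q e_theta (torus_kernel n p)
    (- (dcosker 1 n (p.1 - q.1) * cosker pi n (p.2 - q.2))); last by move=> H; rewrite derive_val.
apply/is_derive_e_theta; rewrite /torus_kernel /=.
have H := is_deriveM (is_derive_sub_cosker 1 p.1 q.1 n) (is_derive_cst (cosker pi n (p.2 - q.2)) q.1 1).
by apply: is_derive_eq H _; rewrite -![_ *: _]/(_ * _) /=; ring.
Qed.

Lemma derive_torus_kernel2 n p q : 'D_e_t (torus_kernel n p) q =
  - (cosker 1 n (p.1 - q.1) * dcosker pi n (p.2 - q.2)).
Proof.
have : is_derive q e_t (torus_kernel n p)
    (- (cosker 1 n (p.1 - q.1) * dcosker pi n (p.2 - q.2))); last by move=> H; rewrite derive_val.
apply/is_derive_e_t; rewrite /torus_kernel /=.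
have H := is_deriveM (is_derive_cst (cosker 1 n (p.1 - q.1)) q.2 1) (is_derive_sub_cosker pi p.2 q.2 n).
by apply: is_derive_eq H _; rewrite -![_ *: _]/(_ * _) /=; ring.
Qed.

End separable_kernels.

Section weak_derivative_uniqueness.
Context {R : realType}.
Local Notation mR := (measurableTypeR R).
Local Notation mu := (@lebesgue_measure R).
Implicit Types (u w : R * R -> R) (p q : R * R).

Let mT2 : measurable (T2 : set (mR * mR)) := measurable_T2.

Definition kernel_mass n : R := cosmass 1 pi n * cosmass pi 1 n.

Lemma kernel_mass_gt0 n : 0 < kernel_mass n.
Proof.
by rewrite mulr_gt0// cosmass_gt0// ?pi_gt0 ?mul1r ?mulr1.
Qed.

(** Periodic convolution with a kernel of mass 1. Only the values of [u] on the fundamental domain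
    enter, and the periodicity of the result comes from the kernel. *)
Definition mollify n u p : R :=
  (kernel_mass n)^-1 * \int[leb2]_(q in T2) (u q * torus_kernel n p q).

Lemma smooth2_mollify n u : leb2.-integrable (T2 : set (mR * mR)) (EFin \o u) ->
  smooth2 (mollify n u).
Proof.
move=> ui; have [_ _ _ /(_ _ ui)[s _ _]] := @smoothing_torus_kernel R n.
by apply: smooth2M => //; apply: (@smooth2_fst _ (fun=> _)); exact: smooth1_cst.
Qed.

Lemma smooth_per_mollify n u : leb2.-integrable (T2 : set (mR * mR)) (EFin \o u) ->
  smooth_per (mollify n u).
Proof.
move=> ui; split=> [k|t x|x t]; first exact/smooth2_Ck/smooth2_mollify.
- rewrite /mollify; congr (_ * _); apply: eq_Rintegral => q _; congr (_ * _).
  rewrite /torus_kernel/= -(@cosker_period _ 1 pi _ n (x - _)) ?mul1r//.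
  by congr (cosker _ _ _ * _); ring.
- rewrite /mollify; congr (_ * _); apply: eq_Rintegral => q _; congr (_ * _).
  rewrite /torus_kernel/= -(@cosker_period _ pi 1 _ n (t - _)) ?mulr1//.
  by congr (_ * cosker _ _ _); ring.
Qed.

Lemma continuous_torus_kernel n p : continuous (torus_kernel n p).
Proof. by have [] := @smoothing_torus_kernel R n. Qed.

Lemma torus_kernel_ge0 n p q : 0 <= torus_kernel n p q.
Proof. by rewrite mulr_ge0// cosker_ge0. Qed.

Lemma continuous_cosker_sub (w x : R) n : continuous (fun y => cosker w n (x - y)).
Proof. exact/smooth1_continuous/smooth1_cosker. Qed.

Lemma Rintegral_torus_kernel n p : T2 p ->
  \int[leb2]_(q in T2) torus_kernel n p q = kernel_mass n.
Proof.
move=> [/= p1 p2]; rewrite /torus_kernel.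
rewrite (@Rintegral_tensor _ (fun y => cosker 1 n (p.1 - y)) (fun y => cosker pi n (p.2 - y)));
  [|exact: continuous_cosker_sub..].
rewrite !cosker_itv ?pi_gt0 ?mulr1 ?mul1r//.
Qed.

Lemma mollify_bound n u (M : R) p : leb2.-integrable (T2 : set (mR * mR)) (EFin \o u) ->
  (forall q, T2 q -> `|u q| <= M) -> T2 p -> `|mollify n u p| <= M.
Proof.
move=> ui uM pT2; rewrite /mollify normrM gtr0_norm ?invr_gt0 ?kernel_mass_gt0//.
rewrite mulrC ler_pdivrMr ?kernel_mass_gt0//.
have iuk := integrable_T2_mul (continuous_torus_kernel (n := n) (p := p)) ui.
apply: le_trans (le_normr_Rintegral mT2 iuk) _.
have ki : leb2.-integrable (T2 : set (mR * mR)) (EFin \o torus_kernel n p).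
  exact/continuous_box_integrable/continuous_torus_kernel.
rewrite -(Rintegral_torus_kernel n pT2) -RintegralZl//; apply: le_Rintegral => //.
- exact: integrable_norm.
- exact: RintegrableZ.
- by move=> q qT; rewrite normrM (ger0_norm (torus_kernel_ge0 _ _ _)) ler_wpM2r ?torus_kernel_ge0 ?uM.
Qed.

Lemma Omega_T2 p : Omega p -> T2 p.
Proof.
by move=> [/=]; rewrite !in_itv/= => /andP[/ltW a /ltW b] /andP[/ltW c /ltW d];
  rewrite /T2/= !in_itv/= a b c d.
Qed.

(** The point is taken in [Omega] because on a side of [T2] the kernel also concentrates at the
    identified point of the opposite side, where [u] may have another value. *)
Lemma mollify_cvg u (M : R) p : measurable_fun (T2 : set (mR * mR)) u ->
  (forall q, T2 q -> `|u q| <= M) -> Omega p -> {for p, continuous u} ->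
  (fun n => mollify n u p) @ \oo --> u p.
Proof.
move=> mu_ uM pO cu; have pT := Omega_T2 pO.
case: (pO) => /=; rewrite !in_itv/= => p1 p2.
have -> : (fun n => mollify n u p) = (fun n => \int[leb2]_(q in T2)
   (u q * (((cosmass 1 pi n)^-1 * cosker 1 n (p.1 - q.1)) *
           ((cosmass pi 1 n)^-1 * cosker pi n (p.2 - q.2))))).
  apply/funext => n; rewrite /mollify -RintegralZl//; last first.
    apply: integrable_T2_mul; first exact: continuous_torus_kernel.
    exact: (Rintegrable_bounded mT2 leb2_T2 mu_ uM).
  by apply: eq_Rintegral => q _; rewrite /kernel_mass /torus_kernel invfM; ring.
rewrite -[X in _ --> X]mulr1 -[X in _ * X]mulr1.
have cK (w x c : R) n : continuous (fun y => c * cosker w n (x - y)).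
  by move=> y; apply: cvgM; [exact: cvg_cst|exact: continuous_cosker_sub].
have K0 (w h x : R) n y : 0 < w -> 0 < h -> w * h = pi ->
    0 <= (cosmass w h n)^-1 * cosker w n (x - y).
  by move=> w0 h0 wh; rewrite mulr_ge0 ?cosker_ge0// invr_ge0 ltW// cosmass_gt0.
have I1 (w h x : R) n : 0 < w -> 0 < h -> w * h = pi -> - h < x < h ->
    \int[mu]_(y in `[- h, h]) ((cosmass w h n)^-1 * cosker w n (x - y)) = 1.
  move=> w0 h0 wh /andP[x1 x2]; rewrite RintegralZl//; last first.
    exact/continuous_itv_integrable/continuous_cosker_sub.
  by rewrite cosker_itv// ?mulVf ?gt_eqF ?cosmass_gt0// (ltW x1) ltW.
have pi0 := @pi_gt0 R.
apply: (@approximate_identity _ (fun n y => (cosmass 1 pi n)^-1 * cosker 1 n (p.1 - y))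
  (fun n y => (cosmass pi 1 n)^-1 * cosker pi n (p.2 - y)) u (- pi) pi (-1) 1 M) => //.
- by move=> n x; rewrite K0 ?mul1r.
- by move=> n x; rewrite K0 ?mulr1.
- by under eq_cvg do rewrite I1 ?mul1r//; exact: cvg_cst.
- by under eq_cvg do rewrite I1 ?mulr1//; exact: cvg_cst.
- move=> dl eta dl0 eta0.
  have := @cosker_tail _ 1 pi ltr01 pi0 (mul1r _) p.1 dl eta p1 dl0 eta0.
  by apply: filterS => n H x xI xd; rewrite mulrC; exact: H.
- move=> dl eta dl0 eta0.
  have := @cosker_tail _ pi 1 pi0 ltr01 (mulr1 _) p.2 dl eta p2 dl0 eta0.
  by apply: filterS => n H x xI xd; rewrite mulrC; exact: H.
- exact: uM.
Qed.

Lemma L2per_integrable u : L2per u -> leb2.-integrable (T2 : set (mR * mR)) (EFin \o u).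
Proof.
move=> [mu_ u2].
apply: (@Rintegrable_le _ _ _ _ _ mT2 _ (fun p => 1 + u p ^+ 2)) => //.
  apply: RintegrableD => //; apply: (Rintegrable_bounded mT2 leb2_T2 _ (M := 1)) => //.
  by move=> x _; rewrite normr1.
move=> p _; rewrite ler_norml; have h1 := sqr_ge0 (u p - 1); have h2 := sqr_ge0 (u p + 1).
have h3 := sqr_ge0 (u p).
move: h1 h2 h3; rewrite sqrrB sqrrD !mulr1 expr1n => h1 h2 h3.
by apply/andP; split; lra.
Qed.

(** Weak derivatives become classical ones after mollification. Moving the derivative of the kernel
    from [p] to [q] costs a sign, and the definition of the weak derivative, tested with the kernel
    itself, gives it back. *)
Lemma is_derive_mollify e u w n p : e = e_theta \/ e = e_t ->
  leb2.-integrable (T2 : set (mR * mR)) (EFin \o u) ->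
  is_weak_deriv e u w -> is_derive p e (mollify n u) (mollify n w p).
Proof.
move=> eE ui [wL2 wP].
have [_ ck1 ck2 /(_ _ ui)[_ d1 d2]] := @smoothing_torus_kernel R n.
have H : is_derive p e (fun p => \int[leb2]_(q in T2) (u q * torus_kernel n p q))
    (\int[leb2]_(q in T2) (w q * torus_kernel n p q)).
  have := wP _ (smooth_per_torus_kernel n p).
  case: eE => -> E.
    apply: is_derive_eq (d1 p) _; rewrite -[RHS]opprK -E -mulN1r -RintegralZl//.
      by apply: eq_Rintegral => q _; rewrite derive_torus_kernel1; ring.
    apply: eq_integrable (RintegrableZ mT2 (-1) (integrable_T2_mul (ck1 p) ui)) => //.
    by move=> q _ /=; rewrite derive_torus_kernel1; congr EFin; ring.
  apply: is_derive_eq (d2 p) _; rewrite -[RHS]opprK -E -mulN1r -RintegralZl//.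
    by apply: eq_Rintegral => q _; rewrite derive_torus_kernel2; ring.
  apply: eq_integrable (RintegrableZ mT2 (-1) (integrable_T2_mul (ck2 p) ui)) => //.
  by move=> q _ /=; rewrite derive_torus_kernel2; congr EFin; ring.
by have := is_deriveZ (kernel_mass n)^-1 H.
Qed.

End weak_derivative_uniqueness.

(** * Weak derivatives and weak solutions *)

Section plane_null_sets.
Context {R : realType}.
Local Notation mR := (measurableTypeR R).
Local Notation mu := (@lebesgue_measure R).

Lemma ae_fst (P : R -> Prop) : {ae mu, forall x, P x} ->
  {ae leb2, forall p : mR * mR, P p.1}.
Proof.
move=> [N [mN N0 PN]]; exists (N `*` setT); split.
- exact: measurableX.
- by rewrite product_measure1E// [X in (X * _)%E]N0 mul0e.
- by move=> p /= nP; split => //; apply: PN => Pp; exact: nP.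
Qed.

Lemma ae_snd (P : R -> Prop) : {ae mu, forall x, P x} ->
  {ae leb2, forall p : mR * mR, P p.2}.
Proof.
move=> [N [mN N0 PN]]; exists (setT `*` N); split.
- exact: measurableX.
- by rewrite product_measure1E// [X in (_ * X)%E]N0 mule0.
- by move=> p /= nP; split => //; apply: PN => Pp; exact: nP.
Qed.

Lemma ae_neq (a : R) : {ae mu, forall x, x != a}.
Proof.
exists [set a]; split; [exact: measurable_set1|exact: lebesgue_measure_set1|].
by move=> x /= /negP; rewrite negbK => /eqP.
Qed.

Lemma ae_Omega : {ae leb2, forall p : mR * mR, T2 p -> Omega p}.
Proof.
have h1 := ae_fst (ae_neq (- pi)); have h2 := ae_fst (ae_neq pi).
have h3 := ae_snd (ae_neq (-1)); have h4 := ae_snd (ae_neq 1).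
apply: filterS (filterI (filterI h1 h2) (filterI h3 h4)) => -[x y] /= [[n1 n2] [n3 n4]].
rewrite /T2 /Omega /= !in_itv/= => -[/andP[x1 x2] /andP[y1 y2]].
by rewrite !lt_neqAle x1 x2 y1 y2 eq_sym n1 n2 eq_sym n3 n4.
Qed.

(** Provides Dynkin's theorem with a generator stable under intersection. The line is not a
    half-open bounded interval, so strips are recovered as countable unions of rectangles with one
    side ]- n, n]. *)
Lemma measurable_plane_ocitv : (measurable : set_system (mR * mR)) =
  <<s [set A `*` B | A in @ocitv R & B in @ocitv R] >>.
Proof.
set G := [set A `*` B | A in @ocitv R & B in @ocitv R].
have strip (f : nat -> set (R * R)) : (forall n, G (f n)) -> <<s G >> (\bigcup_n f n).
  by move=> Gf; apply: sigma_algebra_bigcup => n; apply: sub_sigma_algebra.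
have cover (x : R) : exists n : nat, x \in `]- n%:R, n%:R].
  exists (Num.truncn `|x|).+1; rewrite in_itv/=.
  have := truncnS_gt `|x|; rewrite ltr_norml => /andP[-> /ltW ->] //.
have mfst : measurable_fun (setT : set (g_sigma_algebraType G)) (fst : g_sigma_algebraType G -> mR).
  apply: (measurability (@ocitv R)) => // _ [A Ai <-].
  have -> : setT `&` fst @^-1` A = \bigcup_n (A `*` `]- n%:R, n%:R]) :> set (R * R).
    apply/seteqP; split=> [[x y] [_ /= Ax]|[x y] [n _] [/=]//].
    by have [n yn] := cover y; exists n.
  by apply: strip => n; exists A => //; exists `]- n%:R, n%:R]%classic => //; exact: is_ocitv.
have msnd : measurable_fun (setT : set (g_sigma_algebraType G)) (snd : g_sigma_algebraType G -> mR).
  apply: (measurability (@ocitv R)) => // _ [A Ai <-].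
  have -> : setT `&` snd @^-1` A = \bigcup_n (`]- n%:R, n%:R] `*` A) :> set (R * R).
    apply/seteqP; split=> [[x y] [_ /= Ax]|[x y] [n _] [/=]//].
    by have [n yn] := cover x; exists n.
  by apply: strip => n; exists `]- n%:R, n%:R]%classic; [exact: is_ocitv|exists A].
rewrite measurable_prod_measurableType; apply/seteqP; split.
  apply: smallest_sub; first exact: smallest_sigma_algebra.
  move=> _ [A mA [B mB <-]].
  have -> : A `*` B = (setT `&` fst @^-1` A) `&` (setT `&` snd @^-1` B) :> set (R * R).
    by rewrite !setTI.
  apply: (@measurableI _ (g_sigma_algebraType G)); [exact: mfst|exact: msnd].
apply: smallest_sub; first exact: smallest_sigma_algebra.
move=> _ [A Ai [B Bi <-]]; apply: sub_sigma_algebra; exists A.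
  exact: sub_sigma_algebra.
by exists B => //; exact: sub_sigma_algebra.
Qed.

Lemma continuous_indic_ocitv (a b x : R) : x != a -> x != b ->
  {for x, continuous (\1_(`]a, b]%classic) : R -> R)}.
Proof.
move=> xa xb; apply: cvg_near_cst.
have [h|h|h] := ltgtP x a; last by rewrite h eqxx in xa.
  near=> y; have ya : y < a by near: y; exact: (cvgr_lt x).
  by rewrite !indicE !memNset//= in_itv/= ltNge ?(ltW ya) ?(ltW h).
have [h'|h'|h'] := ltgtP x b; last by rewrite h' eqxx in xb.
  near=> y; have ya : a < y by near: y; exact: (cvgr_gt x).
  have yb : y < b by near: y; exact: (cvgr_lt x).
  by rewrite !indicE !mem_set//= in_itv/= ?h ?ya ltW.
near=> y; have yb : b < y by near: y; exact: (cvgr_gt x).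
by rewrite !indicE !memNset//= in_itv/= => /andP[_]; rewrite leNgt ?yb ?h'.
Unshelve. all: by end_near. Qed.

End plane_null_sets.

(** * The fundamental lemma of the calculus of variations on the torus *)

Section fundamental_lemma.
Context {R : realType}.
Local Notation mR := (measurableTypeR R).
Local Notation mu := (@lebesgue_measure R).
Implicit Types (u w : R * R -> R).
Let mT2 : measurable (T2 : set (mR * mR)) := measurable_T2.

(** Continuity is asked almost everywhere only, so that both continuous functions and indicators of
    rectangles qualify. *)
Lemma mollify_dominated w u (M : R) :
  leb2.-integrable (T2 : set (mR * mR)) (EFin \o w) ->
  measurable_fun (T2 : set (mR * mR)) u -> (forall q, T2 q -> `|u q| <= M) ->
  {ae leb2, forall p : mR * mR, Omega p -> {for p, continuous u}} ->
  (fun n => \int[leb2]_(p in T2) (w p * mollify n u p)) @ \oo -->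
  \int[leb2]_(p in T2) (w p * u p).
Proof.
move=> wi mu_ uM cu.
have ui := Rintegrable_bounded mT2 leb2_T2 mu_ uM.
have mw := Rintegrable_measurable wi.
apply: (Rintegral_dominated mT2 (g := fun p => M * `|w p|)).
- move=> n; apply: measurable_funM => //.
  apply: measurable_funTS; apply: continuous_measurable_fun2.
  exact/smooth2_continuous/smooth2_mollify.
- exact: measurable_funM.
- apply: filterS (filterI cu ae_Omega) => p [cp Tp] pT.
  apply: cvgM; first exact: cvg_cst.
  exact: (mollify_cvg mu_ uM (Tp pT) (cp (Tp pT))).
- by apply: RintegrableZ => //; exact: integrable_norm.
- move=> n p pT; rewrite normrM mulrC ler_wpM2r//; exact: mollify_bound.
Qed.

(** Mollified indicators of rectangles are admissible test functions and converge, so the integral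
    of [w] vanishes on every rectangle. Dynkin's theorem extends this to all measurable sets, which
    forces [w] to vanish almost everywhere. *)
Lemma smooth_per_orthogonal_ae0 w : leb2.-integrable (T2 : set (mR * mR)) (EFin \o w) ->
  (forall phi, smooth_per phi -> \int[leb2]_(p in T2) (w p * phi p) = 0) ->
  {ae leb2, forall p : mR * mR, T2 p -> w p = 0}.
Proof.
move=> wi w0.
have wTi := (Rintegrable_patch _ _ mT2).1 wi.
have rect (A B : set R) : ocitv A -> ocitv B ->
    \int[leb2]_(p in A `*` B) ((w \_ T2) p) = 0.
  move=> [[a b] _ /= <-] [[c d] _ /= <-].
  pose u (p : R * R) : R := \1_(`]a, b]%classic) p.1 * \1_(`]c, d]%classic) p.2.
  have mi (x y : R) : measurable_fun (setT : set mR) (\1_(`]x, y]%classic) : mR -> mR).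
    exact: measurable_indic.
  have mu_ : measurable_fun (T2 : set (mR * mR)) u.
    apply: measurable_funTS; apply: measurable_funM.
      by apply: measurableT_comp => //; exact: mi.
    by apply: measurableT_comp => //; exact: mi.
  have u1 q : T2 q -> `|u q| <= 1.
    by move=> _; rewrite /u !indicE; case: (_ \in _); case: (_ \in _);
      rewrite ?mulr0 ?mul0r ?mulr1 ?normr0 ?normr1.
  have cu : {ae leb2, forall p : mR * mR, Omega p -> {for p, continuous u}}.
    have h1 := ae_fst (ae_neq a); have h2 := ae_fst (ae_neq b).
    have h3 := ae_snd (ae_neq c); have h4 := ae_snd (ae_neq d).
    apply: filterS (filterI (filterI h1 h2) (filterI h3 h4)) => p /= [[n1 n2] [n3 n4]] _.
    apply: cvgM.
      by apply: (continuous_comp (f := fst)); [exact: cvg_fst|exact: continuous_indic_ocitv].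
    by apply: (continuous_comp (f := snd)); [exact: cvg_snd|exact: continuous_indic_ocitv].
  have := mollify_dominated wi mu_ u1 cu.
  have -> : (fun n => \int[leb2]_(p in T2) (w p * mollify n u p)) = cst 0.
    apply/funext => n; apply/w0/smooth_per_mollify.
    exact: (Rintegrable_bounded mT2 leb2_T2 mu_ u1).
  move=> /cvg_lim -/(_ (@Rhausdorff R)); rewrite lim_cst; last exact: Rhausdorff.
  move=> ->; rewrite [LHS]Rintegral_mkcond [RHS]Rintegral_mkcond.
  apply: eq_Rintegral => -[x y] _; rewrite /patch /u !in_setX/= !indicE.
  by case: (x \in `]a, b]%classic); case: (y \in `]c, d]%classic); case: ifP => _ /=;
    rewrite ?mulr1 ?mulr0 ?mulr0.
have sub E : measurable (E : set (mR * mR)) ->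
    leb2.-integrable (E : set (mR * mR)) (EFin \o (w \_ T2)).
  by move=> mE; exact: integrableS wTi.
have EF E : measurable (E : set (mR * mR)) ->
    (\int[leb2]_(p in E) ((w \_ T2) p)%:E = (\int[leb2]_(p in E) ((w \_ T2) p)%R)%:E)%E.
  by move=> mE; rewrite /Rintegral fineK//; exact: integrable_fin_num (sub _ mE).
have ocitv_meas A : ocitv A -> measurable (A : set mR).
  by move=> [[a b] _ <-]; exact: measurable_itv.
(* The constant 1 is itself a test function. It settles the whole plane, on which the passage to
   complements relies. *)
have tot : \int[leb2]_(p in setT) ((w \_ T2) p) = 0.
  rewrite -Rintegral_mkcond -[RHS](w0 (fun=> 1)).
    by apply: eq_Rintegral => p _; rewrite mulr1.
  split=> [k|t|t]; [|by []..].
  by apply: smooth2_Ck; apply: (@smooth2_fst _ (fun=> 1)); exact: smooth1_cst.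
have all0 (E : set (mR * mR)) : measurable E -> (\int[leb2]_(p in E) ((w \_ T2) p)%:E = 0)%E.
  move=> mE; rewrite measurable_plane_ocitv in mE; move: E mE.
  apply: dynkin_induction => //=.
  - exact: measurable_plane_ocitv.
  - move=> _ _ [A Ai [B Bi <-]] [C Ci [D Di <-]]; rewrite -setXI.
    by exists (A `&` C); [exact: ocitvI|exists (B `&` D) => //; exact: ocitvI].
  - by rewrite EF// tot.
  - move=> _ [A Ai [B Bi <-]]; rewrite EF ?rect//.
    by apply: measurableX; exact: ocitv_meas.
  - move=> S mS; rewrite !EF//; last exact: measurableC.
    move=> [S0]; congr EFin; rewrite -[RHS]tot -(setUv S) Rintegral_setU//.
    + by rewrite S0 add0r.
    + exact: measurableC.
    + by rewrite setUv.
    + by apply/disj_setPS; rewrite setICr.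
  - move=> F mF tF F0; rewrite integral_bigcup//.
      by rewrite eseries0// => n _ _; exact: F0.
    by apply: sub; exact: bigcup_measurable.
have := @integral_ae_eq _ _ _ leb2 T2 mT2 (cst 0%E) (EFin \o w) wi _ _.
move=> H; apply: filterS (H _ _) => [p /= h pT|//|E ET mE].
  by have [] := h pT.
rewrite integral0 -[RHS](all0 E mE); apply: eq_integral => p /[!inE] pE.
by rewrite /patch mem_set//; exact: ET.
Qed.

Lemma weak_deriv_unique e u w1 w2 : is_weak_deriv e u w1 -> is_weak_deriv e u w2 ->
  {ae leb2, forall p : mR * mR, T2 p -> w1 p = w2 p}.
Proof.
move=> [L1 H1] [L2 H2].
have i1 := L2per_integrable L1; have i2 := L2per_integrable L2.
have : {ae leb2, forall p : mR * mR, T2 p -> w1 p - w2 p = 0}.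
  apply: smooth_per_orthogonal_ae0; first exact: RintegrableB.
  move=> phi sphi.
  have cphi : continuous phi.
    by case: sphi => /(_ 0%N) /(_ [::] isT) [c _] _ _ p; exact: c.
  under eq_Rintegral do rewrite mulrBl.
  rewrite RintegralB//; [|exact: integrable_T2_mul..].
  by apply/eqP; rewrite subr_eq0 -eqr_opp -H1// -H2.
by apply: filterS => p /[apply] /eqP; rewrite subr_eq0 => /eqP.
Qed.

End fundamental_lemma.

(** * Sobolev functions with explicit weak derivatives *)

Section sobolev_calculus.
Context {R : realType}.
Local Notation mR := (measurableTypeR R).
Local Notation mu := (@lebesgue_measure R).
Implicit Types (u v w a b phi : R * R -> R) (e p : R * R).
Let mT2 : measurable (T2 : set (mR * mR)) := measurable_T2.

Lemma smooth_per_derive phi e : e = e_theta \/ e = e_t -> smooth_per phi ->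
  [/\ continuous phi, continuous (fun p => 'D_e phi p) &
      forall p : R * R, is_derive p e phi ('D_e phi p)].
Proof.
move=> eE [sphi _ _]; have [c0 d0] := sphi 1%N [::] isT.
split.
- by move=> p; exact: c0.
- by case: eE => ->; [have [c1 _] := sphi 1%N [:: false] isT|
    have [c1 _] := sphi 1%N [:: true] isT] => p; exact: c1.
- move=> p; have [d1 d2] := d0 isT p I.
  by case: eE => ->; [exact: (DeriveDef d1 erefl)|exact: (DeriveDef d2 erefl)].
Qed.

Lemma continuous_L2per u : continuous u -> L2per u.
Proof.
move=> cu; split.
  by apply: measurable_funTS; exact: continuous_measurable_fun2.
by apply: continuous_box_integrable => p; apply: cvgM; exact: cu.
Qed.

Lemma smooth_per_box phi : smooth_per phi ->
  (forall t, phi (- pi, t) = phi (pi, t)) /\ (forall x, phi (x, -1) = phi (x, 1)).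
Proof.
move=> [_ p1 p2]; split=> [t|x].
  by rewrite -(p1 t (- pi)); congr (phi (_, _)); ring.
by rewrite -(p2 x (-1)); congr (phi (_, _)); ring.
Qed.

(** By the product rule the two integrands add up to the derivative of [u * phi], which takes equal
    values on opposite sides of the box. *)
Lemma classical_weak_deriv e u w : e = e_theta \/ e = e_t ->
  continuous u -> continuous w -> (forall p : R * R, is_derive p e u (w p)) ->
  (forall t, t \in `[-1, 1] -> u (- pi, t) = u (pi, t)) ->
  (forall x, x \in `[- pi, pi] -> u (x, -1) = u (x, 1)) ->
  is_weak_deriv e u w.
Proof.
move=> eE cu cw du u1 u2; split; first exact: continuous_L2per.
move=> phi sphi; have [cphi cdphi dphi] := smooth_per_derive eE sphi.
have [phi1 phi2] := smooth_per_box sphi.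
have cM (g h : R * R -> R) : continuous g -> continuous h -> continuous (fun p => g p * h p).
  by move=> cg ch p; apply: cvgM; [exact: cg|exact: ch].
have I1 := continuous_box_integrable (- pi) pi (-1) 1 (cM _ _ cu cdphi).
have I2 := continuous_box_integrable (- pi) pi (-1) 1 (cM _ _ cw cphi).
apply/eqP; rewrite -addr_eq0; apply/eqP; rewrite -RintegralD//.
have c : continuous (fun p => u p * 'D_e phi p + w p * phi p).
  by move=> p; apply: cvgD; [exact: (cM _ _ cu cdphi)|exact: (cM _ _ cw cphi)].
have d (p : R * R) : is_derive p e (fun p => u p * phi p) (u p * 'D_e phi p + w p * phi p).
  apply: is_derive_eq (is_deriveM (du p) (dphi p)) _.
  by rewrite -![_ *: _]/(_ * _) [w p * _]mulrC.
case: eE => eE; rewrite eE in c d *.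
- apply: Rintegral_box_d_theta c d _; first by rewrite gtrN// pi_gt0.
  by move=> t tI; rewrite u1// phi1.
- apply: Rintegral_box_d_t c d _; first by rewrite gtrN.
  by move=> x xI; rewrite u2// phi2.
Qed.

Lemma smooth_per_weak_deriv e phi : e = e_theta \/ e = e_t -> smooth_per phi ->
  is_weak_deriv e phi (fun p => 'D_e phi p).
Proof.
move=> eE sphi; have [c cd d] := smooth_per_derive eE sphi.
by have [p1 p2] := smooth_per_box sphi; apply: classical_weak_deriv.
Qed.

Lemma sqrD_le2 (x y : R) : (x + y) ^+ 2 <= 2 * x ^+ 2 + 2 * y ^+ 2.
Proof. have := sqr_ge0 (x - y); rewrite sqrrB sqrrD; lra. Qed.

Lemma sqrB_le2 (x y : R) : (x - y) ^+ 2 <= 2 * x ^+ 2 + 2 * y ^+ 2.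
Proof. have := sqr_ge0 (x + y); rewrite sqrrB sqrrD; lra. Qed.

Lemma L2perM u v : L2per u -> L2per v ->
  leb2.-integrable (T2 : set (mR * mR)) (EFin \o (fun p => u p * v p)).
Proof.
move=> [m1 i1] [m2 i2]; apply: (Rintegrable_le mT2 (g := fun p => u p ^+ 2 + v p ^+ 2)).
- exact: measurable_funM.
- exact: RintegrableD.
- move=> p _; rewrite ler_norml.
  have := sqr_ge0 (u p - v p); have := sqr_ge0 (u p + v p).
  rewrite sqrrB sqrrD => h1 h2; have := sqr_ge0 (u p); have := sqr_ge0 (v p) => h3 h4.
  by apply/andP; split; lra.
Qed.

Lemma L2perB u v : L2per u -> L2per v -> L2per (fun p => u p - v p).
Proof.
move=> [m1 i1] [m2 i2]; have m : measurable_fun (T2 : set (mR * mR)) (fun p => u p - v p).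
  exact: measurable_funB.
split=> //; apply: (Rintegrable_le mT2 (g := fun p => 2 * u p ^+ 2 + 2 * v p ^+ 2)).
- exact: measurable_funX.
- by apply: RintegrableD => //; exact: RintegrableZ.
- by move=> p _; rewrite ger0_norm ?sqr_ge0// sqrB_le2.
Qed.

Lemma L2norm_sq_ge0 u : 0 <= L2norm_sq u.
Proof. by apply: Rintegral_ge0 => p _; exact: sqr_ge0. Qed.

Lemma L2norm_sqB u v : L2per u -> L2per v ->
  L2norm_sq (fun p => u p - v p) <= 2 * L2norm_sq u + 2 * L2norm_sq v.
Proof.
move=> Lu Lv; rewrite /L2norm_sq -!RintegralZl//; [|by case: Lv|by case: Lu].
rewrite -RintegralD//; [|by apply: RintegrableZ => //; case: Lu|by apply: RintegrableZ => //; case: Lv].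
apply: le_Rintegral => //; first by case: (L2perB Lu Lv).
  by apply: RintegrableD => //; apply: RintegrableZ => //; [case: Lu|case: Lv].
by move=> p _; exact: sqrB_le2.
Qed.

Lemma L2norm_sq_ae u v : measurable_fun (T2 : set (mR * mR)) u ->
  measurable_fun (T2 : set (mR * mR)) v ->
  {ae leb2, forall p : mR * mR, T2 p -> u p = v p} -> L2norm_sq u = L2norm_sq v.
Proof.
move=> m1 m2 uv; apply: Rintegral_ae_eq => //; [exact: measurable_funX|exact: measurable_funX|].
by apply: filterS uv => p uv pT; rewrite uv.
Qed.

(** Names the weak derivatives, so that computed ones can be used in place of the unspecified
    representatives chosen by [weak_deriv]. *)
Definition H1pair u a b : Prop :=
  [/\ L2per u, is_weak_deriv e_theta u a & is_weak_deriv e_t u b].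

Lemma is_weak_derivB e u v a b : e = e_theta \/ e = e_t -> L2per u -> L2per v ->
  is_weak_deriv e u a -> is_weak_deriv e v b ->
  is_weak_deriv e (fun p => u p - v p) (fun p => a p - b p).
Proof.
move=> eE Lu Lv [La Ha] [Lb Hb]; split; first exact: L2perB.
move=> phi sphi; have [c cd _] := smooth_per_derive eE sphi.
have Iu := integrable_T2_mul cd (L2per_integrable Lu).
have Iv := integrable_T2_mul cd (L2per_integrable Lv).
have Ia := integrable_T2_mul c (L2per_integrable La).
have Ib := integrable_T2_mul c (L2per_integrable Lb).
under eq_Rintegral do rewrite mulrBl.
under [in RHS]eq_Rintegral do rewrite mulrBl.
by rewrite !RintegralB// Ha// Hb// opprB opprK addrC.
Qed.

Lemma H1pairB u v a b c d : H1pair u a b -> H1pair v c d ->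
  H1pair (fun p => u p - v p) (fun p => a p - c p) (fun p => b p - d p).
Proof.
move=> [Lu ua ub] [Lv vc vd]; split; first exact: L2perB.
- by apply: is_weak_derivB => //; left.
- by apply: is_weak_derivB => //; right.
Qed.

Lemma weak_derivP e u : (exists w, is_weak_deriv e u w) ->
  is_weak_deriv e u (weak_deriv e u).
Proof. by move=> ex; exact: (xgetPex (cst 0) ex). Qed.

Lemma weak_deriv_ae e u w : is_weak_deriv e u w ->
  {ae leb2, forall p : mR * mR, T2 p -> weak_deriv e u p = w p}.
Proof. by move=> uw; exact: (weak_deriv_unique (weak_derivP (ex_intro _ w uw)) uw). Qed.

Lemma H1pair_weak_deriv u : H1per u ->
  H1pair u (weak_deriv e_theta u) (weak_deriv e_t u).
Proof. by move=> [Lu e1 e2]; split => //; exact: weak_derivP. Qed.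

Definition H1norm_sq u a b : R := L2norm_sq u + L2norm_sq a + L2norm_sq b.

Lemma H1norm_pair u a b : H1pair u a b -> H1norm u = Num.sqrt (H1norm_sq u a b).
Proof.
move=> [Lu ua ub]; rewrite /H1norm /H1norm_sq; congr (Num.sqrt (_ + _ + _)).
- apply: L2norm_sq_ae; last exact: weak_deriv_ae.
    by have [[]] : is_weak_deriv e_theta u (weak_deriv e_theta u)
      by apply: weak_derivP; exists a.
  by case: ua => -[].
- apply: L2norm_sq_ae; last exact: weak_deriv_ae.
    by have [[]] : is_weak_deriv e_t u (weak_deriv e_t u) by apply: weak_derivP; exists b.
  by case: ub => -[].
Qed.

Lemma smooth_per_H1pair phi : smooth_per phi ->
  H1pair phi (fun p => 'D_e_theta phi p) (fun p => 'D_e_t phi p).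
Proof.
move=> sphi; split.
- by apply: continuous_L2per; have [] := smooth_per_derive (or_introl erefl) sphi.
- by apply: smooth_per_weak_deriv => //; left.
- by apply: smooth_per_weak_deriv => //; right.
Qed.

(** With [H1perD_intro], this translates membership in the closure into squared norms of explicit
    derivatives, free of square roots and of [weak_deriv]. *)
Lemma H1perD_approx u a b (eps : R) : H1perD u -> H1pair u a b -> 0 < eps ->
  exists2 phi, smooth_perD phi & H1norm_sq (fun p => u p - phi p)
    (fun p => a p - 'D_e_theta phi p) (fun p => b p - 'D_e_t phi p) < eps.
Proof.
move=> [_ H] uab eps0; have e0 : 0 < Num.sqrt eps by rewrite sqrtr_gt0.
have [phi sphi lt] := H _ e0; exists phi => //; move: lt.
rewrite (H1norm_pair (H1pairB uab (smooth_per_H1pair sphi.1))).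
by rewrite ltr_sqrt.
Qed.

Lemma H1perD_intro u a b : H1pair u a b ->
  (forall eps : R, 0 < eps -> exists2 phi, smooth_perD phi &
    H1norm_sq (fun p => u p - phi p)
    (fun p => a p - 'D_e_theta phi p) (fun p => b p - 'D_e_t phi p) < eps) ->
  H1perD u.
Proof.
move=> uab H; split; first by case: uab => Lu ua ub; split => //; [exists a|exists b].
move=> eps eps0; have [phi sphi lt] := H _ (exprn_gt0 2 eps0); exists phi => //.
rewrite (H1norm_pair (H1pairB uab (smooth_per_H1pair sphi.1))).
by rewrite -[ltRHS](gtr0_norm eps0) -sqrtr_sqr ltr_sqrt// exprn_gt0.
Qed.

End sobolev_calculus.

(* Otherwise unification tries to convert the coordinates of [e_theta] and
   [e_t], that is, the real numbers 1 and 0. *)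
Opaque e_theta e_t.

(** * Poincare inequality and uniqueness of weak solutions *)

Section weak_solution_uniqueness.
Context {R : realType}.
Local Notation mR := (measurableTypeR R).
Local Notation mu := (@lebesgue_measure R).
Implicit Types (u v w a b g phi psi : R * R -> R) (e p : R * R).
Let mT2 : measurable (T2 : set (mR * mR)) := measurable_T2.

Lemma partialB (s : seq bool) phi psi : (forall k, Ck k setT phi) -> (forall k, Ck k setT psi) ->
  partial s (fun p => phi p - psi p) = (fun p => partial s phi p - partial s psi p).
Proof.
move=> s1 s2; elim: s => //= b s ->.
have [_ d1] := s1 (size s).+1 s (leqnSn _); have [_ d2] := s2 (size s).+1 s (leqnSn _).
apply/funext => p.
have [h1 h2] := d1 (leqnn _) p I; have [h3 h4] := d2 (leqnn _) p I.
by case: b; rewrite /d_t /d_theta deriveB.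
Qed.

Lemma smooth_perB phi psi : smooth_per phi -> smooth_per psi ->
  smooth_per (fun p => phi p - psi p).
Proof.
move=> [s1 p1 q1] [s2 p2 q2]; split=> [k s sk|t x|x t]; last 2 first.
- by rewrite /= p1 p2.
- by rewrite /= q1 q2.
have [c1 d1] := s1 (size s).+1 s (leqnSn _); have [c2 d2] := s2 (size s).+1 s (leqnSn _).
rewrite partialB//; split=> [p _|_ p _].
  by apply: cvgB; [exact: c1|exact: c2].
have [h1 h2] := d1 (leqnn _) p I; have [h3 h4] := d2 (leqnn _) p I.
by split; apply: derivableB.
Qed.

Lemma smooth_perDB phi psi : smooth_perD phi -> smooth_perD psi ->
  smooth_perD (fun p => phi p - psi p).
Proof.
move=> [s1 [r1 /andP[r10 r11] h1]] [s2 [r2 /andP[r20 r21] h2]]; split; first exact: smooth_perB.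
exists (Num.max r1 r2); first by rewrite lt_max r10 gt_max r11 r21.
move=> x xpi; apply: subset_trans (_ : _ `<=` `]- r1, r1[ `|` `]- r2, r2[) _; last first.
  by move=> t [] /=; rewrite !in_itv/= => /andP[t1 t2]; rewrite lt_max t2 ?orbT// andbT
    oppr_max gt_min t1 ?orbT.
apply: subset_trans (setUSS (h1 x xpi) (h2 x xpi)); rewrite -closureU.
apply: closureS => t [t1]; have [p0|p0] := eqVneq (phi (x, t)) 0; last by left.
by rewrite p0 sub0r oppr_eq0; right.
Qed.

Lemma lt_quarters (x y z : R) : x < z / 4 -> y < z / 4 -> 2 * x + 2 * y < z.
Proof. lra. Qed.

Lemma sum3_le (x x1 x2 y y1 y2 z z1 z2 : R) : x <= 2 * x1 + 2 * x2 ->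
  y <= 2 * y1 + 2 * y2 -> z <= 2 * z1 + 2 * z2 ->
  x + y + z <= 2 * (x1 + y1 + z1) + 2 * (x2 + y2 + z2).
Proof. lra. Qed.

(* The instance behind the Poincare inequality: Young's inequality for
   [- 2 t A B] with [t ^+ 2 <= 1]. *)
Lemma young_itv (t A B : R) : -1 <= t <= 1 ->
  2^-1 * A ^+ 2 <= A * A + t * (2 * (A * B)) + 2 * B ^+ 2.
Proof.
move=> t1; have t21 : t ^+ 2 <= 1 
    by case/andP: t1 => *; rewrite -subr_ge0 -[1](expr1n _ 2) subr_sqr mulr_ge0 //; lra.
have h1 := sqr_ge0 (A / 2 + t * B * 2); have h2 : (t * B) ^+ 2 <= B ^+ 2.
  by rewrite exprMn ler_piMl// sqr_ge0.
have -> : A * A + t * (2 * (A * B)) + 2 * B ^+ 2 = 2^-1 * A ^+ 2 +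
   (2 * (A / 2 + t * B) ^+ 2 + 2 * (B ^+ 2 - (t * B) ^+ 2)) by field.
by rewrite lerDl addr_ge0// mulr_ge0 ?sqr_ge0// subr_ge0.
Qed.

Lemma H1perDB u v : H1perD u -> H1perD v -> H1perD (fun p => u p - v p).
Proof.
move=> Du Dv; have pu := H1pair_weak_deriv Du.1; have pv := H1pair_weak_deriv Dv.1.
apply: (H1perD_intro (H1pairB pu pv)) => eps eps0.
have e40 : 0 < eps / 4 by rewrite divr_gt0.
have [phi sphi lphi] := H1perD_approx Du pu e40.
have [psi spsi lpsi] := H1perD_approx Dv pv e40.
exists (fun p => phi p - psi p); first exact: smooth_perDB.
have [L1 [La1 _] [Lb1 _]] := H1pairB pu (smooth_per_H1pair sphi.1).
have [L2 [La2 _] [Lb2 _]] := H1pairB pv (smooth_per_H1pair spsi.1).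
have d1 e p : e = e_theta \/ e = e_t -> 'D_e (fun p => phi p - psi p) p = 'D_e phi p - 'D_e psi p.
  move=> eE; have [_ _ dphi] := smooth_per_derive eE sphi.1.
  by have [_ _ dpsi] := smooth_per_derive eE spsi.1; rewrite deriveB.
have E u1 u2 v1 v2 : L2per (fun p => u1 p - v1 p) -> L2per (fun p => u2 p - v2 p) ->
    L2norm_sq (fun p => u1 p - u2 p - (v1 p - v2 p)) <=
    2 * L2norm_sq (fun p => u1 p - v1 p) + 2 * L2norm_sq (fun p => u2 p - v2 p).
  move=> h1 h2; apply: le_trans (L2norm_sqB h1 h2); rewrite le_eqVlt; apply/orP; left.
  by apply/eqP; congr L2norm_sq; apply/funext => p; ring.
have F e a b : e = e_theta \/ e = e_t ->
    (fun p => a p - b p - 'D_e (fun p => phi p - psi p) p) =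
    (fun p => a p - b p - ('D_e phi p - 'D_e psi p)).
  by move=> eE; apply/funext => p; rewrite d1.
rewrite (F e_theta _ _ (or_introl erefl)) (F e_t _ _ (or_intror erefl)).
apply: le_lt_trans (lt_quarters lphi lpsi).
by apply: sum3_le; apply: E.
Qed.

Lemma continuous_closed_itv0 (f : R -> R) (a b : R) : a < b -> continuous f ->
  (forall x, a < x < b -> f x = 0) -> forall x, a <= x <= b -> f x = 0.
Proof.
move=> ab cf f0 x /andP[ax xb].
have [xa|xa] := eqVneq x a.
  rewrite xa; apply: (@cvg_unique _ (@Rhausdorff R) (f y @[y --> a^'+])).
    by apply: cvg_at_right_filter; exact: cf.
  apply: cvg_near_cst; near=> y; apply: f0; apply/andP; split; near: y.
    exact: nbhs_right_gt.
  exact: nbhs_right_lt.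
have [xb'|xb'] := eqVneq x b.
  rewrite xb'; apply: (@cvg_unique _ (@Rhausdorff R) (f y @[y --> b^'-])).
    by apply: cvg_at_left_filter; exact: cf.
  apply: cvg_near_cst; near=> y; apply: f0; apply/andP; split; near: y.
    exact: nbhs_left_gt.
  exact: nbhs_left_lt.
by apply: f0; rewrite !lt_neqAle ax xb eq_sym xa xb'.
Unshelve. all: by end_near. Qed.

(** The support condition concerns angles strictly between - pi and pi; the two end angles follow by
    continuity. *)
Lemma smooth_perD_boundary phi : smooth_perD phi ->
  forall x, - pi <= x <= pi -> phi (x, 1) = 0.
Proof.
move=> [sphi [r /andP[_ r1] hr]]; have [cphi _ _] := smooth_per_derive (or_introl erefl) sphi.
apply: (@continuous_closed_itv0 (fun x => phi (x, 1))).
- by rewrite gtrN// pi_gt0.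
- exact: continuous_slice1.
- move=> x xpi; apply/eqP/negPn/negP => phi0.
  have : `]- r, r[%classic (1 : R).
    apply: (hr x xpi); apply: subset_closure; split => //.
    by rewrite lexx andbT; lra.
  by rewrite /= in_itv/= => /andP[_]; rewrite ltNge (ltW r1).
Qed.

(** The multiplier t: the derivative of t phi^2 in t is phi^2 + 2 t phi phi_t, named [h], and it
    integrates to 0 because phi vanishes at t = 1 and, by periodicity, at t = - 1. Young's
    inequality then bounds half of phi^2 by [h] plus 2 phi_t^2, whence the constant 4. *)
Lemma poincare phi : smooth_perD phi ->
  L2norm_sq phi <= 4 * L2norm_sq (fun p => 'D_e_t phi p).
Proof.
move=> Dphi; have [cphi cd d] := smooth_per_derive (or_intror erefl) Dphi.1.
have cM (g h : R * R -> R) : continuous g -> continuous h -> continuous (fun p => g p * h p).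
  by move=> cg ch p; apply: cvgM; [exact: cg|exact: ch].
have csnd : continuous (fun p : R * R => p.2) by move=> p; exact: cvg_snd.
pose h (p : R * R) := phi p * phi p + p.2 * (2 * (phi p * 'D_e_t phi p)).
have ch : continuous h.
  move=> p; apply: cvgD; first exact: (cM _ _ cphi cphi).
  apply: (cM _ _ csnd) => q; apply: cvgM; [exact: cvg_cst|exact: (cM _ _ cphi cd)].
have H0 : \int[leb2]_(p in T2) h p = 0.
  apply: (@Rintegral_box_d_t _ (fun p => p.2 * (phi p * phi p)) h) => //.
  - move=> p; have d2 : is_derive p e_t (fun p : R * R => p.2) (1 : R).
      by apply/is_derive_e_t => /=; exact: is_derive_id.
    apply: is_derive_eq (is_deriveM d2 (is_deriveM (d p) (d p))) _.
    by rewrite -![_ *: _]/(_ * _) /h -[(phi * phi)%R p]/(phi p * phi p); ring.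
  - move=> x; rewrite in_itv/= => xI.
    by have [_ <-] := smooth_per_box Dphi.1; rewrite (smooth_per_box Dphi.1).2
      smooth_perD_boundary// !mulr0.
have L1 := continuous_L2per cphi; have L2 := continuous_L2per cd.
have i1 : leb2.-integrable (T2 : set (mR * mR)) (EFin \o h).
  exact: continuous_box_integrable.
have i2 : leb2.-integrable (T2 : set (mR * mR)) (EFin \o (fun p => 2 * 'D_e_t phi p ^+ 2)).
  by apply: RintegrableZ => //; case: L2.
have i3 : leb2.-integrable (T2 : set (mR * mR)) (EFin \o (fun p => 2^-1 * phi p ^+ 2)).
  by apply: RintegrableZ => //; case: L1.
have : \int[leb2]_(p in T2) (2^-1 * phi p ^+ 2) <=
    \int[leb2]_(p in T2) (h p + 2 * 'D_e_t phi p ^+ 2).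
  apply: le_Rintegral => //; first exact: RintegrableD.
  move=> [x t] [/= _]; rewrite in_itv/= => /andP[t1 t2]; rewrite /h/=.
  set A := phi _; set B := 'D_e_t _ _.
  by apply: young_itv; rewrite t1.
rewrite RintegralD// H0 add0r !RintegralZl//; [|by case: L2|by case: L1].
rewrite -/(L2norm_sq phi) -/(L2norm_sq _) => le.
by rewrite -(@ler_pM2l _ 2^-1)// (le_trans le)// mulrA (_ : 2^-1 * 4 = 2 :> R)//; field.
Qed.

Lemma L2norm_sq_triangle u v : L2per u -> L2per v ->
  L2norm_sq u <= 2 * L2norm_sq (fun p => u p - v p) + 2 * L2norm_sq v /\
  L2norm_sq v <= 2 * L2norm_sq (fun p => u p - v p) + 2 * L2norm_sq u.
Proof.
move=> Lu Lv; have [_ iu] := Lu; have [_ iv] := Lv; have [_ iuv] := L2perB Lu Lv.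
have iuv2 := RintegrableZ mT2 2 iuv.
have iu2 := RintegrableZ mT2 2 iu; have iv2 := RintegrableZ mT2 2 iv.
rewrite /L2norm_sq -!RintegralZl// -!RintegralD//; split; apply: le_Rintegral => //.
- exact: RintegrableD.
- by move=> p _; apply: le_trans (sqrD_le2 _ _); rewrite subrK.
- exact: RintegrableD.
- move=> p _; rewrite addrC; apply: le_trans (sqrB_le2 _ _).
  by rewrite opprB addrC subrK.
Qed.

Lemma H1perD_eq0 w a b : H1perD w -> H1pair w a b -> L2norm_sq b = 0 -> L2norm_sq w = 0.
Proof.
move=> Dw pw b0; apply/eqP; rewrite eq_le L2norm_sq_ge0 andbT.
apply/ler_addgt0Pr => e e0; rewrite add0r.
(* With X and Y the squared errors of the function and of its t-derivative, two triangle
   inequalities and the Poincare inequality give the bound 2 X + 2 * 4 * 2 Y = 2 X + 16 Y, which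
   this choice keeps below [e]. *)
have e180 : 0 < e / 18 by rewrite divr_gt0.
have [phi sphi] := H1perD_approx Dw pw e180.
have pphi := smooth_per_H1pair sphi.1.
have [Lw _ [Lb _]] := pw; have [Lp _ [Lpb _]] := pphi.
have [h1 _] := L2norm_sq_triangle Lw Lp.
have [_ h2] := L2norm_sq_triangle Lb Lpb.
have h3 := poincare sphi; rewrite b0 in h2; rewrite /H1norm_sq => lt.
have h4 := L2norm_sq_ge0 (fun p => a p - 'D_e_theta phi p).
set X := L2norm_sq (fun p => w p - phi p) in h1 lt.
set Y := L2norm_sq (fun p => b p - 'D_e_t phi p) in h2 lt.
set Z := L2norm_sq (fun p => a p - _) in h4 lt.
have X0 : 0 <= X := L2norm_sq_ge0 _; have Y0 : 0 <= Y := L2norm_sq_ge0 _.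
move: h1 h2 h3 h4 lt X0 Y0; move: (L2norm_sq w) (L2norm_sq phi) (L2norm_sq _) X Y Z.
by clear => W P Q X Y Z; lra.
Qed.

Lemma Rintegral_dot_ae z1 z2 a1 a2 b1 b2 : L2per z1 -> L2per z2 ->
  L2per a1 -> L2per a2 -> L2per b1 -> L2per b2 ->
  {ae leb2, forall p : mR * mR, T2 p -> a1 p = b1 p} ->
  {ae leb2, forall p : mR * mR, T2 p -> a2 p = b2 p} ->
  \int[leb2]_(p in T2) (z1 p * a1 p + z2 p * a2 p) =
  \int[leb2]_(p in T2) (z1 p * b1 p) + \int[leb2]_(p in T2) (z2 p * b2 p).
Proof.
move=> Lz1 Lz2 La1 La2 Lb1 Lb2 e1 e2.
have i1 := L2perM Lz1 Lb1; have i2 := L2perM Lz2 Lb2.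
have i3 := L2perM Lz1 La1; have i4 := L2perM Lz2 La2.
rewrite -RintegralD//; apply: Rintegral_ae_eq => //.
- exact: Rintegrable_measurable (RintegrableD mT2 i3 i4).
- exact: Rintegrable_measurable (RintegrableD mT2 i1 i2).
- by apply: filterS2 e1 e2 => p h1 h2 pT; rewrite h1// h2.
Qed.

Lemma L2norm_sqB_split a b : L2per a -> L2per b ->
  L2norm_sq (fun p => a p - b p) =
  \int[leb2]_(p in T2) (a p * (a p - b p)) - \int[leb2]_(p in T2) (b p * (a p - b p)).
Proof.
move=> La Lb; have Lab := L2perB La Lb.
rewrite -RintegralB//; [|exact: L2perM..].
by apply: eq_Rintegral => p _; ring.
Qed.

(** Both weak equations are tested with the difference of the two solutions and have the same
    right-hand side [c]. Subtracting them leaves the squared norm of the gradient of the difference.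
    Its t-component is what [H1perD_eq0] consumes. *)
Lemma grad_diff_eq0 a1 a2 b1 b2 (c : R) : L2per a1 -> L2per a2 -> L2per b1 -> L2per b2 ->
  \int[leb2]_(p in T2) (a1 p * (a1 p - b1 p)) +
  \int[leb2]_(p in T2) (a2 p * (a2 p - b2 p)) = c ->
  \int[leb2]_(p in T2) (b1 p * (a1 p - b1 p)) +
  \int[leb2]_(p in T2) (b2 p * (a2 p - b2 p)) = c ->
  L2norm_sq (fun p => a2 p - b2 p) = 0.
Proof.
move=> La1 La2 Lb1 Lb2 E1 E2.
have : L2norm_sq (fun p => a1 p - b1 p) + L2norm_sq (fun p => a2 p - b2 p) = 0.
  by rewrite !L2norm_sqB_split// addrACA -opprD E1 E2 subrr.
by move/eqP; rewrite paddr_eq0 ?L2norm_sq_ge0// => /andP[_ /eqP].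
Qed.

Lemma weak_solution_unique g u v : weak_solution g u -> weak_solution g v ->
  {ae leb2, forall p : mR * mR, T2 p -> u p = v p}.
Proof.
move=> [Lg Du Hu] [_ Dv Hv].
have Dw := H1perDB Du Dv.
have pu := H1pair_weak_deriv Du.1; have pv := H1pair_weak_deriv Dv.1.
have pw := H1pairB pu pv.
have [Lu [Lu1 _] [Lu2 _]] := pu; have [Lv [Lv1 _] [Lv2 _]] := pv.
have [Lw w1 w2] := pw; have [Lw1 _] := w1; have [Lw2 _] := w2.
have e1 := weak_deriv_ae w1; have e2 := weak_deriv_ae w2.
have [m1 _] := weak_derivP (ex_intro _ _ w1).
have [m2 _] := weak_derivP (ex_intro _ _ w2).
have := Hu _ Dw; have := Hv _ Dw.
rewrite (Rintegral_dot_ae Lv1 Lv2 m1 m2 Lw1 Lw2 e1 e2).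
rewrite (Rintegral_dot_ae Lu1 Lu2 m1 m2 Lw1 Lw2 e1 e2) => E2 E1.
have n2 := grad_diff_eq0 Lu1 Lu2 Lv1 Lv2 E1 E2.
have := H1perD_eq0 Dw pw n2; rewrite /L2norm_sq => w0.
have := Rintegral_eq0_ae mT2 Lw.2 (fun p _ => sqr_ge0 _) w0.
by apply: filterS => p h pT; have /eqP := h pT; rewrite sqrf_eq0 subr_eq0 => /eqP.
Qed.

End weak_solution_uniqueness.

Lemma is_derive_unique (R : realType) (V : normedModType R) (f : V -> R) (x v : V)
  (a b : R) : is_derive x v f a -> is_derive x v f b -> a = b.
Proof. by move=> [_ <-] [_ <-]. Qed.

Section cutoff.
Context {R : realType}.

(** The usual quotient a / (a + b) of flat functions, evaluated at cos (pi t) instead of t: this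
    makes it 2-periodic, and cos (pi t) decreases in |t| on [- 1, 1]. The denominator never vanishes
    because c1 < c0. *)
Lemma smooth_cutoff (r0 r1 : R) : 0 <= r0 -> r0 < r1 -> r1 <= 1 ->
  exists chi : R -> R, [/\ smooth1 chi, forall t, chi (t + 2) = chi t,
    forall t, `|t| <= r0 -> chi t = 1 & forall t, r1 <= `|t| <= 1 -> chi t = 0].
Proof.
move=> r00 r01 r11.
pose c0 := cos (pi * r0) : R; pose c1 := cos (pi * r1) : R.
have pi0 := @pi_gt0 R.
have rng (x : R) : 0 <= x -> x <= 1 -> pi * x \in `[0, pi].
  by move=> x0 x1; rewrite in_itv/= mulr_ge0 ?(ltW pi0)//= ler_piMr// ltW.
have cosle (s t : R) : 0 <= s -> s <= t -> t <= 1 -> cos (pi * t) <= cos (pi * s).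
  move=> s0 st t1; have t0 := le_trans s0 st; have s1 := le_trans st t1.
  rewrite leNgt ltr_cos ?rng//.
  by rewrite -leNgt ler_pM2l.
have c10 : c1 < c0.
  have r10 : 0 <= r1 := le_trans r00 (ltW r01).
  have r01' : r0 <= 1 := le_trans (ltW r01) r11.
  by rewrite ltr_cos ?rng// ltr_pM2l.
have cabs (t : R) : cos (pi * t) = cos (pi * `|t|).
  by rewrite -[LHS]cos_norm normrM gtr0_norm.
pose a t : R := flat 0 (cos (pi * t) + - c1).
pose b t : R := flat 0 (c0 + -1 * cos (pi * t)).
have ab0 t : 0 < a t + b t.
  rewrite /a /b; have [h|h] := ltP c1 (cos (pi * t)).
    by rewrite ltr_pwDl// ?flat_ge0// flat_gt0// subr_gt0.
  by rewrite ltr_wpDl// ?flat_ge0// flat_gt0// mulN1r subr_gt0 (le_lt_trans h).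
exists (fun t => a t * (a t + b t)^-1); split.
- have sa : smooth1 a.
    by apply: smooth1_flat; apply: smooth1D; [exact: smooth1_cos|exact: smooth1_cst].
  have sb : smooth1 b.
    apply: smooth1_flat; apply: smooth1D; first exact: smooth1_cst.
    by apply: smooth1M; [exact: smooth1_cst|exact: smooth1_cos].
  apply: smooth1M => //; apply: smooth1V; first exact: smooth1D.
  by move=> t; rewrite gt_eqF.
- move=> t; have E : cos (pi * (t + 2)) = cos (pi * t).
    by rewrite mulrDr -[RHS]cosD2pi mulr_natr.
  by rewrite /a /b E.
- move=> t tr; have b0 : b t = 0.
    by rewrite /b flat_le0// mulN1r subr_le0 cabs cosle// (le_trans (ltW r01)).
  by rewrite -{1}[a t]addr0 -b0 divff// gt_eqF.
- move=> t /andP[t1 t2]; rewrite /a flat_le0 ?mul0r//.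
  by rewrite subr_le0 cabs cosle// (le_trans r00)// ltW.
Qed.

End cutoff.

(** * Classical solutions are weak solutions *)

Section weak_solution_existence.
Context {R : realType}.
Local Notation mR := (measurableTypeR R).
Local Notation mu := (@lebesgue_measure R).
Implicit Types (u v w a b g phi psi : R * R -> R) (e p : R * R).
Let mT2 : measurable (T2 : set (mR * mR)) := measurable_T2.

Lemma L2norm_sq_mollify_cvg (c G : R * R -> R) : continuous c -> continuous G ->
  (fun n => L2norm_sq (fun p => c p * (G p - mollify n G p))) @ \oo --> (0 : R).
Proof.
move=> cc cG.
have iG := continuous_box_integrable (- pi) pi (-1) 1 cG.
have [M GM] := continuous_T2_bounded cG; have [C cC] := continuous_T2_bounded cc.
have m (f : R * R -> R) : continuous f -> measurable_fun (T2 : set (mR * mR)) f.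
  by move=> cf; apply: measurable_funTS; exact: continuous_measurable_fun2.
have cm n : continuous (mollify n G) by exact/smooth2_continuous/smooth2_mollify.
rewrite [X in _ --> X](_ : 0 = \int[leb2]_(p in T2) 0); last by rewrite Rintegral_eq0.
apply: (Rintegral_dominated mT2 (g := cst ((C * (M + M)) ^+ 2))) => //.
- move=> n; apply: measurable_funX; apply: m => p.
  by apply: cvgM; [exact: cc|apply: cvgB; [exact: cG|exact: cm]].
- apply: filterS ae_Omega => p Tp pT.
  rewrite [X in _ --> X](_ : 0 = (c p * (G p - G p)) ^+ 2); last by rewrite subrr mulr0 expr0n.
  have H : (fun n => c p * (G p - mollify n G p)) @ \oo --> c p * (G p - G p).
    apply: cvgM; first exact: cvg_cst.
    apply: cvgB; first exact: cvg_cst.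
    exact: (mollify_cvg (m _ cG) GM (Tp pT) (cG p)).
  by under eq_fun do rewrite expr2; rewrite expr2; apply: cvgM.
- exact: (Rintegrable_bounded mT2 leb2_T2 _ (M := `|(C * (M + M)) ^+ 2|)).
- move=> n p pT; rewrite normrX lerXn2r ?nnegrE//.
    apply: mulr_ge0; first exact: le_trans (cC _ pT).
    by apply: addr_ge0; exact: le_trans (GM _ pT).
  rewrite normrM ler_pM// ?cC// (le_trans (ler_normB _ _))// lerD ?GM//.
  exact: mollify_bound.
Qed.

Section classical_solution.
Variables (F F1 F2 F11 F22 : R * R -> R) (rho : R).
Hypotheses (cF : continuous F) (cF1 : continuous F1) (cF2 : continuous F2).
Hypotheses (cF11 : continuous F11) (cF22 : continuous F22).
Hypotheses (dF1 : forall p : R * R, is_derive p e_theta F (F1 p))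
  (dF2 : forall p : R * R, is_derive p e_t F (F2 p))
  (dF11 : forall p : R * R, is_derive p e_theta F1 (F11 p))
  (dF22 : forall p : R * R, is_derive p e_t F2 (F22 p)).
Hypotheses (pF : forall t, F (- pi, t) = F (pi, t))
  (pF1 : forall t, F1 (- pi, t) = F1 (pi, t))
  (pF2 : forall t, F2 (- pi, t) = F2 (pi, t)).
Hypotheses (rho0 : 0 <= rho) (rho1 : rho < 1)
  (F0 : forall x t, rho < `|t| -> F (x, t) = 0).

Let rho_lt1 (t : R) : `|t| = 1 -> rho < `|t|. Proof. by move=> ->. Qed.

Let F1_0 x t : rho < `|t| -> F1 (x, t) = 0.
Proof.
move=> rt; have /is_derive_e_theta /= d := dF1 (x, t).
have z : (fun x => F (x, t)) = cst 0 by apply/funext => y; exact: F0.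
rewrite z in d; have := @derive_val _ _ _ _ _ _ _ d.
by rewrite derive_cst.
Qed.

Let F2_0 x t : rho < `|t| -> F2 (x, t) = 0.
Proof.
move=> rt; have /is_derive_e_t /= d := dF2 (x, t).
have z : {near t, (fun s => F (x, s)) =1 cst 0}.
  near=> s; apply: F0; near: s.
  by apply: (cvgr_gt `|t|) => //; apply: cvg_norm; exact: cvg_id.
have := @derive_val _ _ _ _ _ _ _ d.
by rewrite (near_eq_derive _ z) derive_cst.
Unshelve. all: by end_near. Qed.

Let wF1 : is_weak_deriv e_theta F F1.
Proof.
apply: classical_weak_deriv => //; first by left.
by move=> x _; rewrite !F0// rho_lt1// ?normrN normr1.
Qed.

Let wF2 : is_weak_deriv e_t F F2.
Proof.
apply: classical_weak_deriv => //; first by right.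
by move=> x _; rewrite !F0// rho_lt1// ?normrN normr1.
Qed.

Let wF11 : is_weak_deriv e_theta F1 F11.
Proof.
apply: classical_weak_deriv => //; first by left.
by move=> x _; rewrite !F1_0// rho_lt1// ?normrN normr1.
Qed.

Let wF22 : is_weak_deriv e_t F2 F22.
Proof.
apply: classical_weak_deriv => //; first by right.
by move=> x _; rewrite !F2_0// rho_lt1// ?normrN normr1.
Qed.

Let iF G : continuous G -> leb2.-integrable (T2 : set (mR * mR)) (EFin \o G).
Proof. exact: continuous_box_integrable. Qed.

Let pairF : H1pair F F1 F2.
Proof. by split=> //; exact: continuous_L2per. Qed.

(** The cosine kernels have full support, so a mollification of [F] need not vanish near t = 1 or t
    = - 1. It is multiplied by a cutoff [chi] equal to 1 on the support of [F]; then [F = chi * F],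
    and differentiating this identity shows to which terms the derivatives of the approximants
    converge. *)
Lemma classical_H1perD : H1perD F.
Proof.
have r01 : rho < (1 + rho) / 2 by move: rho1 => ?; lra.
have r11 : (1 + rho) / 2 <= 1 by move: rho1 => ?; lra.
have [chi [schi pchi chi1 chi0]] := smooth_cutoff rho0 r01 r11.
have [chi' schi' dchi] := smooth1_derive schi.
have chiF p : F p = chi p.2 * F p.
  case: p => x t /=; have [tr|tr] := leP `|t| rho; first by rewrite chi1// mul1r.
  by rewrite F0// mulr0.
have dchi2 (p : R * R) : is_derive p e_t (fun p => chi p.2) (chi' p.2).
  by apply/is_derive_e_t; exact: dchi.
have dchi1 (p : R * R) : is_derive p e_theta (fun p => chi p.2) (0 : R).
  by apply/is_derive_e_theta => /=; exact: is_derive_cst.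
have cchi := continuous_snd (smooth1_continuous schi).
have cchi' := continuous_snd (smooth1_continuous schi').
have FE : F = (fun p => chi p.2) * F by apply/funext => p; exact: chiF.
have chiF1 p : F1 p = chi p.2 * F1 p.
  have := is_deriveM (dchi1 p) (dF1 p); rewrite -FE => d.
  apply: etrans (is_derive_unique (dF1 p) d) _.
  by rewrite -[LHS]/(chi p.2 * F1 p + F p * 0) mulr0 addr0.
have chiF2 p : F2 p = chi p.2 * F2 p + chi' p.2 * F p.
  have := is_deriveM (dchi2 p) (dF2 p); rewrite -FE => d.
  apply: etrans (is_derive_unique (dF2 p) d) _.
  by rewrite -[LHS]/(chi p.2 * F2 p + F p * chi' p.2) [F p * _]mulrC.
pose phi n p := chi p.2 * mollify n F p.
have dm1 n p := is_derive_mollify n p (or_introl erefl) (iF cF) wF1.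
have dm2 n p := is_derive_mollify n p (or_intror erefl) (iF cF) wF2.
have phi1 n p : 'D_e_theta (phi n) p = chi p.2 * mollify n F1 p.
  have d := is_deriveM (dchi1 p) (dm1 n p).
  apply: etrans (@derive_val _ _ _ _ _ _ _ d) _.
  by rewrite -[LHS]/(chi p.2 * mollify n F1 p + mollify n F p * 0) mulr0 addr0.
have phi2 n p : 'D_e_t (phi n) p = chi p.2 * mollify n F2 p + chi' p.2 * mollify n F p.
  have d := is_deriveM (dchi2 p) (dm2 n p).
  apply: etrans (@derive_val _ _ _ _ _ _ _ d) _.
  by rewrite -[LHS]/(chi p.2 * mollify n F2 p + mollify n F p * chi' p.2) [mollify n F p * _]mulrC.
have sphi n : smooth_perD (phi n).
  have [_ p1 p2] := smooth_per_mollify n (iF cF).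
  split; first split=> [k|t x|x t].
  - apply: smooth2_Ck; apply: smooth2M; first exact: smooth2_snd.
    exact: (smooth2_mollify n (iF cF)).
  - by rewrite /phi /= p1.
  - by rewrite /phi /= p2 pchi.
  (* The midpoint between (1 + rho) / 2, from where the cutoff vanishes, and 1: the closed support
     then fits in an open interval. *)
  exists ((3 + rho) / 4); first by move: rho0 rho1 => ? ?; apply/andP; split; lra.
  move=> x _; set A := [set _ | _].
  have AI : A `<=` `[- ((1 + rho) / 2), (1 + rho) / 2].
    move=> t [t1 /eqP p0]; rewrite /= in_itv/= -ler_norml.
    have [//|h] := leP; case: p0; rewrite /phi /= chi0 ?mul0r// (ltW h) /=.
    by rewrite ler_norml.
  have cI : closed (`[- ((1 + rho) / 2), (1 + rho) / 2] : set R).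
    by apply: compact_closed; [exact: Rhausdorff|exact: segment_compact].
  have := closureS AI; rewrite -((closure_id _).1 cI).
  move=> H t /H /=; rewrite !in_itv/= => /andP[t1 t2].
  by move: rho1 => ?; apply/andP; split; lra.
have L2m (c : R * R -> R) n (G : R * R -> R) : continuous c -> continuous G -> L2per (fun p => c p * (G p - mollify n G p)).
  move=> cc cG; apply: continuous_L2per => p; apply: cvgM; first exact: cc.
  by apply: cvgB; [exact: cG|exact/smooth2_continuous/smooth2_mollify/iF].
apply: (H1perD_intro pairF) => eps eps0.
(* The two doubled terms bound the error of the t-derivative, where Leibniz's rule produces an extra
   term with [chi']. The sign in [- chi'] presents that error as a difference, the form expected by
   [L2norm_sqB]. *)
pose S n := L2norm_sq (fun p => chi p.2 * (F p - mollify n F p)) +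
  L2norm_sq (fun p => chi p.2 * (F1 p - mollify n F1 p)) +
  (2 * L2norm_sq (fun p => chi p.2 * (F2 p - mollify n F2 p)) +
   2 * L2norm_sq (fun p => - chi' p.2 * (F p - mollify n F p))).
have S0 : S @ \oo --> (0 : R).
  rewrite (_ : 0 = 0 + 0 + (2 * 0 + 2 * 0)); last by rewrite mulr0 !addr0.
  apply: cvgD; first by apply: cvgD; exact: L2norm_sq_mollify_cvg.
  apply: cvgD; (apply: cvgM; first exact: cvg_cst); apply: L2norm_sq_mollify_cvg => //.
  by move=> p; apply: cvgN; exact: cchi'.
have [n _ /(_ n (leqnn n)) Sn] : \forall n \near \oo, S n < eps.
  by apply: (cvgr_lt (0 : R)).
exists (phi n) => //; apply: le_lt_trans Sn; rewrite /H1norm_sq /S.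
apply: lerD; first apply: lerD.
- rewrite le_eqVlt; apply/orP; left; apply/eqP; congr L2norm_sq.
  by apply/funext => p; rewrite {1}chiF /phi mulrBr.
- rewrite le_eqVlt; apply/orP; left; apply/eqP; congr L2norm_sq.
  by apply/funext => p; rewrite {1}chiF1 phi1 mulrBr.
- have cN : continuous (fun p : R * R => - chi' p.2) by move=> p; apply: cvgN; exact: cchi'.
  apply: le_trans (L2norm_sqB (L2m _ n _ cchi cF2) (L2m _ n _ cN cF)).
  rewrite le_eqVlt; apply/orP; left; apply/eqP; congr L2norm_sq.
  by apply/funext => p; rewrite {1}chiF2 phi2; ring.
Qed.

(** For smooth periodic [a] this is the definition of [w]. In general [a] is mollified:
    [mollify n a] is a test function, its derivative is [mollify n b], and both integrals
    converge. *)
Lemma weak_deriv_byparts e a b v w : e = e_theta \/ e = e_t ->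
  continuous a -> continuous b -> L2per v ->
  is_weak_deriv e a b -> is_weak_deriv e v w ->
  \int[leb2]_(p in T2) (v p * b p) = - \int[leb2]_(p in T2) (w p * a p).
Proof.
move=> eE ca cb Lv ab [Lw Hw].
have H (c z : R * R -> R) : continuous c -> L2per z ->
    (fun n => \int[leb2]_(p in T2) (z p * mollify n c p)) @ \oo -->
    \int[leb2]_(p in T2) (z p * c p).
  move=> cc Lz; have [M cM] := continuous_T2_bounded cc.
  apply: (mollify_dominated (L2per_integrable Lz) _ cM); last by apply/aeW => p _; exact: cc.
  by apply: measurable_funTS; exact: continuous_measurable_fun2.
have H1 := H _ _ cb Lv; have H2 := H _ _ ca Lw.
apply: (@cvg_unique _ (@Rhausdorff R) _ _ _ _ H1).
have -> : (fun n => \int[leb2]_(p in T2) (v p * mollify n b p)) =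
    (fun n => - \int[leb2]_(p in T2) (w p * mollify n a p)).
  apply/funext => n; rewrite -Hw; last exact/smooth_per_mollify/iF.
  apply: eq_Rintegral => p _; congr (_ * _).
  by have d := is_derive_mollify n p eE (iF ca) ab; rewrite derive_val.
exact: cvgN.
Qed.

(** Integration by parts moves the derivatives of [v] onto [F1] and [F2]. The right-hand side is
    compared with the Laplacian almost everywhere only, because [radon_lap] is set to 0 on the
    boundary of [T2]. *)
Lemma classical_weak_solution g : L2per g ->
  {ae leb2, forall p : mR * mR, T2 p -> g p = F11 p + F22 p} ->
  weak_solution g F.
Proof.
move=> Lg gE; split=> //; first exact: classical_H1perD.
move=> v Dv; have [Lv wv1 wv2] := H1pair_weak_deriv Dv.1.
have e1 := weak_deriv_ae wF1; have e2 := weak_deriv_ae wF2.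
have [m1 _] := weak_derivP (ex_intro _ _ wF1).
have [m2 _] := weak_derivP (ex_intro _ _ wF2).
have LF1 := continuous_L2per cF1; have LF2 := continuous_L2per cF2.
have LF11 := continuous_L2per cF11; have LF22 := continuous_L2per cF22.
have B1 := weak_deriv_byparts (or_introl erefl) cF1 cF11 Lv wF11 wv1.
have B2 := weak_deriv_byparts (or_intror erefl) cF2 cF22 Lv wF22 wv2.
have E : \int[leb2]_(p in T2) (weak_deriv e_theta F p * weak_deriv e_theta v p +
    weak_deriv e_t F p * weak_deriv e_t v p) =
    \int[leb2]_(p in T2) (weak_deriv e_theta v p * F1 p) +
    \int[leb2]_(p in T2) (weak_deriv e_t v p * F2 p).
  rewrite -(Rintegral_dot_ae wv1.1 wv2.1 m1 m2 LF1 LF2 e1 e2).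
  move: (weak_deriv _ F) (weak_deriv _ v) (weak_deriv _ F) (weak_deriv _ v) => a b c d.
  by apply: eq_Rintegral => p _; rewrite (mulrC (b p)) (mulrC (d p)).
rewrite E -[in LHS](opprK (\int[leb2]_(p in T2) (weak_deriv e_theta v p * F1 p))) -B1.
rewrite -[in LHS](opprK (\int[leb2]_(p in T2) (weak_deriv e_t v p * F2 p))) -B2.
rewrite -opprD; congr (- _).
have i1 := L2perM Lv LF11; have i2 := L2perM Lv LF22.
rewrite -RintegralD//; apply: Rintegral_ae_eq => //.
- exact: Rintegrable_measurable (RintegrableD mT2 i1 i2).
- exact: Rintegrable_measurable (L2perM Lv Lg).
- by apply: filterS gE => p h pT; rewrite h// mulrDr.
Qed.

End classical_solution.

End weak_solution_existence.

(** * The Radon transform *)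

Section glide_symmetry.
Context {R : realType}.
Implicit Types (G H : R * R -> R) (p : R * R).

Definition glide (a c : R) (p : R * R) : R * R := (p.1 + a, c * p.2).

Lemma continuous_glide a c : continuous (glide a c).
Proof.
move=> p; apply: (@continuous_pair _ _ _ (fun q : R * R => q.1 + a) (fun q : R * R => c * q.2)).
  by apply: cvgD; [exact: cvg_fst|exact: cvg_cst].
by apply: cvgM; [exact: cvg_cst|exact: cvg_snd].
Qed.

Lemma is_derive_glide_theta (a c e : R) G p (d : R) : (forall q, G q = e * G (glide a c q)) ->
  is_derive (glide a c p) e_theta G d -> is_derive p e_theta G (e * d).
Proof.
move=> GE /is_derive_e_theta dG; apply/is_derive_e_theta.
have -> : (fun x => G (x, p.2)) = (fun x => e * G (x + a, c * p.2)).
  by apply/funext => x; rewrite GE.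
have d1 : is_derive p.1 1 (fun x => x + a) (1 : R).
  by apply: is_derive_eq; rewrite addr0.
have := is_deriveZ e (@is_derive1_comp _ _ (fun x => x + a) _ _ _ dG d1).
by rewrite mulr1.
Qed.

Lemma is_derive_glide_t (a c e : R) G p (d : R) : (forall q, G q = e * G (glide a c q)) ->
  is_derive (glide a c p) e_t G d -> is_derive p e_t G (e * d * c).
Proof.
move=> GE /is_derive_e_t dG; apply/is_derive_e_t.
have -> : (fun x => G (p.1, x)) = (fun x => e * G (p.1 + a, c * x)).
  by apply/funext => x; rewrite GE.
have := is_deriveZ e (@is_derive1_comp _ _ (fun x => c * x) _ _ _ dG (is_derive_scale c p.2)).
by rewrite -mulrA.
Qed.

(* Iterated glides bring every point of the strip [|t| <= rho] into [Omega]. *)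
Lemma glide_ind (rho : R) (Q : R * R -> Prop) : rho < 1 ->
  (forall p, Q (glide pi (-1) p) -> Q p) -> (forall p, Q (glide (- pi) (-1) p) -> Q p) ->
  (forall p, Omega p -> Q p) -> (forall p, rho < `|p.2| -> Q p) -> forall p, Q p.
Proof.
move=> rho1 Qp Qm QO Qr.
have pi0 := @pi_gt0 R.
suff H n p : `|p.1| < pi + n%:R * pi -> Q p.
  move=> p; apply: (H (Num.bound (`|p.1| / pi))).
  by rewrite ltr_wpDl ?(ltW pi0)// -ltr_pdivrMr//; exact: unstable.ltr_bound.
elim: n p => [|n IH] [x t] /=.
  rewrite mul0r addr0 ltr_norml => xpi.
  have [tr|tr] := ltP rho `|t|; first exact: Qr.
  by apply: QO; split; rewrite /= in_itv//= -ltr_norml (le_lt_trans tr).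
have -> : n.+1%:R = n%:R + 1 :> R by rewrite -natr1.
have := @pi_gt0 R; rewrite mulrDl mul1r ltr_norml => pi0' /andP[x1 x2].
have n0 : 0 <= n%:R * pi :> R by rewrite mulr_ge0// ltW.
have [xp|xp] := leP pi x.
  by apply/Qm/IH; rewrite /= ltr_norml; apply/andP; split; lra.
have [xm|xm] := leP x (- pi).
  by apply/Qp/IH; rewrite /= ltr_norml; apply/andP; split; lra.
by apply: IH; rewrite /= ltr_norml; apply/andP; split; lra.
Qed.

Definition C1_at G p : Prop :=
  [/\ {for p, continuous G}, derivable G p e_theta & derivable G p e_t].

(** The sign [e] follows the derivatives of a glide-invariant function: [d_theta] keeps it and [d_t]
    reverses it. *)
Definition glide_inv (e : R) G : Prop := forall p, G (glide pi (-1) p) = e * G p.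

Lemma glide_invE e G : e * e = 1 -> glide_inv e G -> forall p,
  G p = e * G (glide pi (-1) p) /\ G p = e * G (glide (- pi) (-1) p).
Proof.
move=> ee Ge p; split; first by rewrite Ge mulrA ee mul1r.
rewrite -Ge; congr G; rewrite /glide /=; case: p => x t /=.
by rewrite subrK mulN1r mulN1r opprK.
Qed.

Lemma glide_inv_periodic e G (t : R) : e * e = 1 -> glide_inv e G ->
  G (- pi, t) = G (pi, t).
Proof.
move=> ee Ge; rewrite -[LHS]mul1r -ee -mulrA -Ge -Ge; congr G.
by rewrite /glide /= addNr add0r !mulN1r opprK.
Qed.

Lemma near_C1_at G H p : {near p, G =1 H} -> C1_at H p -> C1_at G p.
Proof.
move=> GH [cH d1 d2]; have HG : {near p, H =1 G} by apply: filterS GH => q ->.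
split.
- rewrite /prop_for /continuous_at (nbhs_singleton GH).
  by apply: cvg_trans cH; exact: near_eq_cvg.
- exact: near_eq_derivable HG d1.
- exact: near_eq_derivable HG d2.
Qed.

Lemma C1_at_glide a c e G p : (forall q, G q = e * G (glide a c q)) ->
  C1_at G (glide a c p) -> C1_at G p.
Proof.
move=> GE [cG d1 d2]; split.
- have -> : G = (fun q => e * G (glide a c q)) by apply/funext.
  apply: cvgM; first exact: cvg_cst.
  by apply: continuous_comp; [exact: continuous_glide|].
- by have [] := is_derive_glide_theta GE (derivableP d1).
- by have [] := is_derive_glide_t GE (derivableP d2).
Qed.

Lemma glide_inv_d_theta e G : e * e = 1 -> glide_inv e G -> (forall p, C1_at G p) ->
  glide_inv e (d_theta G).
Proof.
move=> ee Ge GC p; have GE := fun q => (glide_invE ee Ge q).1.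
have [_ d _] := GC (glide pi (-1) p).
have h := is_derive_unique (is_derive_glide_theta GE (derivableP d))
  (derivableP (let: And3 _ d _ := GC p in d)).
by rewrite /d_theta -h mulrA ee mul1r.
Qed.

Lemma glide_inv_d_t e G : e * e = 1 -> glide_inv e G -> (forall p, C1_at G p) ->
  glide_inv (- e) (d_t G).
Proof.
move=> ee Ge GC p; have GE := fun q => (glide_invE ee Ge q).1.
have [_ _ d] := GC (glide pi (-1) p).
have h := is_derive_unique (is_derive_glide_t GE (derivableP d))
  (derivableP (let: And3 _ _ d := GC p in d)).
by rewrite /d_t -h mulrN1 mulrNN mulrA ee mul1r.
Qed.

Section strip.
Variable (rho : R).
Hypothesis rho1 : rho < 1.

Lemma strip_C1_at G p : (forall p, rho < `|p.2| -> G p = 0) -> rho < `|p.2| ->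
  [/\ C1_at G p, d_theta G p = 0 & d_t G p = 0].
Proof.
move=> G0 rp.
have z : {near p, G =1 cst 0}.
  near=> q; apply: G0; near: q.
  by apply: (cvgr_gt `|p.2|) => //; apply: cvg_norm; exact: cvg_snd.
split.
- by apply: (near_C1_at z); split; [exact: cvg_cst|exact: derivable_cst|exact: derivable_cst].
- by rewrite /d_theta (near_eq_derive _ z) derive_cst.
- by rewrite /d_t (near_eq_derive _ z) derive_cst.
Unshelve. all: by end_near. Qed.

Lemma glide_C1 e G : e * e = 1 -> glide_inv e G ->
  (forall p, Omega p -> C1_at G p) -> (forall p, rho < `|p.2| -> G p = 0) ->
  forall p, C1_at G p.
Proof.
move=> ee Ge GO G0; apply: (glide_ind rho1) => p.
- exact: C1_at_glide (fun q => (glide_invE ee Ge q).1).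
- exact: C1_at_glide (fun q => (glide_invE ee Ge q).2).
- exact: GO.
- by move=> rp; have [] := strip_C1_at G0 rp.
Qed.

Lemma glide_continuous e G : e * e = 1 -> glide_inv e G ->
  (forall p, Omega p -> {for p, continuous G}) -> (forall p, rho < `|p.2| -> G p = 0) ->
  continuous G.
Proof.
move=> ee Ge GO G0; apply: (glide_ind rho1) => // p.
- move=> cG; have -> : G = (fun q => e * G (glide pi (-1) q)).
    by apply/funext => q; exact: (glide_invE ee Ge q).1.
  apply: cvgM; first exact: cvg_cst.
  by apply: continuous_comp; [exact: continuous_glide|].
- move=> cG; have -> : G = (fun q => e * G (glide (- pi) (-1) q)).
    by apply/funext => q; exact: (glide_invE ee Ge q).2.
  apply: cvgM; first exact: cvg_cst.
  by apply: continuous_comp; [exact: continuous_glide|].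
- by move=> rp; have [[]] := strip_C1_at G0 rp.
Qed.

Lemma glide_weak_solution F : 0 <= rho -> Ck 2 Omega F -> glide_inv 1 F ->
  (forall p, rho < `|p.2| -> F p = 0) ->
  [/\ continuous F, continuous (laplacian F) & forall g, L2per g ->
  {ae leb2, forall p : measurableTypeR R * measurableTypeR R, T2 p -> g p = laplacian F p} ->
  weak_solution g F].
Proof.
move=> rho0 CF F_inv F0.
have ee : (- 1) * (- 1) = 1 :> R by rewrite mulrNN mulr1.
have Ck1 s : (size s < 2)%N -> forall p, Omega p -> C1_at (partial s F) p.
  move=> s2 p Op; have [c d] := CF s (ltnW s2); split; first exact: c.
    exact: (d s2 p Op).1.
  exact: (d s2 p Op).2.
have Ck2 s : (size s <= 2)%N -> forall p, Omega p -> {for p, continuous (partial s F)}.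
  by move=> s2; exact: (CF s s2).1.
have C := glide_C1 (mulr1 1) F_inv (Ck1 [::] isT) F0.
have F1_0 p : rho < `|p.2| -> d_theta F p = 0 by move=> /(strip_C1_at F0)[].
have F2_0 p : rho < `|p.2| -> d_t F p = 0 by move=> /(strip_C1_at F0)[].
have F1_inv := glide_inv_d_theta (mulr1 1) F_inv C.
have F2_inv := glide_inv_d_t (mulr1 1) F_inv C.
have C1 := glide_C1 (mulr1 1) F1_inv (Ck1 [:: false] isT) F1_0.
have C2 := glide_C1 ee F2_inv (Ck1 [:: true] isT) F2_0.
have F11_0 p : rho < `|p.2| -> d_theta (d_theta F) p = 0 by move=> /(strip_C1_at F1_0)[].
have F22_0 p : rho < `|p.2| -> d_t (d_t F) p = 0 by move=> /(strip_C1_at F2_0)[].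
have F11_inv := glide_inv_d_theta (mulr1 1) F1_inv C1.
have F22_inv := glide_inv_d_t ee F2_inv C2.
have e3 : - - 1 * - - 1 = 1 :> R by rewrite opprK mulr1.
have c11 := glide_continuous (mulr1 1) F11_inv (Ck2 [:: false; false] isT) F11_0.
have c22 := glide_continuous e3 F22_inv (Ck2 [:: true; true] isT) F22_0.
split=> [p|p|g Lg gE]; first (by have [c _ _] := C p; exact: c); first by apply: cvgD; [exact: c11|exact: c22].
apply: (@classical_weak_solution _ F (d_theta F) (d_t F) (d_theta (d_theta F)) (d_t (d_t F)) rho).
- by move=> p; have [c _ _] := C p; exact: c.
- by move=> p; have [c _ _] := C1 p; exact: c.
- by move=> p; have [c _ _] := C2 p; exact: c.
- exact: c11.
- exact: c22.
- by move=> p; have [_ d _] := C p; exact: derivableP.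
- by move=> p; have [_ _ d] := C p; exact: derivableP.
- by move=> p; have [_ d _] := C1 p; exact: derivableP.
- by move=> p; have [_ _ d] := C2 p; exact: derivableP.
- by move=> t; exact: glide_inv_periodic (mulr1 1) F_inv.
- by move=> t; exact: glide_inv_periodic (mulr1 1) F1_inv.
- by move=> t; exact: glide_inv_periodic ee F2_inv.
- exact: rho0.
- exact: rho1.
- by move=> x t tr; exact: F0.
- exact: Lg.
- exact: gE.
Qed.

End strip.

End glide_symmetry.

(** * Compact support, rotations and projections *)

Section radon_transform.
Context {R : realType}.
Local Notation mR := (measurableTypeR R).
Local Notation mu := (@lebesgue_measure R).
Implicit Types (f g F : R * R -> R) (p : R * R).

Lemma continuous_sqrD : continuous (fun x : R * R => x.1 ^+ 2 + x.2 ^+ 2).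
Proof.
have -> : (fun x : R * R => x.1 ^+ 2 + x.2 ^+ 2) = (fun x => x.1 * x.1 + x.2 * x.2).
  by apply/funext => x; rewrite !expr2.
by move=> p; apply: cvgD; [apply: cvgM; exact: cvg_fst|apply: cvgM; exact: cvg_snd].
Qed.

Lemma open_unit_ball : open (unit_ball : set (R * R)).
Proof.
have /continuousP := continuous_sqrD; move=> /(_ _ (open_lt (y := 1))).
by [].
Qed.

Lemma continuous_zero_extension f : {within closure unit_ball, continuous f} ->
  closure [set x | f x != 0] `<=` unit_ball -> continuous f.
Proof.
move=> cf fs p; have [up|nup] := pselect (unit_ball p).
  have := continuous_subspaceW (@subset_closure _ _) cf.
  by rewrite (continuous_open_subspace _ open_unit_ball); apply; exact/mem_set.
have o : open (~` closure [set x | f x != 0]) by exact/closed_openC/closed_closure.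
have n : {near p, f =1 cst 0}.
  have : nbhs p (~` closure [set x | f x != 0]) by apply: open_nbhs_nbhs; split => // /fs.
  apply: filterS => q nq; apply/eqP/negPn/negP => fq; apply: nq; exact: subset_closure.
have [] // : C1_at f p.
  by apply: (near_C1_at n); split; [exact: cvg_cst|exact: derivable_cst|exact: derivable_cst].
Qed.

(** [r] is the maximum of the squared Euclidean norm on the support, or 0 if the support is empty;
    hence the later occurrences of [Num.sqrt r]. *)
Lemma compact_support_radius f : compact (closure [set x | f x != 0]) ->
  closure [set x | f x != 0] `<=` unit_ball -> continuous f ->
  exists2 r : R, 0 <= r < 1 & forall p, r < p.1 ^+ 2 + p.2 ^+ 2 -> f p = 0.
Proof.
move=> fc fs cf; have [K0|/set0P ne] := eqVneq (closure [set x | f x != 0]) set0.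
  exists 0; first by rewrite lexx ltr01.
  move=> p _; apply/eqP/negPn/negP => fp.
  by have : (set0 : set (R * R)) p by rewrite -K0; exact: subset_closure.
have [c cK cmax] := compact_EVT_max ne fc (continuous_subspaceT continuous_sqrD).
exists (c.1 ^+ 2 + c.2 ^+ 2).
  by rewrite addr_ge0 ?sqr_ge0//=; apply: fs; exact/set_mem.
move=> p; apply: contraTeq => fp; rewrite -leNgt; apply: cmax.
by apply/mem_set/subset_closure.
Qed.

Definition Cc1 (h : R -> R) : Prop :=
  continuous h /\ exists a : R, forall x, h x != 0 -> `|x| <= a.

(** Compact support is expressed by a bound on the coordinates, which shears, exchanges of
    coordinates and rotations preserve with an explicit new bound. *)
Definition Cc2 (g : R * R -> R) : Prop :=
  continuous g /\ exists a : R, forall p, g p != 0 -> `|p.1| <= a /\ `|p.2| <= a.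

Lemma Cc1_integrable h : Cc1 h -> mu.-integrable (setT : set mR) (EFin \o h).
Proof.
move=> [ch [a ha]].
have -> : h = h \_ `[- a, a].
  apply/funext => x; rewrite /patch; case: ifPn => //; rewrite notin_setE /= in_itv/= -ler_norml.
  by move=> /negP; apply: contraNeq; exact: ha.
apply/(Rintegrable_patch mu h (measurable_itv _)).
exact: continuous_itv_integrable.
Qed.

Lemma Cc2_integrable g : Cc2 g -> leb2.-integrable (setT : set (mR * mR)) (EFin \o g).
Proof.
move=> [cg [a ga]].
have -> : g = g \_ (`[- a, a] `*` `[- a, a]).
  apply/funext => p; rewrite /patch; case: ifPn => //; rewrite notin_setE /= !in_itv/= -!ler_norml.
  by move=> h; apply/eqP/negPn/negP => /ga.
apply/(Rintegrable_patch leb2 g (measurable_box _ _ _ _)).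
exact: continuous_box_integrable.
Qed.

Lemma Cc2_slice1 g (y : R) : Cc2 g -> Cc1 (fun x => g (x, y)).
Proof.
by move=> [cg [a ga]]; split; [exact: continuous_slice1|exists a => x /ga[]].
Qed.

Lemma Cc2_slice2 g (x : R) : Cc2 g -> Cc1 (fun y => g (x, y)).
Proof.
by move=> [cg [a ga]]; split; [exact: continuous_slice2|exists a => y /ga[]].
Qed.

Lemma Cc2M g h : Cc2 g -> continuous h -> Cc2 (fun p => g p * h p).
Proof.
move=> [cg [a ga]] ch; split; first by move=> p; apply: cvgM; [exact: cg|exact: ch].
by exists a => p; rewrite mulf_eq0 negb_or => /andP[/ga].
Qed.

Lemma Cc2_shear1 g (a : R) : Cc2 g -> Cc2 (fun p => g (p.1 + a * p.2, p.2)).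
Proof.
move=> [cg [b gb]]; split.
  move=> p; apply: (continuous_comp _ (cg _)).
  apply: (@continuous_pair _ _ _ (fun q : R * R => q.1 + a * q.2) snd); last exact: cvg_snd.
  by apply: cvgD; [exact: cvg_fst|apply: cvgM; [exact: cvg_cst|exact: cvg_snd]].
exists (b + `|a| * b) => p /gb /= [h1 h2]; have b0 := le_trans (normr_ge0 _) h2.
split; last by rewrite (le_trans h2)// lerDl mulr_ge0.
rewrite -[p.1](addrK (a * p.2)) (le_trans (ler_normB _ _))// lerD// normrM.
exact: ler_wpM2l.
Qed.

Lemma Cc2_swap g : Cc2 g -> Cc2 (fun p => g (p.2, p.1)).
Proof.
move=> [cg [b gb]]; split; last by exists b => p /gb[].
move=> p; apply: (continuous_comp _ (cg _)).
by apply: (@continuous_pair _ _ _ snd fst); [exact: cvg_snd|exact: cvg_fst].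
Qed.

Lemma Rintegral_shear1 g (a : R) : Cc2 g ->
  \int[leb2]_p g (p.1 + a * p.2, p.2) = \int[leb2]_p g p.
Proof.
move=> Cg; rewrite (Rintegral_fubini2 (Cc2_integrable Cg)).
rewrite (Rintegral_fubini2 (Cc2_integrable (Cc2_shear1 a Cg))).
apply: eq_Rintegral => y _ /=.
rewrite [RHS](@Rintegral_affine _ 1 (a * y)) ?oner_eq0//.
  by rewrite normr1 mul1r; apply: eq_Rintegral => x _; rewrite mul1r.
exact: (Cc1_integrable (Cc2_slice1 y Cg)).
Qed.

Lemma Rintegral_swap g : Cc2 g -> \int[leb2]_p g (p.2, p.1) = \int[leb2]_p g p.
Proof.
move=> Cg; rewrite (Rintegral_fubini2 (Cc2_integrable Cg)).
by rewrite (Rintegral_fubini (Cc2_integrable (Cc2_swap Cg))).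
Qed.

Lemma Cc2_shear2 g (a : R) : Cc2 g -> Cc2 (fun p => g (p.1, p.2 + a * p.1)).
Proof. by move=> /Cc2_swap/(Cc2_shear1 a)/Cc2_swap. Qed.

Lemma Rintegral_shear2 g (a : R) : Cc2 g ->
  \int[leb2]_p g (p.1, p.2 + a * p.1) = \int[leb2]_p g p.
Proof.
move=> Cg; have Sg := Cc2_swap Cg.
have := Rintegral_swap (Cc2_shear1 a Sg) => /= ->.
by rewrite (Rintegral_shear1 a Sg) Rintegral_swap.
Qed.

Definition rotate (theta : R) (p : R * R) : R * R :=
  (p.1 * cos theta - p.2 * sin theta, p.1 * sin theta + p.2 * cos theta).

Lemma rotateK theta p : let q := rotate theta p in
  p.1 = q.1 * cos theta + q.2 * sin theta /\ p.2 = q.2 * cos theta - q.1 * sin theta.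
Proof.
have h := cos2Dsin2 theta; rewrite !expr2 in h; rewrite /=; split.
  rewrite -[LHS]mulr1 -{1}h; ring.
rewrite -[LHS]mulr1 -{1}h; ring.
Qed.

Lemma rotate_sqrD theta p :
  (rotate theta p).1 ^+ 2 + (rotate theta p).2 ^+ 2 = p.1 ^+ 2 + p.2 ^+ 2.
Proof.
rewrite -[RHS]mulr1 -[in RHS](cos2Dsin2 theta) /=; ring.
Qed.

Lemma continuous_rotate theta : continuous (rotate theta).
Proof.
move=> p; apply: (@continuous_pair _ _ _ (fun p => p.1 * cos theta - p.2 * sin theta)
   (fun p => p.1 * sin theta + p.2 * cos theta)).
  by apply: cvgB; (apply: cvgM; last exact: cvg_cst); [exact: cvg_fst|exact: cvg_snd].
by apply: cvgD; (apply: cvgM; last exact: cvg_cst); [exact: cvg_fst|exact: cvg_snd].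
Qed.

Lemma norm_cos_le (a x y : R) : `|x| <= a -> `|x * cos y| <= a /\ `|x * sin y| <= a.
Proof.
move=> xa; rewrite !normrM; split; apply: le_trans xa; rewrite ler_piMr// ler_norml.
  by rewrite cos_geN1 cos_le1.
by rewrite sin_geN1 sin_le1.
Qed.

Lemma Cc2_rotate g theta : Cc2 g -> Cc2 (g \o rotate theta).
Proof.
move=> [cg [a ga]]; split.
  by move=> p; apply: continuous_comp; [exact: continuous_rotate|exact: cg].
exists (a + a) => p /ga[h1 h2].
have [c1 s1] := norm_cos_le theta h1; have [c2 s2] := norm_cos_le theta h2; have [-> ->] := rotateK theta p.
split; first by rewrite (le_trans (ler_normD _ _))// lerD.
by rewrite (le_trans (ler_normB _ _))// lerD.
Qed.

(* A rotation is the product of three shears; this fails only at odd multiples of pi. *)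
Lemma Rintegral_rotate g (theta : R) : Cc2 g -> - pi < theta < pi ->
  \int[leb2]_p g (rotate theta p) = \int[leb2]_p g p.
Proof.
move=> Cg /andP[tm tp]; have [->|t0] := eqVneq theta 0.
  have E : rotate 0 = id.
    by apply/funext => -[x y]; rewrite /rotate cos0 sin0 /= !mulr1 !mulr0 subr0 add0r.
  by rewrite E.
have s0 : sin theta != 0.
  have [tn|] := ltP 0 theta; first by rewrite gt_eqF// sin_gt0_pi// tn.
  rewrite le_eqVlt (negbTE t0)/= => tn.
  by rewrite -[theta]opprK sinN oppr_eq0 gt_eqF// sin_gt0_pi// oppr_gt0 tn ltrNl.
(* [a] equals - tan (theta / 2); it is the parameter of both outer shears, and [b] that of the
   middle one. *)
pose a := (cos theta - 1) / sin theta; pose b := sin theta.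
have ab : a * b = cos theta - 1 by rewrite /a /b divfK.
have aa : a * (2 + a * b) = - sin theta.
  rewrite ab /a; apply: (mulIf s0); rewrite mulrAC -mulrA mulrA divfK//.
  have := cos2Dsin2 theta; rewrite !expr2 => h; lra.
have E p : rotate theta p = (let q := (p.1 + a * p.2, p.2) in
   let r := (q.1, q.2 + b * q.1) in (r.1 + a * r.2, r.2)).
  rewrite /rotate /=; congr (_, _).
    transitivity (p.1 * (1 + a * b) + p.2 * (a * (2 + a * b))); last by ring.
    by rewrite aa ab; ring.
  transitivity (p.1 * b + p.2 * (1 + a * b)); last by ring.
  by rewrite ab /b; ring.
have C1 := Cc2_shear1 a Cg; have C2 := Cc2_shear2 b C1; have C3 := Cc2_shear1 a C2.
have E2 : g \o rotate theta = (fun p => g (let q := (p.1 + a * p.2, p.2) in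
   let r := (q.1, q.2 + b * q.1) in (r.1 + a * r.2, r.2))).
  by apply/funext => p; rewrite /= E.
transitivity (\int[leb2]_p (g \o rotate theta) p); first by [].
rewrite E2.
by rewrite (Rintegral_shear1 a C2) (Rintegral_shear2 b C1) (Rintegral_shear1 a Cg).
Qed.

Lemma radonE g theta t : radon g (theta, t) = \int[mu]_s (g \o rotate theta) (t, s).
Proof. by []. Qed.

Lemma Cc2_proj (theta : R) (g : R * R -> R) (k : R -> R) : Cc2 g -> continuous k ->
  Cc2 (fun p => g p * k (p.1 * cos theta + p.2 * sin theta)).
Proof.
move=> Cg ck; apply: Cc2M => // p.
apply: (@continuous_comp _ _ _ (fun p => p.1 * cos theta + p.2 * sin theta) k); last exact: ck.
by apply: cvgD; (apply: cvgM; last exact: cvg_cst); [exact: cvg_fst|exact: cvg_snd].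
Qed.

(** The weight depends only on t, the first coordinate before rotation, so it enters the line
    integral; Fubini and the invariance under rotation do the rest. With [k] a cosine or a sine,
    this is the Fourier slice theorem. *)
Lemma radon_proj (theta : R) g (k : R -> R) : Cc2 g -> continuous k -> - pi < theta < pi ->
  mu.-integrable setT (EFin \o (fun t => radon g (theta, t) * k t)) /\
  \int[mu]_t (radon g (theta, t) * k t) =
  \int[leb2]_p (g p * k (p.1 * cos theta + p.2 * sin theta)).
Proof.
move=> Cg ck th; have Ch := Cc2_proj theta Cg ck.
have Cr := Cc2_rotate theta Ch; have ir := Cc2_integrable Cr.
have E t : radon g (theta, t) * k t =
    \int[mu]_s ((fun p => g p * k (p.1 * cos theta + p.2 * sin theta)) \o rotate theta) (t, s).
  rewrite radonE -RintegralZr//; last exact: (Cc1_integrable (Cc2_slice2 t (Cc2_rotate theta Cg))).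
  apply: eq_Rintegral => s _ /=; congr (_ * k _).
  by have [] := rotateK theta (t, s).
rewrite -(Rintegral_rotate Ch th) (Rintegral_fubini ir); under eq_Rintegral do rewrite E.
split=> //; have := Rintegrable_fubini ir; congr (mu.-integrable _ _).
by apply/funext => t /=; rewrite E.
Qed.

(** The angle theta + pi with offset - t describes the same line run backwards, hence the
    substitution of - s for s. *)
Lemma radon_glide g : Cc2 g -> glide_inv 1 (radon g).
Proof.
move=> Cg [x t]; rewrite mul1r !radonE /=.
have i1 := Cc1_integrable (Cc2_slice2 t (Cc2_rotate x Cg)).
rewrite [RHS](@Rintegral_affine _ (-1) 0 _ _ i1) ?oppr_eq0 ?oner_eq0// normrN normr1 mul1r.
apply: eq_Rintegral => s _; rewrite /rotate /= cosDpi sinDpi; congr (g (_, _)); ring.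
Qed.

Lemma radon_support g (r : R) (p : R * R) : (forall p, r < p.1 ^+ 2 + p.2 ^+ 2 -> g p = 0) ->
  r < p.2 ^+ 2 -> radon g p = 0.
Proof.
move=> g0 rp; apply: Rintegral_eq0 => s _; apply: g0.
have := rotate_sqrD p.1 (p.2, s); rewrite /rotate /= => ->.
by rewrite (lt_le_trans rp)// lerDl sqr_ge0.
Qed.

End radon_transform.

(** * Removal of the modulo operation *)

Section modulo_lift.
Context {R : realType}.
Local Notation mR := (measurableTypeR R).
Local Notation mu := (@lebesgue_measure R).
Implicit Types (f g F : R * R -> R) (p : R * R).

Lemma periodic_int (h : R -> R) (T : R) (k : int) (x : R) : periodic h T ->
  h (x - T * k%:~R) = h x.
Proof.
move=> hT; have H n y : h (y + T * n%:R) = h y by rewrite mulr_natr periodicn.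
case: k => n; first by rewrite -pmulrn -[in RHS](subrK (T * n%:R) x) H.
by rewrite NegzE mulrNz mulrN opprK -pmulrn H.
Qed.

Lemma cos_sin_centered_mod (lambda r : R) : lambda != 0 ->
  cos (pi / lambda * centered_mod lambda r) = cos (pi / lambda * r) /\
  sin (pi / lambda * centered_mod lambda r) = sin (pi / lambda * r).
Proof.
move=> l0; rewrite /centered_mod; set k := Num.floor _.
have -> : pi / lambda * (r - 2 * lambda * k%:~R) = pi / lambda * r - pi *+ 2 * k%:~R.
  by rewrite mulrBr; congr (_ - _); rewrite -mulr_natr; field.
by rewrite !periodic_int//; [exact: sinD2pi|exact: cosD2pi].
Qed.

Lemma is_derive_comp_dir (phi : R -> R) F p e (c d : R) : e = e_theta \/ e = e_t ->
  is_derive (F p) 1 phi c -> is_derive p e F d -> is_derive p e (fun q => phi (F q)) (c * d).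
Proof.
case: p => x t; move=> [] -> dphi.
  by move=> /is_derive_e_theta dF; apply/is_derive_e_theta; exact: is_derive1_comp dphi dF.
by move=> /is_derive_e_t dF; apply/is_derive_e_t; exact: is_derive1_comp dphi dF.
Qed.

Lemma derive2_comp (phi phi1 phi2 : R -> R) F p e : e = e_theta \/ e = e_t ->
  (forall x : R, is_derive x 1 phi (phi1 x)) -> (forall x : R, is_derive x 1 phi1 (phi2 x)) ->
  (\forall q \near p, derivable F q e) -> derivable (fun q => 'D_e F q) p e ->
  'D_e (fun q => 'D_e (fun r => phi (F r)) q) p =
  phi1 (F p) * 'D_e (fun q => 'D_e F q) p + phi2 (F p) * 'D_e F p ^+ 2.
Proof.
move=> eE d1 d2 dF ddF.
(* The first derivative is differentiated again, so its formula is needed in a whole neighbourhood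
   of [p]. *)
have N : {near p, (fun q => 'D_e (fun r => phi (F r)) q) =1 (fun q => phi1 (F q) * 'D_e F q)}.
  apply: filterS dF => q dq; have h := is_derive_comp_dir eE (d1 (F q)) (derivableP dq).
  exact: (@derive_val _ _ _ _ _ _ _ h).
rewrite (near_eq_derive _ N).
have h := is_deriveM (is_derive_comp_dir eE (d2 (F p)) (derivableP (nbhs_singleton dF)))
  (derivableP ddF).
rewrite (@derive_val _ _ _ _ _ _ _ h).
rewrite -[LHS]/(phi1 (F p) * 'D_e (fun q => 'D_e F q) p + 'D_e F p * (phi2 (F p) * 'D_e F p)).
by rewrite expr2; congr (_ + _); ring.
Qed.

Lemma open_Omega : open (Omega : set (R * R)).
Proof.
have o1 : open ((fst : R * R -> R) @^-1` `]- pi, pi[).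
  by apply: open_comp; [move=> p _; exact: cvg_fst|exact: interval_open].
have o2 : open ((snd : R * R -> R) @^-1` `]- 1, 1[).
  by apply: open_comp; [move=> p _; exact: cvg_snd|exact: interval_open].
exact: openI o1 o2.
Qed.

(** What the chain rule leaves, with [C] and [S] the cosine and the sine at the point, [a] and [b]
    the first derivatives, [aa] and [bb] the second ones. The terms in the squared gradient cancel,
    and the others carry C^2 + S^2. *)
Let lift_identity (C S a b aa bb c : R) :
  C * (c * C * aa + c * (- c * S) * a ^+ 2 + (c * C * bb + c * (- c * S) * b ^+ 2)) -
  S * (- c * S * aa + - c * (c * C) * a ^+ 2 + (- c * S * bb + - c * (c * C) * b ^+ 2)) =
  c * (aa + bb) * (C ^+ 2 + S ^+ 2).
Proof. ring. Qed.

Lemma laplacian_sin_cos F p (c : R) : Ck 2 Omega F -> Omega p ->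
  cos (c * F p) * laplacian (fun q => sin (c * F q)) p -
  sin (c * F p) * laplacian (fun q => cos (c * F q)) p = c * laplacian F p.
Proof.
move=> CF Op.
have nO : \forall q \near p, Omega q by apply: open_nbhs_nbhs; split => //; exact: open_Omega.
have n1 : \forall q \near p, derivable F q e_theta.
  by apply: filterS nO => q Oq; have [_ /(_ isT q Oq)[d _]] := CF [::] isT; exact: d.
have n2 : \forall q \near p, derivable F q e_t.
  by apply: filterS nO => q Oq; have [_ /(_ isT q Oq)[_ d]] := CF [::] isT; exact: d.
have [_ /(_ isT p Op)[m1 _]] := CF [:: false] isT.
have [_ /(_ isT p Op)[_ m2]] := CF [:: true] isT.
have s1 (x : R) := is_derive_sin_scale c x; have c1 (x : R) := is_derive_cos_scale c x.
have s2 (x : R) : is_derive x 1 (fun x => c * cos (c * x)) (c * (- c * sin (c * x))).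
  exact: is_deriveZ.
have c2 (x : R) : is_derive x 1 (fun x => - c * sin (c * x)) (- c * (c * cos (c * x))).
  exact: is_deriveZ.
have S1 := derive2_comp (or_introl erefl) s1 s2 n1 m1.
have S2 := derive2_comp (or_intror erefl) s1 s2 n2 m2.
have C1 := derive2_comp (or_introl erefl) c1 c2 n1 m1.
have C2 := derive2_comp (or_intror erefl) c1 c2 n2 m2.
rewrite /laplacian /d_theta /d_t S1 S2 C1 C2.
rewrite -[RHS]mulr1 -(cos2Dsin2 (c * F p)).
exact: lift_identity.
Qed.

Lemma radon_lapE (lambda : R) f p : lambda != 0 -> Ck 2 Omega (radon f) -> Omega p ->
  radon_lap lambda f p = laplacian (radon f) p.
Proof.
move=> l0 CF Op; rewrite /radon_lap /patch mem_set//=.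
have Ec q : cos (pi / lambda * modulo_radon lambda f q) = cos (pi / lambda * radon f q).
  by have [] := cos_sin_centered_mod (radon f q) l0.
have Es q : sin (pi / lambda * modulo_radon lambda f q) = sin (pi / lambda * radon f q).
  by have [] := cos_sin_centered_mod (radon f q) l0.
rewrite Ec Es (_ : (fun q => sin _) = (fun q => sin (pi / lambda * radon f q))); last exact/funext.
rewrite (_ : (fun q => cos _) = (fun q => cos (pi / lambda * radon f q))); last exact/funext.
rewrite laplacian_sin_cos// mulrA; move: (lt0r_neq0 (@pi_gt0 R)); move: (@pi R) => P P0.
by rewrite (_ : lambda / P * (P / lambda) = 1) ?mul1r//; field; rewrite l0.
Qed.

End modulo_lift.

Section radon_solution.
Context {R : realType}.
Local Notation mR := (measurableTypeR R).
Local Notation mu := (@lebesgue_measure R).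
Implicit Types (f g u F : R * R -> R) (p : R * R).
Let mT2 : measurable (T2 : set (mR * mR)) := measurable_T2.

Lemma L2per_patch_Omega g : continuous g -> L2per (patch (cst 0) Omega g).
Proof.
move=> cg; have mg := continuous_measurable_fun2 cg.
have mO : measurable (Omega : set (mR * mR)) := open_measurable2 open_Omega.
have m : measurable_fun (T2 : set (mR * mR)) (patch (cst 0) Omega g).
  by apply: measurable_funTS; apply/(measurable_restrictT _ mO); exact: measurable_funTS.
split => //; apply: (Rintegrable_le mT2 (g := fun p => g p ^+ 2)).
- exact: measurable_funX.
- exact: (continuous_L2per cg).2.
- move=> p _; rewrite /patch; case: ifP => _.
    by rewrite normrX real_normK ?num_real.
  by rewrite /= expr0n normr0 sqr_ge0.
Qed.

Lemma radon_weak_solution (lambda r : R) f : lambda != 0 -> Cc2 f -> 0 <= r < 1 ->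
  (forall p, r < p.1 ^+ 2 + p.2 ^+ 2 -> f p = 0) -> Ck 2 Omega (radon f) ->
  [/\ continuous (radon f), forall p, Num.sqrt r < `|p.2| -> radon f p = 0 &
      weak_solution (radon_lap lambda f) (radon f)].
Proof.
move=> l0 Cf /andP[r0 r1] fr CF.
have s1 : Num.sqrt r < 1 by rewrite -sqrtr1 ltr_sqrt.
have F0 p : Num.sqrt r < `|p.2| -> radon f p = 0.
  move=> rp; apply: (radon_support fr).
  by rewrite -[p.2 ^+ 2]real_normK ?num_real// -(sqr_sqrtr r0) ltrXn2r ?nnegrE// sqrtr_ge0.
have [cF cl H] := glide_weak_solution s1 (sqrtr_ge0 r) CF (radon_glide Cf) F0.
split=> //; apply: H.
  have -> : radon_lap lambda f = patch (cst 0) Omega (laplacian (radon f)).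
    apply/funext => p; rewrite [RHS]/patch; case: ifPn => [/set_mem|pO].
      exact: radon_lapE.
    by rewrite /radon_lap /patch (negbTE pO).
  exact: L2per_patch_Omega.
apply: filterS ae_Omega => p Tp pT; exact: (radon_lapE l0 CF (Tp pT)).
Qed.

(** A neighbourhood contains a product of two balls, which has positive measure and thus lies in no
    null set. *)
Lemma ae_nbhs (P : R * R -> Prop) p (U : set (R * R)) : nbhs p U ->
  {ae leb2, forall q : mR * mR, P q} -> exists2 q, U q & P q.
Proof.
move=> [[A B] /= [nA nB] AB] aeP; apply: contrapT => H.
have sub : A `*` B `<=` ~` [set q | P q] by move=> q /AB Uq Pq; apply: H; exists q.
have {nA} /nbhs_ballP[a /= a0 Aa] := nA; have {nB} /nbhs_ballP[b /= b0 Bb] := nB.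
have mX : measurable (ball p.1 a `*` ball p.2 b : set (mR * mR)).
  by apply: measurableX; exact: measurable_ball.
have [N [mN N0 PN]] := aeP.
have XN : ball p.1 a `*` ball p.2 b `<=` N.
  by move=> q [/Aa qA /Bb qB]; apply: PN; exact: sub.
have : ((mu \x mu)%E (ball p.1 a `*` ball p.2 b : set (mR * mR)) <= 0)%E.
  by rewrite -[X in (_ <= X)%E]N0; apply: le_measure; rewrite ?inE.
rewrite product_measure1E; [|exact: measurable_ball..].
have m1 := lebesgue_measure_ball p.1 (ltW a0); have m2 := lebesgue_measure_ball p.2 (ltW b0).
rewrite [X in (X * _)%E]m1 [X in (_ * X)%E]m2 -EFinM lee_fin leNgt => /negP; apply.
by apply: mulr_gt0; rewrite pmulrn_lgt0.
Qed.

(** Equality almost everywhere in the plane says nothing on a single line of constant theta, which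
    is where [fourier1] integrates. Continuity turns it into equality at every point of [Omega]. *)
Lemma continuous_torus_ae_eq u F : continuous_torus u -> continuous F ->
  {ae leb2, forall p : mR * mR, T2 p -> u p = F p} -> forall p, Omega p -> u p = F p.
Proof.
move=> [cu _ _] cF uF p Op.
have cu' : {for p, continuous u}.
  have := continuous_subspaceW Omega_T2 cu.
  by rewrite (continuous_open_subspace _ open_Omega); apply; exact/mem_set.
apply/eqP/negPn/negP => n.
have nO : nbhs p Omega by apply: open_nbhs_nbhs; split => //; exact: open_Omega.
have nu : \forall q \near p, u q - F q != 0.
  apply: (@cvgr_neq0 _ _ _ (nbhs p) _ (fun q => u q - F q) (u p - F p)).
    by apply: cvgB; [exact: cu'|exact: cF].
  by rewrite subr_eq0.
have [q [Oq nq] h] := ae_nbhs (filterI nO nu) uF.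
by move: nq; rewrite h ?subrr ?eqxx//; exact: Omega_T2.
Qed.

Lemma zero_ext_radon u F (rho : R) : rho < 1 -> (forall p, rho < `|p.2| -> F p = 0) ->
  (forall p, Omega p -> u p = F p) ->
  forall theta t : R, - pi < theta < pi -> zero_ext u (theta, t) = F (theta, t).
Proof.
move=> rho1 F0 uF x t xpi; rewrite /zero_ext /patch; case: ifPn => [/set_mem/uF//|].
rewrite notin_setE => nO; rewrite [RHS]F0//=; rewrite ltNge; apply/negP => tr; apply: nO.
by split; rewrite /= in_itv//= -ltr_norml (le_lt_trans tr).
Qed.

End radon_solution.

(** * Polar coordinates *)

Section polar_coordinates.
Context {R : realType}.
Local Notation mR := (measurableTypeR R).
Local Notation mu := (@lebesgue_measure R).
Local Notation W := (`]- (pi / 2), (pi / 2)[%classic : set R).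
Implicit Types (h : R * R -> R) (x t : R).

Lemma cos_gt0_W x : W x -> 0 < cos x.
Proof. by rewrite /= in_itv/=; exact: cos_gt0_pihalf. Qed.

Lemma continuous_cosV2 x : cos x != 0 -> {for x, continuous (fun x : R => (cos x)^-2)}.
Proof.
move=> c0; apply: cvgV; first by rewrite expf_neq0.
have -> : (fun x : R => cos x ^+ 2) = (fun x => cos x * cos x) by apply/funext => y; rewrite expr2.
by rewrite expr2; apply: cvgM; exact: continuous_cos.
Qed.

Lemma continuous_derive1_tan x : cos x != 0 -> {for x, continuous (derive1 (@tan R))}.
Proof.
move=> c0; have n0 : \forall y \near x, cos y != 0.
  by apply: (@cvgr_neq0 _ _ _ (nbhs x) _ cos (cos x)) => //; exact: continuous_cos.
have E (y : R) : cos y != 0 -> derive1 (@tan R) y = (cos y)^-2.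
  by move=> cy; rewrite derive1E; have d := is_derive_tan cy; rewrite derive_val.
rewrite /prop_for /continuous_at E//; apply: cvg_trans (continuous_cosV2 c0).
by apply: near_eq_cvg; apply: filterS n0 => y /E.
Qed.

Lemma integral_tan_itv (G : R -> R) (a : R) : continuous G -> 0 <= a -> a < pi / 2 ->
  (\int[mu]_(t in `[(- tan a)%R, tan a]) (G t)%:E =
   \int[mu]_(x in `[(- a)%R, a]) (G (tan x) * (cos x)^-2)%R%:E)%E.
Proof.
move=> cG a0 aW.
have inW x : x \in `[- a, a] -> x \in `]- (pi / 2), (pi / 2)[.
  by rewrite !in_itv/= => /andP[x1 x2]; apply/andP; split; lra.
have c0 x : x \in `[- a, a] -> cos x != 0.
  by move=> /inW xW; rewrite gt_eqF// cos_gt0_W.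
have ca : cos a != 0 by apply: c0; rewrite in_itv/= lexx andbT; lra.
have cNa : cos (- a) != 0 by apply: c0; rewrite in_itv/= lexx /=; lra.
rewrite -tanN (integration_by_substitution_increasing (F := tan))//; first last.
- exact: continuous_subspaceT.
- split=> [x xa||].
  + by apply: derivable_tan; apply: c0; exact: subset_itv_oo_cc.
  + by apply: cvg_at_right_filter; exact: continuous_tan.
  + by apply: cvg_at_left_filter; exact: continuous_tan.
- apply: (cvgP (derive1 (@tan R) a)); apply: cvg_at_left_filter; exact: continuous_derive1_tan.
- apply: (cvgP (derive1 (@tan R) (- a))); apply: cvg_at_right_filter; exact: continuous_derive1_tan.
- by move=> x xa; apply/continuous_derive1_tan/c0; exact: subset_itv_oo_cc.
- by move=> x y /inW xW /inW yW xy; rewrite ltr_tan.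
- lra.
apply: eq_integral => x /set_mem /c0 cx /=; congr (_ * _)%:E.
by rewrite derive1E; have d := is_derive_tan cx; rewrite derive_val.
Qed.

(** The substitution holds on compact intervals; both integrals are then exhausted, by [- n, n] on
    one side and by its image under atan on the other. *)
Lemma integral_tan (G : R -> R) : continuous G -> (forall t, 0 <= G t) ->
  (\int[mu]_t (G t)%:E = \int[mu]_(x in W) (G (tan x) * (cos x)^-2)%R%:E)%E.
Proof.
move=> cG G0.
pose A (n : nat) : set mR := `[- n%:R, n%:R]%classic.
pose B (n : nat) : set mR := `[- atan n%:R, atan n%:R]%classic.
have AU : \bigcup_n A n = setT.
  rewrite -subTset => x _; exists (Num.bound `|x|) => //=.
  by rewrite /A /= in_itv/= -ler_norml ltW//; exact: unstable.ltr_bound.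
have BU : \bigcup_n B n = W.
  apply/seteqP; split => x.
    move=> [n _]; rewrite /B /= !in_itv/= => /andP[x1 x2].
    have := atan_ltpi2 (n%:R : R) => ?; apply/andP; split; lra.
  move=> xW; exists (Num.bound `|tan x|) => //; rewrite /B /= in_itv/= -atanN.
  have /ltW := unstable.ltr_bound `|tan x|; rewrite ler_norml => /andP[t1 t2].
  by rewrite -[X in _ <= X <= _](tanK xW) !le_atan.
have mcos : measurable_fun W (fun x => (G (tan x) * (cos x)^-2)%:E).
  apply/measurable_EFinP; apply: open_continuous_measurable_fun; first exact: interval_open.
  move=> x /set_mem /cos_gt0_W cx; apply: cvgM; last by apply: continuous_cosV2; rewrite gt_eqF.
  by apply: continuous_comp; [apply: continuous_tan; rewrite gt_eqF|exact: cG].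
have HA : (\int[mu]_(t in A n) (G t)%:E)%E @[n --> \oo] --> (\int[mu]_t (G t)%:E)%E.
  rewrite -AU; apply: ge0_nondecreasing_set_cvg_integral.
  - apply/nondecreasing_seqP => n; rewrite subsetEset => x; rewrite /A /= !in_itv/= -!ler_norml.
    by move=> /le_trans; apply; rewrite ler_nat.
  - by move=> n; exact: measurable_itv.
  - move=> n; apply/measurable_EFinP; apply: measurable_funTS; exact: continuous_measurable_fun.
  - by move=> n x _; rewrite lee_fin.
have HB : (\int[mu]_(t in B n) (G (tan t) * (cos t)^-2)%R%:E)%E @[n --> \oo] -->
    (\int[mu]_(x in W) (G (tan x) * (cos x)^-2)%R%:E)%E.
  rewrite -BU; apply: ge0_nondecreasing_set_cvg_integral.
  - apply/nondecreasing_seqP => n; rewrite subsetEset => x; rewrite /B /= !in_itv/= -!ler_norml.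
    by move=> /le_trans; apply; rewrite le_atan// ler_nat.
  - by move=> n; exact: measurable_itv.
  - move=> n; apply: measurable_funS mcos; first exact: measurable_itv.
    by rewrite -BU; exact: bigcup_sup.
  - by move=> n x _; rewrite lee_fin mulr_ge0// invr_ge0 sqr_ge0.
have E : (fun n => \int[mu]_(t in A n) (G t)%:E)%E =
    (fun n => \int[mu]_(t in B n) (G (tan t) * (cos t)^-2)%R%:E)%E.
  apply/funext => n; rewrite /A /B -integral_tan_itv//; last exact: atan_ltpi2.
    by rewrite atanK.
  by rewrite -atan0 le_atan.
by move: HA; rewrite E => HA; exact: (cvg_unique _ HA HB).
Qed.

(** The radius [p.2] is signed, so the Jacobian is its absolute value: exactly the ramp |S| of the
    filter. *)
Definition polar h (p : R * R) : R := `|p.2| * h (p.2 * cos p.1, p.2 * sin p.1).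

Lemma continuous_polar h : continuous h -> continuous (polar h).
Proof.
move=> ch p; apply: cvgM; first by apply: cvg_norm; exact: cvg_snd.
apply: (@continuous_comp _ _ _ (fun p : R * R => (p.2 * cos p.1, p.2 * sin p.1)) h); last exact: ch.
apply: (@continuous_pair _ _ _ (fun p : R * R => p.2 * cos p.1) (fun p : R * R => p.2 * sin p.1)).
  apply: cvgM; first exact: cvg_snd.
  by apply: (@continuous_comp _ _ _ fst cos); [exact: cvg_fst|exact: continuous_cos].
apply: cvgM; first exact: cvg_snd.
by apply: (@continuous_comp _ _ _ fst sin); [exact: cvg_fst|exact: continuous_sin].
Qed.

(** Angles in an open half circle with a signed radius cover the plane once, up to a null set. For
    fixed x != 0 the substitution y = x tan theta introduces the angle; Tonelli exchanges the order,
    and x becomes the radius. *)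
Lemma integral_polar_halfplane h : continuous h -> (forall p, 0 <= h p) ->
  (\int[leb2]_p (h p)%:E = \int[mu]_(x in W) \int[mu]_s (polar h (x, s))%:E)%E.
Proof.
move=> ch h0.
pose T : mR -> mR := (@tan R) \_ W; pose C : mR -> mR := (fun x : R => (cos x)^-2) \_ W.
have mW : measurable (W : set mR) := measurable_itv _.
have mT : measurable_fun setT T.
  apply/(measurable_restrictT _ mW); apply: open_continuous_measurable_fun; first exact: interval_open.
  by move=> x /set_mem /cos_gt0_W cx; apply: continuous_tan; rewrite gt_eqF.
have mC : measurable_fun setT C.
  apply/(measurable_restrictT _ mW); apply: open_continuous_measurable_fun; first exact: interval_open.
  by move=> x /set_mem /cos_gt0_W cx; apply: continuous_cosV2; rewrite gt_eqF.
have C0 x : 0 <= C x by rewrite /C /patch; case: ifP => // _; rewrite invr_ge0 sqr_ge0.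
pose q (p : mR * mR) : R := `|p.1| * h (p.1, p.1 * T p.2) * C p.2.
have q0 p : (0 <= (q p)%:E)%E by rewrite lee_fin !mulr_ge0.
have mT2 : measurable_fun (setT : set (mR * mR)) (fun p => T p.2) by exact: measurableT_comp.
have mq : measurable_fun setT (EFin \o q).
  apply/measurable_EFinP; apply: measurable_funM; last exact: measurableT_comp.
  apply: measurable_funM; first exact: measurableT_comp.
  apply: (measurableT_comp (continuous_measurable_fun2 ch)).
  by apply: measurable_fun_pair => //; exact: measurable_funM.
have mh : measurable_fun setT (EFin \o (h : mR * mR -> mR)).
  by apply/measurable_EFinP; exact: continuous_measurable_fun2.
have he0 (p : mR * mR) : (0 <= (h p)%:E)%E by rewrite lee_fin.
have step2 x : x != 0 -> (\int[mu]_y (h (x, y))%:E = \int[mu]_t (q (x, t))%:E)%E.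
  move=> x0; have cs := continuous_slice2 (x := x) ch.
  have cG : continuous (fun t => h (x, x * t + 0)).
    move=> t; apply: (@continuous_comp _ _ _ (fun t => x * t + 0) (fun y => h (x, y))); last exact: cs.
    by apply: cvgD; [apply: cvgM; [exact: cvg_cst|exact: cvg_id]|exact: cvg_cst].
  rewrite (ge0_integral_affine 0 x0)//; last first.
    by apply/measurable_EFinP; exact: continuous_measurable_fun.
  rewrite (integral_tan cG)// -ge0_integralZl_EFin//; first last.
  - apply/measurable_EFinP; apply: open_continuous_measurable_fun; first exact: interval_open.
    move=> t /set_mem /cos_gt0_W cx; apply: cvgM; last by apply: continuous_cosV2; rewrite gt_eqF.
    apply: (@continuous_comp _ _ _ (@tan R) (fun t => h (x, x * t + 0))); last exact: cG.
    by apply: continuous_tan; rewrite gt_eqF.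
  - by move=> t _; rewrite lee_fin mulr_ge0// invr_ge0 sqr_ge0.
  rewrite integral_mkcond; apply: eq_integral => t _; rewrite /q /T /C /patch /=.
  by case: ifP => // _; rewrite ?mulr0// -EFinM addr0 mulrA.
have aeE : {ae mu, forall x : mR, setT x ->
    (\int[mu]_y (h (x, y))%:E = \int[mu]_t (q (x, t))%:E)%E}.
  have [N [mN N0 PN]] := ae_neq (0 : R); exists N; split => // x nP; apply: PN => /= x0.
  by apply: nP => _; exact: step2.
rewrite (fubini_tonelli1 _ mh he0) /fubini_F.
transitivity (\int[mu]_x \int[mu]_t (q (x, t))%:E)%E.
  apply: ge0_ae_eq_integral => //.
  - exact: (measurable_fun_fubini_tonelli_F _ mh he0).
  - exact: (measurable_fun_fubini_tonelli_F _ mq q0).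
  - by move=> x _; apply: integral_ge0 => y _; exact: he0.
  - by move=> x _; apply: integral_ge0 => y _; exact: q0.
rewrite (fubini_tonelli _ mq q0) [RHS]integral_mkcond.
apply: eq_integral => t _; rewrite [RHS]/patch; case: ifPn => [/set_mem tW|tW]; last first.
  transitivity (\int[mu]_(x in setT) (0 : \bar R))%E; last by rewrite integral0.
  by apply: eq_integral => x _; rewrite /= /q /C /patch /= (negbTE tW) mulr0.
have ct := cos_gt0_W tW; have ct0 : cos t != 0 by rewrite gt_eqF.
have mt := measurable_fun_pair1 t mq.
(* The substitution x = s cos t at fixed angle; the factors |s cos t|, (cos t)^-2 and cos t multiply
   to |s|. *)
rewrite (ge0_integral_affine 0 ct0 mt); last by move=> x; exact: q0.
have mts : measurable_fun (setT : set mR) (fun x => (EFin \o q) (cos t * x + 0, t)).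
  exact: measurableT_comp mt (measurable_affine _ _).
have q0s (x : mR) : setT x -> (0 <= (EFin \o q) ((cos t * x + 0)%R, t))%E by move=> _; exact: q0.
rewrite -(ge0_integralZl_EFin _ measurableT q0s mts)//.
apply: eq_integral => s _; rewrite -EFinM /q /polar /T /C /patch (mem_set tW) addr0 /=.
rewrite normrM (_ : cos t * s * tan t = s * sin t); last by rewrite /tan; field.
by rewrite [cos t * s]mulrC gtr0_norm//; congr (_%:E); field.
Qed.

End polar_coordinates.

Section polar_torus.
Context {R : realType}.
Local Notation mR := (measurableTypeR R).
Local Notation mu := (@lebesgue_measure R).
Implicit Types (h : R * R -> R) (Phi : R -> \bar R).
Local Open Scope ereal_scope.

Lemma ge0_integral_itv_split Phi (a b c : R) : measurable_fun (setT : set mR) Phi ->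
  (forall x, 0 <= Phi x) -> (a <= b)%R -> (b <= c)%R ->
  \int[mu]_(x in `[a, c]) Phi x = \int[mu]_(x in `[a, b]) Phi x + \int[mu]_(x in `[b, c]) Phi x.
Proof.
move=> mP P0 ab bc.
have -> : `[a, c]%classic = `[a, b]%classic `|` `]b, c]%classic.
  by rewrite (@itv_bndbnd_setU _ _ _ (BRight b))// bnd_simp.
rewrite ge0_integral_setU//.
- by congr (_ + _); rewrite !integral_itv_bndoo//; exact: measurable_funTS.
- exact: measurable_funTS.
- apply/disj_setPS => x [] /=; rewrite !in_itv/= => /andP[_ xb] /andP[bx _].
  by move: (lt_le_trans bx xb); rewrite ltxx.
Qed.

Lemma ge0_integral_itv_shift Phi (s a b c d : R) : measurable_fun (setT : set mR) Phi ->
  (forall x, 0 <= Phi x) -> c = (a + s)%R -> d = (b + s)%R ->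
  \int[mu]_(x in `[c, d]) Phi x = \int[mu]_(x in `[a, b]) Phi (x + s)%R.
Proof.
move=> mP P0 -> ->; rewrite [LHS]integral_mkcond [RHS]integral_mkcond.
rewrite (@ge0_integral_affine _ 1%R s)//; first last.
- by move=> x; rewrite /patch; case: ifP.
- by apply/(measurable_restrictT _ (measurable_itv _)); exact: measurable_funTS.
rewrite normr1 mul1e; apply: eq_integral => x _; rewrite /patch mul1r.
have -> // : (x + s \in `[(a + s)%R, (b + s)%R]%classic)%R = (x \in `[a, b]%classic).
by apply/idP/idP => /set_mem H; apply/mem_set; move: H; rewrite /= !in_itv/= !lerD2r.
Qed.

Lemma ge0_integral_half_period Phi : measurable_fun (setT : set mR) Phi ->
  (forall x, 0 <= Phi x) -> (forall x, Phi (x + pi)%R = Phi x) ->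
  \int[mu]_(x in `[(- pi)%R, pi]) Phi x = 2%:E * \int[mu]_(x in `](- (pi / 2))%R, (pi / 2)%R[) Phi x.
Proof.
move=> mP P0 Pp; have pi0 := @pi_gt0 R.
have mPt A : measurable_fun (A : set mR) Phi by exact: measurable_funTS.
rewrite -(integral_itv_bndoo true false (mPt _)).
rewrite (ge0_integral_itv_split mP P0 (b := 0%R)); [|lra|lra].
rewrite (ge0_integral_itv_split mP P0 (a := (- pi)%R) (b := (- (pi / 2))%R)); [|lra|lra].
rewrite (ge0_integral_itv_split mP P0 (c := pi) (b := (pi / 2)%R)); [|lra|lra].
rewrite (ge0_integral_itv_split mP P0 (a := (- (pi / 2))%R) (b := 0%R)); [|lra|lra].
have -> : \int[mu]_(x in `[(pi / 2)%R, pi]) Phi x = \int[mu]_(x in `[(- (pi / 2))%R, 0%R]) Phi x.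
  rewrite (@ge0_integral_itv_shift _ pi (- (pi / 2)) 0%R _ _ mP P0); [|lra|lra].
  by apply: eq_integral => x _; exact: Pp.
have -> : \int[mu]_(x in `[(- pi)%R, (- (pi / 2))%R]) Phi x = \int[mu]_(x in `[0%R, (pi / 2)%R]) Phi x.
  rewrite [RHS](@ge0_integral_itv_shift _ pi (- pi) (- (pi / 2)) _ _ mP P0); [|lra|lra].
  by apply: eq_integral => x _; rewrite Pp.
set A := \int[mu]_(x in `[0%R, _]) _; set B := \int[mu]_(x in `[_, 0%R]) _.
by rewrite mule_natl mule2n addeC -addeA.
Qed.

(** The pairs (theta + pi, s) and (theta, - s) are the same point, so the radial integral has period
    pi in the angle, and the full circle counts the plane twice. *)
Lemma integral_polar h : continuous h -> (forall p, (0 <= h p)%R) ->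
  \int[(mu \x mu)%E]_(p in `[(- pi)%R, pi] `*` setT) (polar h p)%:E =
  2%:E * \int[(mu \x mu)%E]_p (h p)%:E.
Proof.
move=> ch h0; rewrite (integral_polar_halfplane ch h0).
have cp := continuous_polar ch.
have p0 p : (0 <= polar h p)%R by rewrite mulr_ge0.
have mp : measurable_fun (setT : set (mR * mR)) (fun p => (polar h p)%:E).
  by apply/measurable_EFinP; exact: continuous_measurable_fun2.
have pe0 (p : mR * mR) : 0 <= (polar h p)%:E by rewrite lee_fin.
have mI : measurable (`[(- pi)%R, pi]%classic : set mR) := measurable_itv _.
have mX : measurable (`[(- pi)%R, pi] `*` setT : set (mR * mR)) by exact: measurableX.
pose Phi (x : mR) := \int[mu]_s (polar h (x, s))%:E.
have mP : measurable_fun (setT : set mR) Phi := measurable_fun_fubini_tonelli_F _ mp pe0.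
have P0 x : 0 <= Phi x by apply: integral_ge0 => s _; exact: pe0.
rewrite -(ge0_integral_half_period mP P0); last first.
  move=> x; rewrite /Phi [RHS](@ge0_integral_affine _ (-1) 0)//; last first.
    exact: measurable_fun_pair2 x mp.
  rewrite normrN normr1 mul1e; apply: eq_integral => s _; congr (_%:E).
  by rewrite /polar /= cosDpi sinDpi mulN1r addr0 normrN !mulNr !mulrN.
rewrite integral_mkcond fubini_tonelli1; first last.
- by move=> p; rewrite /patch; case: ifP.
- by apply/(measurable_restrictT _ mX); exact: measurable_funTS.
rewrite [RHS]integral_mkcond; apply: eq_integral => x _; rewrite /fubini_F [RHS]/patch.
case: ifPn => xI.
  by apply: eq_integral => s _; rewrite /patch in_setX xI in_setT.
transitivity (\int[mu]_(x in setT) (0 : \bar R)); last by rewrite integral0.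
by apply: eq_integral => s _; rewrite /patch in_setX (negbTE xI).
Qed.

Local Close Scope ereal_scope.
Local Notation TR := (`[- pi, pi] `*` setT : set (mR * mR)).

Let mTR : measurable TR.
Proof. by apply: measurableX => //; exact: measurable_itv. Qed.

Lemma ge0_Rintegral_polar h : continuous h -> (forall p, 0 <= h p) ->
  leb2.-integrable (setT : set (mR * mR)) (EFin \o h) ->
  leb2.-integrable TR (EFin \o polar h) /\
  \int[leb2]_(p in TR) polar h p = 2 * \int[leb2]_p h p.
Proof.
move=> ch h0 hi; have E := integral_polar ch h0.
have p0 p : 0 <= polar h p by rewrite mulr_ge0.
have fi := integrable_fin_num measurableT hi.
have m : measurable_fun TR (EFin \o polar h).
  apply/measurable_EFinP; apply: measurable_funTS; apply: continuous_measurable_fun2.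
  exact: continuous_polar.
split; last by rewrite /Rintegral E fineM.
apply/integrableP; split=> //.
under eq_integral => p _ do rewrite /= ger0_norm//.
rewrite E; move: fi; rewrite ge0_fin_numE; last by apply: integral_ge0 => p _; rewrite lee_fin.
by move=> fi; rewrite lte_mul_pinfty// lee_fin.
Qed.

(** Written as the difference of |h| + h and |h|, the function splits into two that are nonnegative,
    continuous and integrable. *)
Lemma Rintegral_polar h : continuous h ->
  leb2.-integrable (setT : set (mR * mR)) (EFin \o h) ->
  leb2.-integrable TR (EFin \o polar h) /\
  \int[leb2]_(p in TR) polar h p = 2 * \int[leb2]_p h p.
Proof.
move=> ch hi.
have ca : continuous (fun p => `|h p|) by move=> p; apply: cvg_norm; exact: ch.
have cD : continuous (fun p => `|h p| + h p) by move=> p; apply: cvgD; [exact: ca|exact: ch].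
have ia : leb2.-integrable (setT : set (mR * mR)) (EFin \o (fun p => `|h p|)).
  exact: (integrable_norm hi).
have iD := RintegrableD measurableT ia hi.
have [i1 e1] := ge0_Rintegral_polar ca (fun p => normr_ge0 _) ia.
have D0 p : 0 <= `|h p| + h p by rewrite -lerBlDr sub0r -normrN ler_norm.
have [i2 e2] := ge0_Rintegral_polar cD D0 iD.
have E : polar h = (fun p => polar (fun p => `|h p| + h p) p - polar (fun p => `|h p|) p).
  by apply/funext => p; rewrite /polar mulrDr addrC addKr.
rewrite E; split; first exact: RintegrableB.
by rewrite RintegralB// e1 e2 RintegralD// mulrDr addrC addKr.
Qed.

Lemma polar_fubini h : continuous h ->
  leb2.-integrable (setT : set (mR * mR)) (EFin \o h) ->
  [/\ {ae mu, forall x : mR, - pi <= x <= pi ->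
         mu.-integrable setT (EFin \o (fun s => polar h (x, s)))},
      mu.-integrable `[- pi, pi] (EFin \o (fun x => \int[mu]_s polar h (x, s))) &
      \int[mu]_(x in `[- pi, pi]) \int[mu]_s polar h (x, s) = 2 * \int[leb2]_p h p].
Proof.
move=> ch hi; have [pI <-] := Rintegral_polar ch hi.
have mI : measurable (`[- pi, pi]%classic : set mR) := measurable_itv _.
have pi' := (Rintegrable_patch _ _ mTR).1 pI.
split.
- have := ae_integrable1 pi'; apply: filterS => x xi xpi; apply: eq_integrable xi => // s _ /=.
  by rewrite /patch mem_set.
- apply/(Rintegrable_patch _ _ mI); have := Rintegrable_fubini pi'; congr (mu.-integrable _ _).
  apply/funext => x /=; rewrite [in RHS]/patch; case: ifPn => xI.
    by congr (_%:E); apply: eq_Rintegral => s _; rewrite /patch in_setX xI in_setT.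
  by congr (_%:E); apply: Rintegral_eq0 => s _; rewrite /patch in_setX (negbTE xI).
- by rewrite Rintegral_fubiniX.
Qed.

End polar_torus.

(** * Fourier inversion *)

Section exponential_weight.
Context {R : realType}.
Local Notation mR := (measurableTypeR R).
Local Notation mu := (@lebesgue_measure R).
Implicit Types (a s x : R).

Definition expw (e s : R) : R := expR (- e * `|s|).

Lemma expw_gt0 e s : 0 < expw e s. Proof. exact: expR_gt0. Qed.

Lemma expw_le1 e s : 0 <= e -> expw e s <= 1.
Proof. by move=> e0; rewrite -expR0 ler_expR mulNr oppr_le0 mulr_ge0. Qed.

Lemma continuous_expw e : continuous (expw e).
Proof.
move=> s; apply: (@continuous_comp _ _ _ (fun s => - e * `|s|) (@expR R)); last exact: continuous_expR.
by apply: cvgM; [exact: cvg_cst|exact: norm_continuous].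
Qed.

Lemma continuous_scale (c : R) : continuous (fun s : R => c * s).
Proof. by move=> s; apply: cvgM; [exact: cvg_cst|exact: cvg_id]. Qed.

Lemma continuous_cos_scale (c : R) : continuous (fun s : R => cos (c * s)).
Proof.
move=> s; apply: (@continuous_comp _ _ _ (fun s => c * s) (@cos R)); last exact: continuous_cos.
exact: continuous_scale.
Qed.

Lemma continuous_sin_scale (c : R) : continuous (fun s : R => sin (c * s)).
Proof.
move=> s; apply: (@continuous_comp _ _ _ (fun s => c * s) (@sin R)); last exact: continuous_sin.
exact: continuous_scale.
Qed.

Section fourier.
Variables (e a : R).
Hypothesis e0 : 0 < e.
Local Notation D := (e ^+ 2 + a ^+ 2).

Let prim s := expR (- e * s) * (- e^-1 + (- e / D * cos (a * s) + a / D * sin (a * s))).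

Let D0 : D != 0.
Proof. by rewrite gt_eqF// ltr_wpDr ?sqr_ge0// exprn_gt0. Qed.

Let is_derive_prim s : is_derive s 1 prim (expR (- e * s) * (1 + cos (a * s))).
Proof.
have dE : is_derive s 1 (fun s => expR (- e * s)) (expR (- e * s) * - e).
  exact: (@is_derive1_comp _ _ _ _ _ _ (is_derive_expR _) (is_derive_scale _ _)).
have dK := is_deriveD (is_derive_cst (- e^-1) s 1) (is_deriveD
  (is_deriveZ (- e / D) (is_derive_cos_scale a s)) (is_deriveZ (a / D) (is_derive_sin_scale a s))).
have h : is_derive s 1 prim _ := is_deriveM dE dK.
apply: is_derive_eq h _.
rewrite -[LHS]/(expR (- e * s) * (0 + (- e / D * (- a * sin (a * s)) + a / D * (a * cos (a * s)))) +
  (- e^-1 + (- e / D * cos (a * s) + a / D * sin (a * s))) * (expR (- e * s) * - e)).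
move: (expR _) (cos _) (sin _) D0 (lt0r_neq0 e0) => X C S D0' e0'.
field.
by rewrite D0' e0'.
Qed.

Let prim_cvg : prim x @[x --> +oo] --> (0 : R).
Proof.
have E : expR (- e * x) @[x --> +oo] --> (0 : R).
  under eq_fun do rewrite mulNr.
  have h1 : e * x @[x --> +oo] --> +oo by apply: gt0_cvgMry => //; exact: cvg_id.
  exact: (@cvg_comp _ _ _ (fun x : R => e * x) (fun y : R => expR (- y)) _ _ _ h1 (@cvgr_expR R)).
pose M : R := e^-1 + (`|e / D| + `|a / D|).
have B s : `|prim s| <= expR (- e * s) * M.
  rewrite normrM ger0_norm ?expR_ge0// ler_wpM2l ?expR_ge0//.
  rewrite (le_trans (ler_normD _ _))// normrN gtr0_norm ?invr_gt0// lerD//.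
  rewrite (le_trans (ler_normD _ _))// lerD//.
    by have [+ _] := norm_cos_le (x := e / D) (a * s) (lexx _); rewrite !mulNr normrN.
  by have [_ ->] := norm_cos_le (x := a / D) (a * s) (lexx _).
have U : expR (- e * x) * M @[x --> +oo] --> (0 : R).
  by rewrite -(mul0r M); apply: cvgM => //; exact: cvg_cst.
apply/norm_cvg0P.
apply: (squeeze_cvgr _ (cvg_cst 0) U); near=> s.
by rewrite normr_ge0 B.
Unshelve. all: by end_near. Qed.

(** The 1 added to the cosine keeps the integrand nonnegative, as the fundamental theorem on a
    half-line demands. By evenness the integral is twice that over s >= 0, where [prim] is a
    primitive that vanishes at infinity. *)
Lemma integral_expw_1Dcos :
  (\int[mu]_s (expw e s * (1 + cos (a * s)))%:E = (2 * (e^-1 + e / D))%:E)%E.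
Proof.
have c : continuous (fun s : R => 1 + cos (a * s)).
  by move=> s; apply: cvgD; [exact: cvg_cst|exact: continuous_cos_scale].
have cw : continuous (fun s => expw e s * (1 + cos (a * s))).
  by move=> s; apply: cvgM; [exact: continuous_expw|exact: c].
rewrite (@ge0_symfun_integralT _ (fun s => expw e s * (1 + cos (a * s))))//; first last.
- by move=> s; rewrite /= /expw normrN mulrN cosN.
- by move=> s; rewrite mulr_ge0 ?add1cos_ge0// ltW// expw_gt0.
rewrite -set_itvcy (@ge0_continuous_FTC2y _ _ prim 0 0)//; first last.
- move=> s; rewrite in_itv/= andbT => s0; rewrite derive1E.
  by have d := is_derive_prim s; rewrite derive_val /expw gtr0_norm.
- apply: cvg_at_right_filter; apply/differentiable_continuous/derivable1_diffP.
  by have [] := is_derive_prim 0.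
- exact: continuous_subspaceT.
- by move=> s _; rewrite mulr_ge0 ?add1cos_ge0// ltW// expw_gt0.
rewrite -EFinB -EFinM; congr (_%:E); congr (2 * _).
rewrite /prim !mulr0 expR0 cos0 sin0 mulr0 addr0 mulr1 mul1r sub0r; ring.
Qed.

End fourier.

Lemma integrable_expw e : 0 < e -> mu.-integrable (setT : set mR) (EFin \o expw e).
Proof.
move=> e0.
have E : EFin \o expw e = EFin \o (fun s => 2^-1 * (expw e s * (1 + cos (0 * s)))).
  by apply/funext => s /=; rewrite mul0r cos0; congr (_%:E); field.
rewrite E; apply: RintegrableZ => //; apply/integrableP; split.
  apply/measurable_EFinP; apply: continuous_measurable_fun => s.
  apply: cvgM; first exact: continuous_expw.
  by apply: cvgD; [exact: cvg_cst|exact: continuous_cos_scale].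
under eq_integral => s _ do
  rewrite /= ger0_norm ?mulr_ge0 ?add1cos_ge0 ?(ltW (expw_gt0 _ _))//.
by rewrite (integral_expw_1Dcos 0 e0) ltry.
Qed.

Lemma Rintegral_expw_cos_sin (e a : R) : 0 < e ->
  [/\ mu.-integrable (setT : set mR) (EFin \o (fun s => expw e s * cos (a * s))),
      mu.-integrable (setT : set mR) (EFin \o (fun s => expw e s * sin (a * s))),
      \int[mu]_s (expw e s * cos (a * s)) = 2 * e / (e ^+ 2 + a ^+ 2) &
      \int[mu]_s (expw e s * sin (a * s)) = 0].
Proof.
move=> e0; have iw := integrable_expw e0.
have bnd (k : R -> R) : continuous k -> (forall s, `|k s| <= 1) ->
    mu.-integrable (setT : set mR) (EFin \o (fun s => expw e s * k s)).
  move=> ck k1; have mk : measurable_fun (setT : set mR) (k : mR -> mR).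
    exact: continuous_measurable_fun.
  have := Rintegrable_mulbounded measurableT mk iw (fun s _ => k1 s).
  by congr (mu.-integrable _ _); apply/funext => s /=; rewrite mulrC.
have c1 s : `|cos (a * s)| <= 1 by rewrite ler_norml cos_geN1 cos_le1.
have s1 s : `|sin (a * s)| <= 1 by rewrite ler_norml sin_geN1 sin_le1.
have ic := bnd _ (continuous_cos_scale (c := a)) c1.
have is_ := bnd _ (continuous_sin_scale (c := a)) s1.
have E b : \int[mu]_s (expw e s * (1 + cos (b * s))) = 2 * (e^-1 + e / (e ^+ 2 + b ^+ 2)).
  by rewrite /Rintegral integral_expw_1Dcos.
split=> //.
- have := E a; under eq_Rintegral do rewrite mulrDr mulr1.
  rewrite RintegralD//.
  (* At frequency 0 the formula yields twice the integral of the weight alone, which is then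
     cancelled from the formula at [a]. *)
  have := E 0; under eq_Rintegral do rewrite mul0r cos0 mulrC.
  rewrite RintegralZl// expr0n addr0 => E0.
  have -> : \int[mu]_s expw e s = 2 * e^-1.
    apply: (@mulfI _ (1 + 1)); first by rewrite gt_eqF.
    by rewrite E0 expr2 invfM mulrA divff ?gt_eqF// mul1r; ring.
  by rewrite mulrDr => /addrI ->; rewrite mulrA.
- have := @Rintegral_affine _ (-1) 0 _ _ is_; rewrite oppr_eq0 oner_eq0 => /(_ isT).
  rewrite normrN normr1 mul1r => H.
  have : \int[mu]_s (expw e s * sin (a * s)) = - \int[mu]_s (expw e s * sin (a * s)).
    rewrite {1}H -[RHS]mulN1r -RintegralZl//; apply: eq_Rintegral => s _.
    by rewrite addr0 mulN1r /expw normrN mulrN sinN !mulrN mulN1r.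
  by lra.
Qed.

End exponential_weight.

Section tensor.
Context d1 d2 (T1 : measurableType d1) (T2 : measurableType d2) (R : realType).
Variable m1 : {sigma_finite_measure set T1 -> \bar R}.
Variable m2 : {sigma_finite_measure set T2 -> \bar R}.

Lemma Rintegrable_tensor (g : T1 -> R) (h : T2 -> R) :
  m1.-integrable setT (EFin \o g) -> m2.-integrable setT (EFin \o h) ->
  (m1 \x m2)%E.-integrable setT (EFin \o (fun p => g p.1 * h p.2)).
Proof.
move=> gi hi; have mg := Rintegrable_measurable gi; have mh := Rintegrable_measurable hi.
apply/integrable12ltyP.
  by apply/measurable_EFinP; apply: measurable_funM; exact: measurableT_comp.
case/integrableP: gi => mge gi; case/integrableP: hi => mhe hi.
under eq_integral => x _.
  under eq_integral => y _ do rewrite /= normrM EFinM.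
  rewrite ge0_integralZl_EFin//; last by apply/measurable_EFinP; exact: measurableT_comp.
  over.
rewrite ge0_integralZr//; last 2 first.
- by apply/measurable_EFinP; exact: measurableT_comp.
- by apply: integral_ge0 => y _; rewrite lee_fin.
by rewrite lte_mul_pinfty// ?integral_ge0// ge0_fin_numE// integral_ge0.
Qed.

Lemma Rintegral_tensorT (g : T1 -> R) (h : T2 -> R) :
  m1.-integrable setT (EFin \o g) -> m2.-integrable setT (EFin \o h) ->
  \int[(m1 \x m2)%E]_p (g p.1 * h p.2) = (\int[m1]_x g x) * \int[m2]_y h y.
Proof.
move=> gi hi; rewrite (Rintegral_fubini (Rintegrable_tensor gi hi)) -RintegralZr//.
by apply: eq_Rintegral => x _; rewrite /= RintegralZl.
Qed.

End tensor.

(* The library has no canonical sigma-finite structure on leb2, which Fubini's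
   theorem on the product of two planes requires. *)
Section sigma_finite_measure_of.
Context d (T : measurableType d) (R : realType) (m : set T -> \bar R).
Hypotheses (m0 : m set0 = 0%E) (m_ge0 : forall A, (0 <= m A)%E).
Hypotheses (m_sigma : semi_sigma_additive m) (mT : sigma_finite setT m).

HB.instance Definition _ := isMeasure.Build _ _ _ m m0 m_ge0 m_sigma.
HB.instance Definition _ := Measure_isSigmaFinite.Build _ _ _ m mT.

Definition sigma_finite_measure_of : {sigma_finite_measure set T -> \bar R} := m.

End sigma_finite_measure_of.

Section fourier_inversion.
Context {R : realType}.
Local Notation mR := (measurableTypeR R).
Local Notation mu := (@lebesgue_measure R).
Implicit Types (f : R * R -> R) (x y z xi : R * R).

Lemma leb2_sigma_finite : sigma_finite setT (leb2 : set (mR * mR) -> \bar R).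
Proof.
exists (fun n => `[- n%:R, n%:R] `*` `[- n%:R, n%:R]).
  apply/esym; rewrite -subTset => p _; exists (maxn (Num.bound `|p.1|) (Num.bound `|p.2|)) => //.
  split; rewrite /= in_itv/= -ler_norml (le_trans (ltW (unstable.ltr_bound _)))// ler_nat.
    exact: leq_maxl.
  exact: leq_maxr.
by move=> n; split; [exact: measurable_box|exact: leb2_box].
Qed.

Definition plane_measure : {sigma_finite_measure set (mR * mR)%type -> \bar R} :=
  sigma_finite_measure_of (@measure0 _ _ _ leb2) (@measure_ge0 _ _ _ leb2)
    (@measure_semi_sigma_additive _ _ _ leb2) leb2_sigma_finite.

Definition dot x y : R := x.1 * y.1 + x.2 * y.2.

Lemma dotC x y : dot x y = dot y x.
Proof. by rewrite /dot mulrC [_ * y.2]mulrC. Qed.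

Lemma continuous_dot x : continuous (dot x).
Proof.
by move=> y; apply: cvgD; (apply: cvgM; first exact: cvg_cst); [exact: cvg_fst|exact: cvg_snd].
Qed.

Definition lip1 (k : R -> R) : Prop := forall u v, `|k u - k v| <= `|u - v|.

Lemma lip1_derive (k k' : R -> R) : (forall u : R, is_derive u 1 k (k' u)) ->
  (forall u, `|k' u| <= 1) -> lip1 k.
Proof.
move=> dk k1.
have H u v : u < v -> `|k v - k u| <= `|v - u|.
  have ck : {within `[u, v], continuous k}.
    apply: continuous_subspaceT => w; apply/differentiable_continuous/derivable1_diffP.
    by have [] := dk w.
  by move=> uv; have [c _ ->] := MVT uv (fun w _ => dk w) ck; rewrite normrM ler_piMl.
move=> u v; have [uv|vu|->] := ltgtP u v; last by rewrite !subrr.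
  by rewrite distrC [leRHS]distrC H.
exact: H.
Qed.

Lemma lip1_cos : lip1 (@cos R).
Proof.
apply: (lip1_derive (@is_derive_cos R)) => u.
by rewrite normrN ler_norml sin_geN1 sin_le1.
Qed.

Lemma lip1_sin : lip1 (@sin R).
Proof.
by apply: (lip1_derive (@is_derive_sin R)) => u; rewrite ler_norml cos_geN1 cos_le1.
Qed.

Lemma lip1_continuous k : lip1 k -> continuous k.
Proof.
move=> kl u; apply/cvgrPdist_le => e e0; near=> v; apply: le_trans (kl _ _) _.
by near: v; apply: cvgr_dist_le => //; exact: cvg_id.
Unshelve. all: by end_near. Qed.

Lemma Cc2_dot f (k : R -> R) xi : Cc2 f -> continuous k -> Cc2 (fun y => f y * k (dot y xi)).
Proof.
move=> Cf ck; apply: Cc2M => // y.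
apply: (@continuous_comp _ _ _ (fun y => dot y xi) k); last exact: ck.
have -> : (fun y => dot y xi) = dot xi by apply/funext => w; exact: dotC.
exact: continuous_dot.
Qed.

(** Since [f] vanishes outside a square of half-width [A], the integral is Lipschitz in xi with
    constant [C]. Continuity of the coefficients is what the passage to polar coordinates
    requires. *)
Lemma continuous_coef f (k : R -> R) : Cc2 f -> lip1 k ->
  continuous (fun xi => \int[leb2]_y (f y * k (dot y xi))).
Proof.
move=> Cf kl; have ck := lip1_continuous kl; have [cf [A fA]] := Cf.
have fi := Cc2_integrable Cf.
pose C := \int[leb2]_y (`|f y| * A).
have L xi xi' : `|\int[leb2]_y (f y * k (dot y xi)) - \int[leb2]_y (f y * k (dot y xi'))| <=
    C * (`|xi.1 - xi'.1| + `|xi.2 - xi'.2|).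
  have i1 := Cc2_integrable (Cc2_dot xi Cf ck); have i2 := Cc2_integrable (Cc2_dot xi' Cf ck).
  have fAi : leb2.-integrable (setT : set (mR * mR)) (EFin \o (fun y => `|f y| * A)).
    have := RintegrableZ measurableT A (integrable_norm fi); congr (leb2.-integrable _ _).
    by apply/funext => y /=; rewrite mulrC.
  rewrite -RintegralB// (le_trans (le_normr_Rintegral _ _))//; first exact: RintegrableB.
  rewrite -RintegralZr//; apply: le_Rintegral => //.
  - exact/integrable_norm/RintegrableB.
  - have := RintegrableZ measurableT (`|xi.1 - xi'.1| + `|xi.2 - xi'.2|) fAi.
    by congr (leb2.-integrable _ _); apply/funext => y /=; rewrite mulrC.
  move=> y _; rewrite -mulrBr normrM -mulrA; have [->|/fA[y1 y2]] := eqVneq (f y) 0.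
    by rewrite normr0 !mul0r.
  rewrite ler_wpM2l// (le_trans (kl _ _))//.
  rewrite (_ : _ - _ = y.1 * (xi.1 - xi'.1) + y.2 * (xi.2 - xi'.2)); last by rewrite /dot; ring.
  by rewrite (le_trans (ler_normD _ _))// !normrM mulrDr lerD// ler_wpM2r.
move=> xi; apply/cvgrPdist_le => e e0; near=> xi'; apply: le_trans (L _ _) _.
near: xi'; apply: (cvgr_le (0 : R)) => //.
rewrite [X in _ --> X](_ : 0 = C * (`|xi.1 - xi.1| + `|xi.2 - xi.2|)); last first.
  by rewrite !subrr normr0 addr0 mulr0.
apply: cvgM; first exact: cvg_cst.
by apply: cvgD; apply: cvg_norm; (apply: cvgB; first exact: cvg_cst); [exact: cvg_fst|exact: cvg_snd].
Unshelve. all: by end_near. Qed.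

Definition ccoef f xi : R := \int[leb2]_y (f y * cos (dot y xi)).
Definition scoef f xi : R := \int[leb2]_y (f y * sin (dot y xi)).

Definition planew (e : R) xi : R := expw e xi.1 * expw e xi.2.
(** The Fourier transform of [expw e] at frequency [a], not normalised: its total mass is 2 pi. *)
Definition poisson (e a : R) : R := 2 * e / (e ^+ 2 + a ^+ 2).

Lemma planew_integrable (e : R) : 0 < e ->
  leb2.-integrable (setT : set (mR * mR)) (EFin \o planew e).
Proof.
by move=> e0; apply: Rintegrable_tensor; exact: integrable_expw.
Qed.

(** The addition formula splits the integrand into two tensor products; the one with sines
    integrates to 0 by oddness. *)
Lemma Rintegral_planew_cos (e : R) z : 0 < e ->
  \int[leb2]_xi (planew e xi * cos (dot z xi)) = poisson e z.1 * poisson e z.2.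
Proof.
move=> e0; have [c1 s1 C1 S1] := Rintegral_expw_cos_sin z.1 e0.
have [c2 s2 C2 S2] := Rintegral_expw_cos_sin z.2 e0.
have ic := Rintegrable_tensor c1 c2; have is_ := Rintegrable_tensor s1 s2.
transitivity (\int[leb2]_xi
   ((expw e xi.1 * cos (z.1 * xi.1)) * (expw e xi.2 * cos (z.2 * xi.2)) -
    (expw e xi.1 * sin (z.1 * xi.1)) * (expw e xi.2 * sin (z.2 * xi.2)))).
  by apply: eq_Rintegral => xi _; rewrite /planew /dot cosD; ring.
rewrite RintegralB//; apply: etrans (congr2 _ (Rintegral_tensorT c1 c2) (congr1 _ (Rintegral_tensorT s1 s2))) _.
by rewrite C1 C2 S1 S2 mulr0 subr0.
Qed.

Lemma measurable_dot : measurable_fun setT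
  (fun p : (mR * mR) * (mR * mR) => dot p.1 p.2 : mR).
Proof.
by apply: measurable_funD; apply: measurable_funM; apply: measurableT_comp => //;
  apply: measurableT_comp.
Qed.

(** The real part of F f (xi) exp (i x . xi), as F f = [ccoef] - i [scoef]. *)
Definition inversion_kernel f x xi : R :=
  ccoef f xi * cos (dot x xi) + scoef f xi * sin (dot x xi).

Lemma inversion_kernelE f x xi : Cc2 f ->
  inversion_kernel f x xi = \int[leb2]_y (f y * cos (dot (x.1 - y.1, x.2 - y.2) xi)).
Proof.
move=> Cf; have ic := Cc2_integrable (Cc2_dot xi Cf (@continuous_cos R)).
have is_ := Cc2_integrable (Cc2_dot xi Cf (@continuous_sin R)).
rewrite /inversion_kernel /ccoef /scoef -!RintegralZr// -RintegralD//; first last.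
- have := RintegrableZ measurableT (sin (dot x xi)) is_; congr (leb2.-integrable _ _).
  by apply/funext => y /=; rewrite mulrC.
- have := RintegrableZ measurableT (cos (dot x xi)) ic; congr (leb2.-integrable _ _).
  by apply/funext => y /=; rewrite mulrC.
apply: eq_Rintegral => y _ /=.
have -> : dot (x.1 - y.1, x.2 - y.2) xi = dot x xi - dot y xi by rewrite /dot /=; ring.
by rewrite cosB; ring.
Qed.

(** Thanks to the weight, the double integrand is integrable on the product of the two planes, so
    the integrals over xi and y can be exchanged. *)
Lemma weighted_inversion f x (e : R) : Cc2 f -> 0 < e ->
  \int[leb2]_xi (planew e xi * inversion_kernel f x xi) =
  \int[leb2]_y (f y * (poisson e (x.1 - y.1) * poisson e (x.2 - y.2))).
Proof.
move=> Cf e0.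
have fi := Cc2_integrable Cf; have wi := planew_integrable e0.
pose K (p : (mR * mR) * (mR * mR)) : R :=
  cos (dot (x.1 - p.2.1, x.2 - p.2.2) p.1) * (planew e p.1 * f p.2).
have mc : measurable_fun setT
    (fun p : (mR * mR) * (mR * mR) => cos (dot (x.1 - p.2.1, x.2 - p.2.2) p.1) : mR).
  have mcos : measurable_fun (setT : set mR) (@cos R : mR -> mR).
    exact: continuous_measurable_fun (@continuous_cos R).
  apply: (measurableT_comp mcos).
  have m : measurable_fun setT (fun p : (mR * mR) * (mR * mR) =>
      ((x.1 - p.2.1, x.2 - p.2.2) : mR * mR, p.1)).
    apply: measurable_fun_pair => //; apply: measurable_fun_pair;
      by apply: measurable_funB => //; apply: measurableT_comp.
  exact: (measurableT_comp measurable_dot m).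
have b (p : (mR * mR) * (mR * mR)) : setT p ->
    `|cos (dot (x.1 - p.2.1, x.2 - p.2.2) p.1)| <= 1.
  by move=> _; rewrite ler_norml cos_geN1 cos_le1.
have iK : (plane_measure \x plane_measure)%E.-integrable setT (EFin \o K).
  have T := @Rintegrable_tensor _ _ _ _ _ plane_measure plane_measure _ _ wi fi.
  exact: (Rintegrable_mulbounded measurableT mc T b).
have E1 := Rintegral_fubini iK; have E2 := Rintegral_fubini2 iK.
transitivity (\int[leb2]_xi \int[leb2]_y K (xi, y)).
  apply: eq_Rintegral => xi _; rewrite inversion_kernelE// -RintegralZl//.
    by apply: eq_Rintegral => y _; rewrite /K /=; ring.
  have := Rintegrable_mulbounded measurableT (measurable_fun_pair2 xi mc) fi
    (fun y _ => b (xi, y) Logic.I).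
  by congr (leb2.-integrable _ _); apply/funext => y; rewrite /= mulrC.
transitivity (\int[leb2]_y \int[leb2]_xi K (xi, y)); first exact: etrans (esym E1) E2.
apply: eq_Rintegral => y _.
rewrite -(Rintegral_planew_cos (x.1 - y.1, x.2 - y.2) e0) -RintegralZl//.
  by apply: eq_Rintegral => xi _; rewrite /K /=; ring.
have := Rintegrable_mulbounded measurableT (measurable_fun_pair1 y mc) wi
  (fun xi _ => b (xi, y) Logic.I).
by congr (leb2.-integrable _ _); apply/funext => xi; rewrite /= mulrC.
Qed.

End fourier_inversion.

(** * Removal of the weight *)

Section fourier_inversion_limit.
Context {R : realType}.
Local Notation mR := (measurableTypeR R).
Local Notation mu := (@lebesgue_measure R).
Implicit Types (f : R * R -> R) (x y z xi : R * R).

Let eps (n : nat) : R := n.+1%:R^-1.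

Let eps_gt0 n : 0 < eps n. Proof. by rewrite invr_gt0. Qed.

Let eps_cvg0 : eps @ \oo --> (0 : R).
Proof. exact: cvg_harmonic. Qed.

Lemma poisson_ge0 (e a : R) : 0 < e -> 0 <= poisson e a.
Proof. by move=> e0; rewrite divr_ge0 ?addr_ge0 ?sqr_ge0// mulr_ge0// ltW. Qed.

Lemma continuous_poisson (e c : R) : 0 < e -> continuous (fun s => poisson e (c - s)).
Proof.
move=> e0 s; apply: cvgM; first exact: cvg_cst.
apply: cvgV; first by rewrite gt_eqF// ltr_wpDr ?sqr_ge0// exprn_gt0.
apply: cvgD; first exact: cvg_cst.
by under eq_fun do rewrite expr2; rewrite expr2; apply: cvgM;
  (apply: cvgB; [exact: cvg_cst|exact: cvg_id]).
Qed.

Lemma poisson_tail (c dl eta : R) : 0 < dl -> 0 < eta -> \forall n \near \oo,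
  forall s, dl <= `|s - c| -> poisson (eps n) (c - s) <= eta.
Proof.
move=> dl0 eta0; near=> n; move=> s ds.
have en : eps n <= eta * dl ^+ 2 / 2.
  by near: n; apply: (cvgr_le (0 : R)) => //; rewrite divr_gt0// mulr_gt0// exprn_gt0.
have d20 : 0 < eps n ^+ 2 + (c - s) ^+ 2 by rewrite ltr_wpDr ?sqr_ge0// exprn_gt0.
rewrite /poisson ler_pdivrMr// (@le_trans _ _ (eta * dl ^+ 2))//.
  by rewrite -ler_pdivlMl// mulrC.
rewrite ler_pM2l// ler_wpDl ?sqr_ge0// -(real_normK (num_real (c - s))) distrC.
by rewrite lerXn2r ?nnegrE// ltW.
Unshelve. all: by end_near. Qed.

Lemma atan_scale_cvg (d : R) : 0 < d -> (fun n => atan (n.+1%:R * d)) @ \oo --> (pi / 2 : R).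
Proof.
move=> d0; have h1 : (fun n => n.+1%:R * d) @ \oo --> +oo%R.
  rewrite (cvg_shiftS (fun n => n%:R * d)).
  have h2 : r * d @[r --> +oo] --> +oo by apply: gt0_cvgMly => //; exact: cvg_id.
  exact: (@cvg_comp _ _ _ (fun n => n%:R : R) (fun r => r * d) _ _ _ (@cvgr_idn R) h2).
exact: (@cvg_comp _ _ _ (fun n => n.+1%:R * d) (@atan R) _ _ _ h1 (@cvgy_atan R)).
Qed.

(** A primitive is 2 atan ((s - c) / eps). As [c] is strictly inside the interval, each end
    contributes pi in the limit. *)
Lemma poisson_mass (c A : R) : - A < c < A ->
  (fun n => \int[mu]_(s in `[- A, A]) poisson (eps n) (c - s)) @ \oo --> (2 * pi : R).
Proof.
move=> /andP[c1 c2].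
have E n : \int[mu]_(s in `[- A, A]) poisson (eps n) (c - s) =
    2 * atan (n.+1%:R * (A - c)) + 2 * atan (n.+1%:R * (c + A)).
  have dF (s : R) : is_derive s 1 (fun s => 2 * atan (n.+1%:R * (s - c))) (poisson (eps n) (c - s)).
    have d1 : is_derive s 1 (fun s => n.+1%:R * (s - c)) n.+1%:R.
      by apply: is_derive_eq; rewrite subr0 -[RHS]mulr1.
    apply: is_derive_eq (is_deriveZ 2 (@is_derive1_comp _ _ _ _ _ _ (is_derive1_atan _) d1)) _.
    rewrite /poisson /eps -[LHS]/(2 * ((1 + (n.+1%:R * (s - c)) ^+ 2)^-1 * n.+1%:R)).
    rewrite -[(c - s) ^+ 2]sqrrN opprB.
    have n0 : n.+1%:R != 0 :> R by rewrite pnatr_eq0.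
    have D1 : 1 + (n.+1%:R * (s - c)) ^+ 2 != 0 :> R.
      by rewrite gt_eqF// ltr_wpDr ?sqr_ge0.
    move: (n.+1%:R) (s - c) n0 D1 => N d n0 D1; rewrite exprVn.
    have -> : N ^- 2 + d ^+ 2 = (1 + (N * d) ^+ 2) / N ^+ 2 by rewrite exprMn; field.
    by move: (1 + (N * d) ^+ 2) D1 => D D1; field; rewrite D1 n0.
  have cP := continuous_poisson (c := c) (eps_gt0 n).
  have AA : - A < A by lra.
  rewrite (Rintegral_FTC AA cP dF).
  rewrite -[c + A]opprK opprD mulrN atanN mulrN [- c - A]addrC; congr (_ + - (2 * atan (_ * _))).
have h1 : 0 < A - c by lra.
have h2 : 0 < c + A by lra.
under eq_fun do rewrite E.
rewrite (_ : 2 * pi = 2 * (pi / 2) + 2 * (pi / 2)); last by field.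
by apply: cvgD; (apply: cvgM; first exact: cvg_cst); exact: atan_scale_cvg.
Qed.

(** Both sides of [weighted_inversion] converge as the weight tends to 1: the left by domination,
    since F f is integrable through the hypothesis on the kernel, the right because Poisson kernels
    form an approximate identity. Each coordinate contributes a mass 2 pi. *)
Lemma Rintegral_inversion_kernel f x : Cc2 f ->
  leb2.-integrable (setT : set (mR * mR)) (EFin \o inversion_kernel f x) ->
  \int[leb2]_xi inversion_kernel f x xi = (2 * pi) ^+ 2 * f x.
Proof.
move=> Cf Hi; have [cf [a fa]] := Cf.
(* Large enough for the square to contain the support of [f] and to have [x] in its interior. *)
pose A : R := `|a| + `|x.1| + `|x.2| + 1.
have [x1 x2] : - A < x.1 < A /\ - A < x.2 < A.
  by rewrite -!ltr_norml /A; split; move: (normr_ge0 a) (normr_ge0 x.1) (normr_ge0 x.2) => ? ? ?; lra.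
have fA p : f p != 0 -> (`[- A, A] `*` `[- A, A]) p.
  move=> /fa[p1 p2]; split; rewrite /= in_itv/= -ler_norml /A.
    by move: (ler_norm a) (normr_ge0 x.1) (normr_ge0 x.2) => ? ? ?; lra.
  by move: (ler_norm a) (normr_ge0 x.1) (normr_ge0 x.2) => ? ? ?; lra.
have [M fM] := continuous_box_bounded (- A) A (- A) A cf.
have xb : (`[- A, A] `*` `[- A, A]) x.
  by move: x1 x2 => /andP[? ?] /andP[? ?]; split; rewrite /= in_itv/= !ltW.
have R_ : (fun n => \int[leb2]_y (f y * (poisson (eps n) (x.1 - y.1) * poisson (eps n) (x.2 - y.2))))
    @ \oo --> f x * (2 * pi * (2 * pi)).
  have E n : \int[leb2]_y (f y * (poisson (eps n) (x.1 - y.1) * poisson (eps n) (x.2 - y.2))) =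
     \int[leb2]_(y in `[- A, A] `*` `[- A, A])
       (f y * (poisson (eps n) (x.1 - y.1) * poisson (eps n) (x.2 - y.2))).
    rewrite [RHS]Rintegral_mkcond; apply: eq_Rintegral => y _; rewrite /patch; case: ifPn => //.
    rewrite notin_setE => yA; have [->|/fA//] := eqVneq (f y) 0; by rewrite mul0r.
  under eq_fun do rewrite E.
  apply: (@approximate_identity _ (fun n s => poisson (eps n) (x.1 - s))
    (fun n s => poisson (eps n) (x.2 - s)) f (- A) A (- A) A M).
  - by move=> n; exact: continuous_poisson.
  - by move=> n; exact: continuous_poisson.
  - by move=> n s; exact: poisson_ge0.
  - by move=> n s; exact: poisson_ge0.
  - exact: poisson_mass.
  - exact: poisson_mass.
  - move=> dl eta dl0 eta0; apply: filterS (poisson_tail x.1 dl0 eta0) => n h s _; exact: h.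
  - move=> dl eta dl0 eta0; apply: filterS (poisson_tail x.2 dl0 eta0) => n h s _; exact: h.
  - by apply: measurable_funTS; exact: continuous_measurable_fun2.
  - exact: fM.
  - exact: fM.
  - exact: cf.
have L_ : (fun n => \int[leb2]_xi (planew (eps n) xi * inversion_kernel f x xi)) @ \oo -->
    \int[leb2]_xi inversion_kernel f x xi.
  have mH := Rintegrable_measurable Hi.
  have mS : measurable (setT : set (mR * mR)) := measurableT.
  apply: (@Rintegral_dominated _ _ _ _ _ mS (fun n xi => planew (eps n) xi * inversion_kernel f x xi)
    (inversion_kernel f x) (fun xi => `|inversion_kernel f x xi|)).
  - move=> n; apply: measurable_funM; last exact: mH.
    exact: Rintegrable_measurable (planew_integrable (eps_gt0 n)).
  - exact: mH.
  - apply/aeW => xi _; rewrite -[X in _ --> X]mul1r; apply: cvgM; last exact: cvg_cst.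
    have w1 (s : R) : (fun n => expw (eps n) s) @ \oo --> (1 : R).
      rewrite /expw -(expR0 R) -(mul0r `|s|) -(oppr0 R).
      apply: continuous_cvg; first exact: continuous_expR.
      by apply: cvgM; [apply: cvgN; exact: eps_cvg0|exact: cvg_cst].
    by rewrite -[X in _ --> X]mul1r; apply: cvgM.
  - exact: integrable_norm.
  - move=> n xi _; rewrite normrM ler_piMl// ger0_norm; last by rewrite mulr_ge0// ltW// expw_gt0.
    by rewrite mulr_ile1// ?expw_le1 ?(ltW (eps_gt0 n)) ?(ltW (expw_gt0 _ _)).
have E : (fun n => \int[leb2]_xi (planew (eps n) xi * inversion_kernel f x xi)) =
   (fun n => \int[leb2]_y (f y * (poisson (eps n) (x.1 - y.1) * poisson (eps n) (x.2 - y.2)))).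
  by apply/funext => n; exact: weighted_inversion.
rewrite E in L_; rewrite (@cvg_unique _ (@Rhausdorff R) _ _ _ _ L_ R_).
by rewrite expr2 mulrC.
Qed.

End fourier_inversion_limit.

(** * Filtered back projection *)

Section filtered_back_projection.
Context {R : realType}.
Local Notation mR := (measurableTypeR R).
Local Notation mu := (@lebesgue_measure R).
Implicit Types (f u : R * R -> R) (x xi : R * R).

Lemma ReZ (a : R) (z : R[i]) : complex.Re (a%:C * z) = a * complex.Re z.
Proof. by case: z => c d; rewrite /= mul0r subr0. Qed.

Lemma ImZ (a : R) (z : R[i]) : complex.Im (a%:C * z) = a * complex.Im z.
Proof. by case: z => c d; rewrite /= mul0r addr0. Qed.

Lemma ReM_cexpi (z : R[i]) (r : R) :
  complex.Re (z * cexpi r) = complex.Re z * cos r - complex.Im z * sin r.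
Proof. by case: z. Qed.

Lemma ImM_cexpi (z : R[i]) (r : R) :
  complex.Im (z * cexpi r) = complex.Re z * sin r + complex.Im z * cos r.
Proof. by case: z. Qed.

Lemma Re_Cintegral d (T : measurableType d) (m : {measure set T -> \bar R}) (D : set T)
  (h : T -> R[i]) : complex.Re (Cintegral m D h) = \int[m]_(s in D) complex.Re (h s).
Proof. by []. Qed.

Lemma Im_Cintegral d (T : measurableType d) (m : {measure set T -> \bar R}) (D : set T)
  (h : T -> R[i]) : complex.Im (Cintegral m D h) = \int[m]_(s in D) complex.Im (h s).
Proof. by []. Qed.

Lemma Cintegral_eq0 d (T : measurableType d) (m : {measure set T -> \bar R}) (D : set T)
  (h : T -> R[i]) : (forall s, D s -> h s = 0) -> Cintegral m D h = 0.
Proof.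
by move=> h0; rewrite /Cintegral !Rintegral_eq0// => s /h0 ->.
Qed.

Lemma fourier2E f xi : Cc2 f -> fourier2 f xi = ccoef f xi -i* scoef f xi.
Proof.
move=> Cf; rewrite /fourier2 /Cintegral; congr (_ +i* _).
  by apply: eq_Rintegral => y _; rewrite ReZ /= cosN.
rewrite /scoef -[RHS]mulN1r -RintegralZl//.
  by apply: eq_Rintegral => y _; rewrite ImZ /= sinN mulrN mulN1r.
exact: Cc2_integrable (Cc2_dot xi Cf (@continuous_sin R)).
Qed.

(** The Fourier slice theorem. It is stated for any [h] that agrees with [radon f] on the line, so
    that it applies to the extension by zero of a weak solution. *)
Lemma fourier1_radon f (theta S : R) (h : R * R -> R) : Cc2 f -> - pi < theta < pi ->
  (forall t, h (theta, t) = radon f (theta, t)) ->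
  fourier1 (fun q => (h q)%:C) (theta, S) =
  ccoef f (S * cos theta, S * sin theta) -i* scoef f (S * cos theta, S * sin theta).
Proof.
move=> Cf th hE; rewrite /fourier1 /Cintegral.
have E (y : R * R) : (y.1 * cos theta + y.2 * sin theta) * S = dot y (S * cos theta, S * sin theta).
  by rewrite /dot /=; ring.
have cc : continuous (fun t : R => cos (t * S)).
  move=> t; apply: (@continuous_comp _ _ _ (fun t : R => t * S) (@cos R)); last exact: continuous_cos.
  by apply: cvgM; [exact: cvg_id|exact: cvg_cst].
have cs : continuous (fun t : R => - sin (t * S)).
  move=> t; apply: cvgN.
  apply: (@continuous_comp _ _ _ (fun t : R => t * S) (@sin R)); last exact: continuous_sin.
  by apply: cvgM; [exact: cvg_id|exact: cvg_cst].
congr (_ +i* _).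
  transitivity (\int[mu]_t (radon f (theta, t) * cos (t * S))).
    by apply: eq_Rintegral => t _; rewrite ReZ /= cosN hE.
  by rewrite (radon_proj Cf cc th).2; apply: eq_Rintegral => y _; rewrite E.
transitivity (\int[mu]_t (radon f (theta, t) * - sin (t * S))).
  by apply: eq_Rintegral => t _; rewrite ImZ /= sinN hE.
rewrite (radon_proj Cf cs th).2 /scoef -[RHS]mulN1r -RintegralZl//.
  by apply: eq_Rintegral => y _; rewrite E mulrN mulN1r.
exact: Cc2_integrable (Cc2_dot _ Cf (@continuous_sin R)).
Qed.

(** The imaginary part of F f (xi) exp (i x . xi), odd in xi because [f] is real. *)
Definition odd_kernel f x xi : R :=
  ccoef f xi * sin (dot x xi) - scoef f xi * cos (dot x xi).

Lemma coefN f xi : Cc2 f ->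
  ccoef f (- xi.1, - xi.2) = ccoef f xi /\ scoef f (- xi.1, - xi.2) = - scoef f xi.
Proof.
move=> Cf; have E y : dot y (- xi.1, - xi.2) = - dot y xi by rewrite /dot /=; ring.
split; first by apply: eq_Rintegral => y _; rewrite E cosN.
rewrite -[RHS]mulN1r -RintegralZl//; last exact: Cc2_integrable (Cc2_dot _ Cf (@continuous_sin R)).
by apply: eq_Rintegral => y _; rewrite E sinN mulrN mulN1r.
Qed.

(** Serves the end angles - pi and pi, which are outside [Omega]: there the transform of the
    extension by zero is 0, whatever the formula valid in between would give. *)
Lemma Rintegral_itv_ends (P Q : R -> R) (a b : R) :
  mu.-integrable `[a, b] (EFin \o P) -> (forall s : R, a < s < b -> Q s = P s) ->
  Q a = 0 -> Q b = 0 ->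
  mu.-integrable `[a, b] (EFin \o Q) /\
  \int[mu]_(x in `[a, b]) Q x = \int[mu]_(x in `[a, b]) P x.
Proof.
move=> Pi QP Qa Qb.
have mI : measurable (`[a, b]%classic : set mR) := measurable_itv _.
have mO : measurable (`]a, b[%classic : set mR) := measurable_itv _.
have Po : mu.-integrable (`]a, b[ : set mR) (EFin \o P).
  by apply: integrableS Pi => //; exact: subset_itv_oo_cc.
have Qi : mu.-integrable (`[a, b] : set mR) (EFin \o Q).
  have Ps : mu.-integrable (`[a, b] : set mR) (EFin \o (P \_ `]a, b[)).
    by apply: integrableS ((Rintegrable_patch _ _ mO).1 Po).
  apply: eq_integrable Ps => // x /set_mem; rewrite /= in_itv/= => /andP[ax xb].
  rewrite /patch; case: ifPn => [/set_mem|]; first by rewrite /= in_itv/= => /QP ->.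
  rewrite notin_setE /= in_itv/= => /negP; rewrite negb_and -!leNgt => /orP[xa|bx].
    by rewrite (_ : x = a) ?Qa//; apply/eqP; rewrite eq_le xa.
  by rewrite (_ : x = b) ?Qb//; apply/eqP; rewrite eq_le bx andbT.
split=> //; apply: Rintegral_ae_eq => //.
- exact: Rintegrable_measurable Qi.
- exact: Rintegrable_measurable Pi.
- have [N [mN N0 PN]] := negligibleU (ae_neq a) (ae_neq b).
  exists N; split=> // s ns; apply: PN; apply: contrapT => /not_orP[/contrapT sa /contrapT sb].
  apply: ns; rewrite /= in_itv/= => /andP[as_ s_b]; apply: QP.
  by rewrite !lt_neqAle as_ s_b sb eq_sym sa.
Qed.

Section reconstruction.
Variables (f u : R * R -> R).
Hypothesis Cf : Cc2 f.
Hypothesis cI : leb2.-integrable (setT : set (mR * mR)) (EFin \o ccoef f).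
Hypothesis sI : leb2.-integrable (setT : set (mR * mR)) (EFin \o scoef f).
Hypothesis uF : forall theta t : R, - pi < theta < pi ->
  zero_ext u (theta, t) = radon f (theta, t).

Let cc : continuous (ccoef f). Proof. exact: continuous_coef lip1_cos. Qed.
Let cs : continuous (scoef f). Proof. exact: continuous_coef lip1_sin. Qed.

Lemma rampE (theta S : R) : - pi < theta < pi ->
  ramp_fourier1 u (theta, S) = polar (ccoef f) (theta, S) -i* polar (scoef f) (theta, S).
Proof.
move=> th; rewrite /ramp_fourier1 (fourier1_radon S Cf th); last by move=> t; exact: uF.
by rewrite /polar /=; apply/eqP; rewrite eq_complex /= !mul0r subr0 addr0 mulrN !eqxx.
Qed.

Lemma ramp_boundary (theta S : R) : ~ (- pi < theta < pi) -> ramp_fourier1 u (theta, S) = 0.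
Proof.
move=> th; have z t : zero_ext u (theta, t) = 0.
  rewrite /zero_ext /patch; case: ifPn => // /set_mem[/=]; by rewrite in_itv/=.
rewrite /ramp_fourier1 /fourier1 Cintegral_eq0 ?mulr0// => t _.
by rewrite z mul0r.
Qed.

Let kernel_facts (k1 k2 : R -> R) (x : R * R) : continuous k1 -> continuous k2 ->
  (forall s, `|k1 s| <= 1) -> (forall s, `|k2 s| <= 1) ->
  continuous (fun xi => ccoef f xi * k1 (dot x xi) + scoef f xi * k2 (dot x xi)) /\
  leb2.-integrable (setT : set (mR * mR))
    (EFin \o (fun xi => ccoef f xi * k1 (dot x xi) + scoef f xi * k2 (dot x xi))).
Proof.
move=> ck1 ck2 k11 k21.
have c1 : continuous (fun xi => k1 (dot x xi)).
  by move=> xi; apply: (@continuous_comp _ _ _ (dot x) k1); [exact: continuous_dot|exact: ck1].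
have c2 : continuous (fun xi => k2 (dot x xi)).
  by move=> xi; apply: (@continuous_comp _ _ _ (dot x) k2); [exact: continuous_dot|exact: ck2].
split; first by move=> xi; apply: cvgD; apply: cvgM; [exact: cc|exact: c1|exact: cs|exact: c2].
have m1 := continuous_measurable_fun2 c1; have m2 := continuous_measurable_fun2 c2.
have i1 := Rintegrable_mulbounded measurableT m1 cI (fun xi _ => k11 (dot x xi)).
have i2 := Rintegrable_mulbounded measurableT m2 sI (fun xi _ => k21 (dot x xi)).
have := RintegrableD measurableT i1 i2; congr (leb2.-integrable _ _).
by apply/funext => xi /=; congr (_%:E); congr (_ + _); rewrite mulrC.
Qed.

Let inversion_facts x : continuous (inversion_kernel f x) /\
  leb2.-integrable (setT : set (mR * mR)) (EFin \o inversion_kernel f x).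
Proof.
apply: (kernel_facts x (@continuous_cos R) (@continuous_sin R)) => s.
  by rewrite ler_norml cos_geN1 cos_le1.
by rewrite ler_norml sin_geN1 sin_le1.
Qed.

Let odd_facts x : continuous (odd_kernel f x) /\
  leb2.-integrable (setT : set (mR * mR)) (EFin \o odd_kernel f x).
Proof.
have cN : continuous (fun s : R => - cos s) by move=> s; apply: cvgN; exact: continuous_cos.
have E : odd_kernel f x =
    (fun xi => ccoef f xi * sin (dot x xi) + scoef f xi * - cos (dot x xi)).
  by apply/funext => xi; rewrite mulrN.
rewrite E; apply: (kernel_facts x (@continuous_sin R) cN) => s.
  by rewrite ler_norml sin_geN1 sin_le1.
by rewrite normrN ler_norml cos_geN1 cos_le1.
Qed.

(** The frequency S acts as the signed radius: |S| is the Jacobian, and (x_1 cos theta + x_2 sin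
    theta) S is the scalar product of x with the point (S cos theta, S sin theta). *)
Lemma inv_rampE x (theta : R) : - pi < theta < pi ->
  inv_fourier1 (ramp_fourier1 u) (theta, x.1 * cos theta + x.2 * sin theta) =
  ((2 * pi)^-1 * \int[mu]_s polar (inversion_kernel f x) (theta, s)) +i*
  ((2 * pi)^-1 * \int[mu]_s polar (odd_kernel f x) (theta, s)).
Proof.
move=> th; rewrite /inv_fourier1; apply/eqP; rewrite eq_complex ReZ ImZ Re_Cintegral Im_Cintegral.
have E S : (x.1 * cos theta + x.2 * sin theta) * S = dot x (S * cos theta, S * sin theta).
  by rewrite /dot /=; ring.
apply/andP; split; apply/eqP; congr (_ * _); apply: eq_Rintegral => S _; rewrite rampE//.
  by rewrite ReM_cexpi [_ * S]E /polar /inversion_kernel /=; ring.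
by rewrite ImM_cexpi [_ * S]E /polar /odd_kernel /=; ring.
Qed.

Lemma inv_ramp_boundary (theta r : R) : ~ (- pi < theta < pi) ->
  inv_fourier1 (ramp_fourier1 u) (theta, r) = 0.
Proof.
move=> th; rewrite /inv_fourier1 Cintegral_eq0 ?mulr0// => S _.
by rewrite (ramp_boundary _ th) mul0r.
Qed.

Lemma ramp_integrable : {ae mu, forall theta : mR, - pi < theta < pi ->
  Cintegrable mu setT (fun S : R => ramp_fourier1 u (theta, S))}.
Proof.
have [ae1 _ _] := polar_fubini cc cI; have [ae2 _ _] := polar_fubini cs sI.
apply: filterS2 ae1 ae2 => theta h1 h2 th.
have th' : - pi <= theta <= pi by move: th => /andP[? ?]; rewrite !ltW.
split.
  by apply: eq_integrable (h1 th') => // S _; rewrite rampE.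
have := RintegrableZ measurableT (-1) (h2 th').
by congr (mu.-integrable _ _); apply/funext => S; rewrite rampE//= mulN1r.
Qed.

(* The polar odd kernel is odd in the radial variable, so that its radial
   integral vanishes wherever it converges. *)
Lemma Rintegral_polar_odd x :
  \int[mu]_(theta in `[- pi, pi]) \int[mu]_s polar (odd_kernel f x) (theta, s) = 0.
Proof.
have [cO iO] := odd_facts x; have [ae1 i1 _] := polar_fubini cO iO.
transitivity (\int[mu]_(s in `[- pi, pi]) (0 : R)); last by rewrite Rintegral_eq0.
have mI : measurable (`[- pi, pi]%classic : set mR) := measurable_itv _.
apply: (Rintegral_ae_eq mI) => //; first exact: Rintegrable_measurable i1.
apply: filterS ae1 => theta h th; have {}h := h th.
have := @Rintegral_affine _ (-1) 0 _ _ h; rewrite oppr_eq0 oner_eq0 => /(_ isT).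
rewrite normrN normr1 mul1r => H.
set I := \int[mu]_s _ in H *.
have : I = - I.
  rewrite {1}H -[RHS]mulN1r -RintegralZl//; apply: eq_Rintegral => s _.
  rewrite addr0 !mulN1r /polar /= normrN -mulrN; congr (_ * _).
  have [c1 s1] := coefN (s * cos theta, s * sin theta) Cf.
  have d1 : dot x (- (s * cos theta), - (s * sin theta)) = - dot x (s * cos theta, s * sin theta).
    by rewrite /dot /=; ring.
  by rewrite /odd_kernel !mulNr c1 s1 d1 sinN cosN; ring.
by lra.
Qed.

(** The constants combine to (4 pi)^-1 * (2 pi)^-1 * 2 * (2 pi)^2 = 1: the normalisation of the
    theorem, the inverse transform in one variable, the double covering by polar coordinates and
    Fourier inversion in the plane. *)
Lemma back_projection_facts x :
  Cintegrable mu `[- pi, pi] (fun theta : R => inv_fourier1 (ramp_fourier1 u)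
    (theta, x.1 * cos theta + x.2 * sin theta)) /\
  (f x)%:C = ((4 * pi)^-1)%:C * back_projection (inv_fourier1 (ramp_fourier1 u)) x.
Proof.
have [cH iH] := inversion_facts x; have [cO iO] := odd_facts x.
have [_ jH eH] := polar_fubini cH iH; have [_ jO _] := polar_fubini cO iO.
have mI : measurable (`[- pi, pi]%classic : set mR) := measurable_itv _.
have kH := RintegrableZ mI (2 * pi)^-1 jH; have kO := RintegrableZ mI (2 * pi)^-1 jO.
have nm : ~ (- pi < (- pi : R) < pi) by rewrite ltxx.
have np : ~ (- pi < (pi : R) < pi) by rewrite ltxx andbF.
pose Q theta := inv_fourier1 (ramp_fourier1 u) (theta, x.1 * cos theta + x.2 * sin theta).
have [qH qHE] := @Rintegral_itv_ends _ (fun theta => complex.Re (Q theta)) _ _ kH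
  (fun theta th => congr1 (@complex.Re R) (inv_rampE x th))
  (congr1 (@complex.Re R) (inv_ramp_boundary _ nm)) (congr1 (@complex.Re R) (inv_ramp_boundary _ np)).
have [qO qOE] := @Rintegral_itv_ends _ (fun theta => complex.Im (Q theta)) _ _ kO
  (fun theta th => congr1 (@complex.Im R) (inv_rampE x th))
  (congr1 (@complex.Im R) (inv_ramp_boundary _ nm)) (congr1 (@complex.Im R) (inv_ramp_boundary _ np)).
split; first by [].
rewrite /back_projection /Cintegral qHE qOE !RintegralZl// Rintegral_polar_odd eH.
rewrite (Rintegral_inversion_kernel Cf iH) mulr0.
apply/eqP; rewrite eq_complex ReZ ImZ /= mulr0 eqxx andbT; apply/eqP.
by move: (lt0r_neq0 (@pi_gt0 R)); move: (@pi R) => P P0; field; rewrite P0.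
Qed.

End reconstruction.

End filtered_back_projection.

(** Integrals are total operations, so the formula alone would not express their convergence; the
    integrability clauses do. Existence is witnessed by [radon f], and every continuous weak
    solution agrees with it on [Omega]. *)
Theorem theorem1 (R : realType) (lambda : R) (f : R * R -> R)
    (lambda_gt0 : 0 < lambda)
    (f_L1 : leb2.-integrable unit_ball (fun x => (f x)%:E))
    (f_cont : {within closure unit_ball, continuous f})
    (f_compact : compact (closure [set x | f x != 0]))
    (f_supp : closure [set x | f x != 0] `<=` unit_ball)
    (f_ext : forall x, ~ unit_ball x -> f x = 0)
    (Ff_L1 : Cintegrable leb2 setT (fourier2 f))
    (Rf_C2 : Ck_closure 2 Omega (radon f)) :
  [/\ exists u : R * R -> R,
        weak_solution (radon_lap lambda f) u /\ continuous_torus u,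
      forall u v : R * R -> R,
        weak_solution (radon_lap lambda f) u ->
        weak_solution (radon_lap lambda f) v ->
        {ae leb2, forall p, T2 p -> u p = v p} &
      forall u : R * R -> R, weak_solution (radon_lap lambda f) u ->
        continuous_torus u ->
        [/\ {ae lebesgue_measure, forall theta : R, - pi < theta < pi ->
              Cintegrable lebesgue_measure setT
                (fun S : R => ramp_fourier1 u (theta, S))},
            forall x : R * R, Cintegrable lebesgue_measure `[- pi, pi]
              (fun theta : R => inv_fourier1 (ramp_fourier1 u)
                (theta, x.1 * cos theta + x.2 * sin theta)) &
            forall x : R * R,
              (f x)%:C = ((4 * pi)^-1)%:C *
                back_projection (inv_fourier1 (ramp_fourier1 u)) x]].
Proof.
have l0 : lambda != 0 by rewrite gt_eqF.
have cf := continuous_zero_extension f_cont f_supp.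
have [r r01 fr] := compact_support_radius f_compact f_supp cf.
have Cf : Cc2 f.
  split=> //; exists 1 => p fp.
  have : p.1 ^+ 2 + p.2 ^+ 2 < 1 by apply: contrapT => /f_ext/eqP; rewrite (negbTE fp).
  move=> p1; split; rewrite -(@expr_le1 _ 2)// real_normK ?num_real//.
    by rewrite (le_trans _ (ltW p1))// lerDl sqr_ge0.
  by rewrite (le_trans _ (ltW p1))// lerDr sqr_ge0.
have [CF _] := Rf_C2.
have [cF F0 wF] := radon_weak_solution l0 Cf r01 fr CF.
have s1 : Num.sqrt r < 1 by move: r01 => /andP[r0 r1]; rewrite -sqrtr1 ltr_sqrt.
have cI : leb2.-integrable setT (EFin \o ccoef f).
  by apply: eq_integrable Ff_L1.1 => // xi _; rewrite fourier2E.
have sI : leb2.-integrable setT (EFin \o scoef f).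
  have := RintegrableZ measurableT (-1) Ff_L1.2; congr (leb2.-integrable _ _).
  apply/funext => xi; rewrite -[LHS]/((-1 * complex.Im (fourier2 f xi))%:E).
  by rewrite (fourier2E xi Cf)/= mulN1r opprK.
split.
- exists (radon f); split=> //; split.
  + exact: continuous_subspaceT.
  + by move=> t _; exact: glide_inv_periodic (mulr1 1) (radon_glide Cf).
  + by move=> theta _; rewrite !F0//= ?normrN normr1.
- exact: weak_solution_unique.
- move=> u wu cu.
  have uF := continuous_torus_ae_eq cu cF (weak_solution_unique wu wF).
  have zF := zero_ext_radon s1 F0 uF.
  split; first exact: (ramp_integrable Cf cI sI zF).
    by move=> x; have [] := back_projection_facts Cf cI sI zF x.
  by move=> x; have [] := back_projection_facts Cf cI sI zF x.
Qed.
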